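(* Let $m,a\ge0$ and $\ell\ge1$ be integers, and let $\mathcal{B}^0_\ell(m,a)$ be the arrangement in $\mathbb{R}^\ell$ consisting of the hyperplanes $x_i+x_j=s$ and $x_i-x_j=s$ for $1\le i<j\le\ell$ and integers $-a\le s\le a$, and $x_i=s$ for $1\le i\le\ell$ and integers $-m\le s\le m$. Then the cone $\mathbf{c}\mathcal{B}^0_\ell(m,a)$ is flag-accurate. In particular, the extended Catalan arrangement $\mathrm{Cat}^m(B_\ell)=\mathcal{B}^0_\ell(m,m)$ of type $B_\ell$ has flag-accurate cone with exponents $(1,\ 2m\ell+2i-1)_{i=1}^{\ell}$, i.e. $1,2m\ell+1,2m\ell+3,\dots,2m\ell+2\ell-1$.
   Context: For an affine arrangement $\mathcal{A}$ in $\mathbb{R}^\ell$, its cone $\mathbf{c}\mathcal{A}$ is the central arrangement in $V'=\mathbb{R}^{\ell+1}$ (extra coordinate $z$) consisting of the hyperplanes $a_1x_1+\dots+a_\ell x_\ell=dz$ for each hyperplane $a_1x_1+\dots+a_\ell x_\ell=d$ of $\mathcal{A}$, together with $z=0$. For a central arrangement $\mathcal{A}$ in $W=\mathbb{R}^n$: $L(\mathcal{A})$ is the set of intersections of subsets of $\mathcal{A}$ (including $W$); $\mathcal{A}^X=\{H\cap X:H\in\mathcal{A},X\not\subseteq H\}$; $\mathcal{A}$ is free if $D(\mathcal{A})=\{\theta\in\mathrm{Der}(S):\theta(\alpha_H)\in\alpha_HS\ \forall H\}$ is free over $S=\mathbb{R}[x_1,\dots,x_n]$, exponents being degrees of a homogeneous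 basis. $\mathcal{A}$ is flag-accurate if it is free with exponents $e_1\le\dots\le e_n$ and there is a flag $X_1\subseteq\dots\subseteq X_n=W$ in $L(\mathcal{A})$ with $\dim X_d=d$ and $\mathcal{A}^{X_d}$ free with exponents $(e_1,\dots,e_d)$ for all $d$. *)

(* Defs.v *)
From HB Require Import structures.
From mathcomp Require Import all_boot all_order all_algebra.
From mathcomp Require Import reals.
From mathcomp Require Import mpoly zify.

Set Implicit Arguments.
Unset Strict Implicit.
Unset Printing Implicit Defensive.

Import Order.TTheory GRing.Theory Num.Theory.
Local Open Scope ring_scope.

(* Arrangements are finite sets of subspaces of 'rV_n, given as lists of which
   only the members matter: neither order nor multiplicity is ever used. *)
Definition arrangement (R : realType) (n : nat) := seq {vspace 'rV[R]_n}.

(* The kernel of the linear form with coefficient column c. *)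
Definition hyperplane (R : realType) (n : nat) (c : 'cV[R]_n) :
    {vspace 'rV[R]_n} :=
  lker (linfun (mulmxr c : 'rV[R]_n -> 'M[R]_1)).

Lemma mem_hyperplane (R : realType) (n : nat) (c : 'cV[R]_n) (v : 'rV[R]_n) :
  (v \in hyperplane c) = (v *m c == 0).
Proof. by rewrite memv_ker lfunE. Qed.

Definition linear_form (R : realType) (n : nat) (c : 'cV[R]_n) : {mpoly R[n]} :=
  \sum_(i < n) c i 0 *: 'X_i.

(* Elements of Der(S), S = {mpoly R[n]}; R-linearity is part of the type. *)
Definition is_derivation (R : realType) (n : nat)
    (theta : {linear {mpoly R[n]} -> {mpoly R[n]}}) : Prop :=
  forall p q, theta (p * q) = theta p * q + p * theta q.

(* Quantifying over all forms c that define H is harmless: they are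
   proportional to one another. *)
Definition in_D (R : realType) (n : nat) (A : arrangement R n)
    (theta : {linear {mpoly R[n]} -> {mpoly R[n]}}) : Prop :=
  is_derivation theta /\
  forall (H : {vspace 'rV[R]_n}) (c : 'cV[R]_n),
    H \in A -> H = hyperplane c ->
    exists g : {mpoly R[n]}, theta (linear_form c) = linear_form c * g.

Definition is_D_basis (R : realType) (n : nat) (A : arrangement R n) (k : nat)
    (theta : 'I_k -> {linear {mpoly R[n]} -> {mpoly R[n]}}) : Prop :=
  [/\ forall i, in_D A (theta i),
      forall eta, in_D A eta ->
        exists f : 'I_k -> {mpoly R[n]},
          forall p, eta p = \sum_(i < k) f i * theta i p
    & forall f : 'I_k -> {mpoly R[n]},
        (forall p, \sum_(i < k) f i * theta i p = 0) -> forall i, f i = 0].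

(* The degree is the polynomial degree: that of the coefficients theta(x_j),
   so that the Euler derivation has degree 1. *)
Definition homogeneous_derivation (R : realType) (n : nat) (d : nat)
    (theta : {linear {mpoly R[n]} -> {mpoly R[n]}}) : Prop :=
  forall j : 'I_n, theta 'X_j \is d.-homog.

Definition free_with_exponents (R : realType) (n : nat) (A : arrangement R n)
    (e : seq nat) : Prop :=
  exists theta : 'I_(size e) -> {linear {mpoly R[n]} -> {mpoly R[n]}},
    is_D_basis A theta /\
    forall i : 'I_(size e), homogeneous_derivation (nth 0%N e i) (theta i).

Definition in_L (R : realType) (n : nat) (A : arrangement R n)
    (X : {vspace 'rV[R]_n}) : Prop :=
  exists2 B : arrangement R n,
    {subset B <= A} & X = (\bigcap_(H <- B) H)%VS.

(* Linear coordinates u |-> u *m subspace_frame X on a subspace X; freeness and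
   exponents do not depend on the choice of the basis. *)
Definition subspace_frame (R : realType) (n : nat) (X : {vspace 'rV[R]_n}) :
    'M[R]_(\dim X, n) :=
  \matrix_(i < \dim X) (vbasis X)`_i.

(* The arrangement of the H :&: X in X, transported to R^(dim X) by the above
   coordinates. *)
Definition restriction (R : realType) (n : nat) (A : arrangement R n)
    (X : {vspace 'rV[R]_n}) : arrangement R (\dim X) :=
  [seq (linfun (mulmxr (subspace_frame X) : 'rV[R]_(\dim X) -> 'rV[R]_n)
          @^-1: (H :&: X))%VS
     | H <- A & ~~ (X <= H)%VS].

Definition flag_accurate_with (R : realType) (n : nat) (A : arrangement R n)
    (e : seq nat) : Prop :=
  [/\ size e = n, sorted leq e, free_with_exponents A e &
    exists X : nat -> {vspace 'rV[R]_n},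
      [/\ X n = fullv,
          forall d, (1 <= d < n)%N -> (X d <= X d.+1)%VS
        & forall d, (1 <= d <= n)%N ->
            [/\ in_L A (X d), \dim (X d) = d
              & free_with_exponents (restriction A (X d)) (take d e)]]].

Definition flag_accurate (R : realType) (n : nat) (A : arrangement R n) :
    Prop :=
  exists e : seq nat, flag_accurate_with A e.

(* Arrangements are again lists of which only the members matter.  The pair
   (c, d) stands for the affine hyperplane x *m c = d. *)
Definition affine_arrangement (R : realType) (l : nat) :=
  seq ('cV[R]_l * R).

(* Points of R^(l+1) are row_mx x z, the last coordinate being z. *)
Definition cone (R : realType) (l : nat) (A : affine_arrangement R l) :
    arrangement R (l + 1) :=
  hyperplane (col_mx 0 1%:M) ::
  [seq hyperplane (col_mx h.1 (- h.2)%:M) | h <- A].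

Definition int_range (k : nat) : seq int :=
  [seq i%:Z - k%:Z | i <- iota 0 (2 * k).+1].

Lemma mem_int_range (k : nat) (s : int) :
  (s \in int_range k) = (- k%:Z <= s <= k%:Z).
Proof.
apply/mapP/andP => [[i]|[ks sk]].
  rewrite mem_iota => /andP[_ ik] ->; split; lia.
exists (absz (s + k%:Z)); last by lia.
by rewrite mem_iota; lia.
Qed.

Definition coord_form (R : realType) (l : nat) (i : 'I_l) : 'cV[R]_l :=
  delta_mx i 0.

Definition B0 (R : realType) (l m a : nat) : affine_arrangement R l :=
  let pairs := [seq p : 'I_l * 'I_l <- enum {: 'I_l * 'I_l} | (p.1 < p.2)%N] in
  [seq (coord_form R p.1 + coord_form R p.2, s%:~R)
     | p <- pairs, s <- int_range a] ++
  [seq (coord_form R p.1 - coord_form R p.2, s%:~R)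
     | p <- pairs, s <- int_range a] ++
  [seq (coord_form R i, s%:~R) | i <- enum 'I_l, s <- int_range m].

Definition CatB (R : realType) (l m : nat) : affine_arrangement R l :=
  B0 R l m m.

(* Main.v *)
(* All the restrictions that occur are again cones of arrangements of the form
   x_i +- x_j = s (|s| <= a), x_i = t (t in T), so the point is to prove that
   such a cone is free, with exponents 1 and |T| + 2a(l-1) + 2k for k < l, when T
   consists of the integers of absolute value <= M and the half-integers of
   absolute value < N; the theorem is the case M = m, N = 0.  Restricting
   successively to x_l = m z, x_(l-1) = (m + a) z, x_(l-2) = (m + 2a) z, ... then
   replaces m by m + a, m + 2a, ... and drops the largest exponents one by one.

   When M = N >= a/2 an explicit basis exists.  Let F be the odd polynomial in t
   with F(t + z/2) - F(t - z/2) = z P(t), where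
     P(t) = t^(2k) prod_j prod_v (t^2 - (x_j + v z)^2) prod_(i < r) (t^2 - (i z/2)^2)
   with v = -(a-1)/2, ..., (a-1)/2 and r = 2M - a.  Then F is constant on each
   chain x_j + {-a/2, ..., a/2} z and vanishes at q z/2 for |q| <= r, so that the
   field with components F(x_i + a z/2) is tangent to the arrangement.  For k < l
   these fields, with the Euler field, are independent because a dependency would
   be an odd polynomial in t with too many roots.

   From there M and N decrease one at a time by deletion of the 2l hyperplanes
   x_i = +- h with h maximal in T.  All these hyperplanes have the same restriction,
   a cone of the same kind in dimension l - 1, which is free by induction on l. *)
Require Import Defs.
From HB Require Import structures.
From mathcomp Require Import all_boot all_order all_algebra.
From mathcomp Require Import reals.
From mathcomp Require Import mpoly.
From mathcomp Require Import perm zify ring lra.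

Set Implicit Arguments.
Unset Strict Implicit.
Unset Printing Implicit Defensive.

Import Order.TTheory GRing.Theory Num.Theory.
Local Open Scope ring_scope.

(** * Polynomial functions and homogeneity *)

(** Half-integers enter through the basis. The pairs [x_i +- x_j = s z] ask for [F] to be constant
    along steps of length [z]; oddness then turns a root of [P] at 0 into
    [F(z/2) = F(-z/2) = -F(z/2)], hence a zero of [F] at [z/2]. The zeros of [F] thus fill a whole
    range of multiples of [z/2], and the basis fits a [T] with integers and half-integers alike. The
    [T] of the theorem has to be reached from there by deletions. The deletions respect the shape of
    the exponents because these depend on [T] only through [M + N]. The restriction to [x_i = +- h]
    has all the exponents but the largest, and the 2l deletions bring that one down to the least
    exponent (after 1) of the smaller arrangement. As the restriction enlarges [M] or [N] by [a],
    the induction on l has to treat all [M] and [N] at once. Polynomials are handled as functions on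
    R^n: divisibility by a linear form becomes vanishing on a hyperplane, and homogeneity becomes
    behaviour under a dilation. *)

Lemma poly_horner_inj (R : realType) (p : {poly R}) :
  (forall x, p.[x] = 0) -> p = 0.
Proof.
move=> p0; apply/eqP; case: eqVneq => // pN0.
pose s := [seq i%:R : R | i <- iota 0 (size p)].
have us : uniq s by rewrite map_inj_uniq ?iota_uniq // => i j /eqP; rewrite eqr_nat => /eqP.
have rs : all (root p) s by apply/allP => x _; rewrite /root p0.
by have := max_poly_roots pN0 rs us; rewrite size_map size_iota ltnn.
Qed.

(** [muni] singles out the last variable; this formula and [meval_muni] carry the induction on the
    number of variables in [meval_eq0]. *)
Lemma mcoeff_muni (R : realType) (n : nat) (p : {mpoly R[n.+1]}) (m : 'X_{1..n.+1}) :
  ((muni p)`_(m ord_max))@_[multinom m (widen_ord (leqnSn n) i) | i < n] = p@_m.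
Proof.
rewrite muniE coef_sum raddf_sum /=.
have E (m' : 'X_{1..n.+1}) : [multinom m' (widen_ord (leqnSn n) i) | i < n] =
   [multinom m (widen_ord (leqnSn n) i) | i < n] -> m' ord_max = m ord_max -> m' = m.
  move=> /mnmP e1 e2; apply/mnmP => i.
  case: (unliftP ord_max i) => [j ->|-> //].
  have := e1 j; rewrite !mnmE; congr (_ = _); congr (fun_of_multinom _ _);
    by apply/val_inj; rewrite /= /bump leqNgt ltn_ord.
have F (m' : 'X_{1..n.+1}) : (((p@_m' *: 'X_[[multinom m' (widen_ord (leqnSn n) i)  | i < n]]) *: 'X^(m' ord_max))`_(m ord_max) : {mpoly R[n]})@_[multinom m (widen_ord (leqnSn n) i)  | i < n] = if m' == m then p@_m else 0.
  rewrite coefZ coefXn; have [->|ne] := eqVneq m' m; first by rewrite eqxx mulr1 mcoeffZ mcoeffX eqxx mulr1.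
  have [e2|_] := eqVneq (m ord_max) (m' ord_max); last by rewrite mulr0 mcoeff0.
  rewrite mulr1 mcoeffZ mcoeffX; case: eqP => [e1|_]; last by rewrite mulr0.
  by move/eqP: ne; case; apply: E.
rewrite (eq_bigr _ (fun m' _ => F m')) -big_mkcond /= -big_filter.
have [mp|mp] := boolP (m \in msupp p).
  by rewrite (filter_pred1_uniq (msupp_uniq p) mp) big_seq1.
rewrite (memN_msupp_eq0 mp) big1_seq //.
Qed.

Lemma meval_muni (R : realType) (n : nat) (p : {mpoly R[n.+1]}) (v : 'I_n.+1 -> R) :
  (map_poly (meval (fun i => v (widen_ord (leqnSn n) i))) (muni p)).[v ord_max] = p.@[v].
Proof.
rewrite muniE raddf_sum /= horner_sum mevalE.
apply: eq_bigr => m _ /=.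
rewrite map_polyZ map_polyXn hornerZ hornerXn.
rewrite [X in X * _]mevalZ mevalX -mulrA; congr (_ * _).
by rewrite big_ord_recr /=; congr (_ * _); apply: eq_bigr => i _; rewrite mnmE.
Qed.

Lemma meval_eq0 (R : realType) (n : nat) (p : {mpoly R[n]}) :
  (forall v, p.@[v] = 0) -> p = 0.
Proof.
elim: n p => [|n IH] p p0.
  have := p0 (fun=> 0); rewrite mevalE => h.
  apply/mpolyP => m; rewrite mcoeff0.
  have E m' : m' = m :> 'X_{1..0} by apply/mnmP => -[].
  have [mp|/memN_msupp_eq0 //] := boolP (m \in msupp p).
  rewrite -[RHS]h (big_rem m) //= big_ord0 mulr1 big1_seq ?addr0 //.
  by move=> m' /=; rewrite (E m') mem_rem_uniq ?msupp_uniq // inE eqxx.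
have mu0 : muni p = 0.
  apply/polyP => k; rewrite coef0; apply: IH => v.
  have : map_poly (meval v) (muni p) = 0.
    apply: poly_horner_inj => x.
    pose w (i : 'I_n.+1) := if unlift ord_max i is Some j then v j else x.
    have := meval_muni p w; rewrite p0 /w unlift_none => <-; congr (_.[_]).
    apply/polyP => i; rewrite !coef_map; apply: meval_eq => j /=.
    have -> : widen_ord (leqnSn n) j = lift ord_max j.
      by apply/val_inj; rewrite /= /bump leqNgt ltn_ord.
    by rewrite liftK.
  by move/polyP/(_ k); rewrite coef_map coef0.
by apply/mpolyP => m; rewrite -mcoeff_muni mu0 coef0 !mcoeff0.
Qed.

Lemma mpoly_ext (R : realType) (n : nat) (p q : {mpoly R[n]}) :
  (forall v : 'rV[R]_n, p.@[v 0] = q.@[v 0]) -> p = q.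
Proof.
move=> pq; apply/eqP; rewrite -subr_eq0; apply/eqP; apply: meval_eq0 => v.
rewrite mevalB; have := pq (\row_i v i).
have E r : r.@[(\row_i v i) 0] = r.@[v] :> R by apply: meval_eq => i; rewrite mxE.
by rewrite !E => ->; rewrite subrr.
Qed.

Lemma meval_linear_form (R : realType) (n : nat) (c : 'cV[R]_n) (v : 'rV[R]_n) :
  (linear_form c).@[v 0] = (v *m c) 0 0.
Proof.
rewrite /linear_form raddf_sum mxE; apply: eq_bigr => i _ /=.
by rewrite mevalZ mevalXU mulrC.
Qed.

(** Pull-back along [w |-> w *m N]: a restriction when [N] parametrizes a subspace, a change of
    coordinates when [N] is invertible. *)
Definition lin_subst (R : realType) (n k : nat) (N : 'M[R]_(k, n))
  (p : {mpoly R[n]}) : {mpoly R[k]} :=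
  p \mPo [tuple linear_form (col i N) | i < n].

Lemma meval_lin_subst (R : realType) (n k : nat) (N : 'M[R]_(k, n))
    (p : {mpoly R[n]}) (w : 'rV[R]_k) :
  (lin_subst N p).@[w 0] = p.@[(w *m N) 0].
Proof.
rewrite /lin_subst comp_mpoly_meval; apply: meval_eq => i.
rewrite tnth_mktuple meval_linear_form.
by rewrite !mxE; apply: eq_bigr => j _; rewrite mxE.
Qed.

Lemma lin_substM (R : realType) (n k : nat) (N : 'M[R]_(k, n)) (p q : {mpoly R[n]}) :
  lin_subst N (p * q) = lin_subst N p * lin_subst N q.
Proof. exact: rmorphM. Qed.

(* Testing the dilation by 2 is enough, as [2 ^+ k] is injective in [k]. *)
Definition homdeg (R : realType) (n d : nat) (p : {mpoly R[n]}) : Prop :=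
  forall v : 'rV[R]_n, p.@[(2%:R *: v) 0] = 2 ^+ d * p.@[v 0].

(* Homogeneity of the possibly negative degree [d - e]. *)
Definition hom_shift (R : realType) (n e d : nat) (p : {mpoly R[n]}) : Prop :=
  forall v : 'rV[R]_n, 2 ^+ e * p.@[(2%:R *: v) 0] = 2 ^+ d * p.@[v 0].

(** The coefficients at [m] of the two sides are [2 ^+ (e + mdeg m)] and [2 ^+ d] times that of
    [p]. *)
Lemma hom_shiftP (R : realType) (n e d : nat) (p : {mpoly R[n]}) (m : 'X_{1..n}) :
  hom_shift e d p -> p@_m != 0 -> (e + mdeg m)%N = d.
Proof.
move=> hp pm.
have E : (p \mPo [tuple (2%:R : R) *: 'X_i | i < n]) * (2 ^+ e)%:MP = (2 ^+ d)%:MP * p.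
  apply: mpoly_ext => v; rewrite !mevalM !mevalC -hp mulrC; congr (_ * _).
  rewrite comp_mpoly_meval; apply: meval_eq => i.
  by rewrite tnth_mktuple mevalZ mevalXU mxE.
have := congr1 (mcoeff m) E; rewrite mulrC !mcoeffCM.
rewrite comp_mpolyEX raddf_sum /=.
have F (m' : 'X_{1..n}) : (p@_m' *: ('X_[m'] \mPo [tuple (2%:R : R) *: 'X_i | i < n]))@_m =
   if m' == m then 2 ^+ mdeg m * p@_m else 0.
  rewrite mcoeffZ comp_mpolyX.
  have -> : \prod_(i < n) tnth [tuple (2%:R : R) *: 'X_i  | i < n] i ^+ m' i = (2%:R : R) ^+ mdeg m' *: 'X_[m'] :> {mpoly R[n]}.
    rewrite mdegE -prodrXr [in RHS]mpolyXE_id -scaler_prod.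
    by apply: eq_bigr => i _; rewrite tnth_mktuple exprZn.
  rewrite mcoeffZ mcoeffX; case: eqVneq => [->|]; first by rewrite mulr1 mulrC.
  by rewrite !mulr0.
rewrite (eq_bigr _ (fun m' _ => F m')) -big_mkcond /= -big_filter.
rewrite (filter_pred1_uniq (msupp_uniq p)) ?mcoeff_msupp // big_seq1 mulrA -exprD.
move/(mulIf pm) => h.
have inj2 : injective (fun k : nat => 2 ^+ k : R).
  move=> i j /eqP; rewrite -!natrX eqr_nat eqn_exp2l // => /eqP //.
exact: inj2 h.
Qed.

Lemma hom_shift_eq0 (R : realType) (n e d : nat) (p : {mpoly R[n]}) :
  hom_shift e d p -> (d < e)%N -> p = 0.
Proof.
move=> hp de; apply/mpolyP => m; rewrite mcoeff0; apply/eqP.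
by apply: contraLR de => /(hom_shiftP hp) <-; rewrite -leqNgt leq_addr.
Qed.

Lemma hom_shift_const (R : realType) (n d : nat) (p : {mpoly R[n]}) :
  hom_shift d d p -> exists c, p = c%:MP.
Proof.
move=> hp; exists p@_0; apply/mpolyP => m; rewrite mcoeffC.
case: eqVneq => [<-|m0]; first by rewrite mulr1.
rewrite mulr0; apply/eqP; apply: contraNT m0 => /(hom_shiftP hp) /eqP.
by rewrite -{2}[d]addn0 eqn_add2l mdeg_eq0 eq_sym.
Qed.

Lemma pow2_neq0 (R : realType) k : (2 ^+ k : R) != 0.
Proof. by rewrite expf_neq0 // pnatr_eq0. Qed.

Lemma hom_shiftW (R : realType) (n e d : nat) (p : {mpoly R[n]}) :
  hom_shift e (e + d) p -> homdeg d p.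
Proof.
by move=> hp v; apply: (mulfI (pow2_neq0 R e)); rewrite hp mulrA exprD.
Qed.

Lemma homdeg_dhomog (R : realType) (n d : nat) (p : {mpoly R[n]}) :
  homdeg d p -> p \is d.-homog.
Proof.
move=> hp; apply/dhomogP => m; rewrite mcoeff_msupp => pm.
have /hom_shiftP/(_ pm) : hom_shift 0 d p by move=> v; rewrite expr0 mul1r hp.
by rewrite add0n.
Qed.

Lemma homdegM (R : realType) (n d e : nat) (p q : {mpoly R[n]}) :
  homdeg d p -> homdeg e q -> homdeg (d + e) (p * q).
Proof. by move=> hp hq v; rewrite !mevalM hp hq exprD; ring. Qed.

Lemma homdegD (R : realType) (n d : nat) (p q : {mpoly R[n]}) :
  homdeg d p -> homdeg d q -> homdeg d (p + q).
Proof. by move=> hp hq v; rewrite !mevalD hp hq mulrDr. Qed.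

Lemma homdegN (R : realType) (n d : nat) (p : {mpoly R[n]}) :
  homdeg d p -> homdeg d (- p).
Proof. by move=> hp v; rewrite !mevalN hp mulrN. Qed.

Lemma homdeg0 (R : realType) (n d : nat) : homdeg d (0 : {mpoly R[n]}).
Proof. by move=> v; rewrite !meval0 mulr0. Qed.

Lemma homdegC (R : realType) (n : nat) (c : R) : homdeg 0 (c%:MP : {mpoly R[n]}).
Proof. by move=> v; rewrite !mevalC mul1r. Qed.

Lemma homdeg_sum (R : realType) (n d : nat) (I : Type) (r : seq I) (P : pred I)
    (F : I -> {mpoly R[n]}) :
  (forall i, P i -> homdeg d (F i)) -> homdeg d (\sum_(i <- r | P i) F i).
Proof.
move=> hF; elim/big_rec: _ => [|i x Pi hx]; first exact: homdeg0.
by apply: homdegD => //; apply: hF.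
Qed.

Lemma homdeg_prod (R : realType) (n : nat) (I : Type) (r : seq I) (P : pred I)
    (d : I -> nat) (F : I -> {mpoly R[n]}) :
  (forall i, P i -> homdeg (d i) (F i)) ->
  homdeg (\sum_(i <- r | P i) d i)%N (\prod_(i <- r | P i) F i).
Proof.
move=> hF; elim/big_rec2: _ => [|i x y Pi hx]; last by apply: homdegM => //; apply: hF.
by rewrite -mpolyC1; apply: homdegC.
Qed.

Lemma homdegX (R : realType) (n : nat) (i : 'I_n) : homdeg 1 ('X_i : {mpoly R[n]}).
Proof. by move=> v; rewrite !mevalXU mxE expr1. Qed.

Lemma homdeg_linear_form (R : realType) (n : nat) (c : 'cV[R]_n) :
  homdeg 1 (linear_form c).
Proof. by move=> v; rewrite !meval_linear_form -scalemxAl mxE expr1. Qed.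

Lemma homdeg_lin_subst (R : realType) (n k d : nat) (N : 'M[R]_(k, n)) p :
  homdeg d p -> homdeg d (lin_subst N p).
Proof. by move=> hp v; rewrite !meval_lin_subst -scalemxAl hp. Qed.

Lemma homdeg_det (R : realType) (n k : nat) (b : 'I_k -> nat) (M : 'M[{mpoly R[n]}]_k) :
  (forall i j, homdeg (b i) (M i j)) -> homdeg (\sum_i b i)%N (\det M).
Proof.
move=> hM; rewrite /determinant; apply: homdeg_sum => s _.
rewrite -signr_odd; case: (odd _); rewrite ?expr1 ?expr0 ?mulN1r ?mul1r; [apply: homdegN|];
by apply: homdeg_prod => i _.
Qed.

(** * Tangent vector fields and Saito matrices *)

Definition vanish (R : realType) (n : nat) (c : 'cV[R]_n) (p : {mpoly R[n]}) :=
  forall v : 'rV[R]_n, v *m c = 0 -> p.@[v 0] = 0.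

Lemma cV_dual (R : realType) (n : nat) (c : 'cV[R]_n) :
  c != 0 -> exists u : 'rV[R]_n, u *m c = 1%:M.
Proof.
move=> c0; have /cV0Pn[k ck] := c0.
exists ((c k 0)^-1 *: delta_mx 0 k); rewrite -scalemxAl -rowE.
by apply/matrixP => i j; rewrite !ord1 !mxE mulVf.
Qed.

(** [M] is the projection onto the hyperplane along [u]; [lin_subst M] then computes remainders
    modulo the form [c]. *)
Lemma hyperplane_proj (R : realType) (n : nat) (c : 'cV[R]_n) :
  c != 0 -> exists u : 'rV[R]_n, exists M : 'M[R]_n,
  [/\ u *m c = 1%:M, M *m c = 0 & forall v, v *m M = v - (v *m c) 0 0 *: u].
Proof.
move=> /cV_dual[u uc]; exists u; exists (1%:M - c *m u); split => //.
  by rewrite mulmxBl -mulmxA uc mulmx1 mul1mx subrr.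
move=> v; rewrite mulmxBr mulmx1 mulmxA; congr (_ - _).
by rewrite {1}[v *m c]mx11_scalar mul_scalar_mx.
Qed.

(** Every [p] is congruent to [lin_subst M p] modulo the form, because ['X_i] and its image differ
    by [u 0 i] times the form; the image is zero when [p] vanishes on the hyperplane. *)
Lemma vanish_dvd (R : realType) (n : nat) (c : 'cV[R]_n) (p : {mpoly R[n]}) :
  c != 0 -> vanish c p -> exists g, p = linear_form c * g.
Proof.
move=> /hyperplane_proj[u [M [uc Mc vM]]] pc.
have s0 : lin_subst M p = 0.
  apply: mpoly_ext => v; rewrite meval_lin_subst meval0 pc //.
  by rewrite -mulmxA Mc mulmx0.
have [g] : exists g, p - lin_subst M p = linear_form c * g; last first.
  by rewrite s0 subr0 => ->; exists g.
elim/mpolyind: p {pc s0} => [|a m p _ _ [g IH]].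
  by exists 0; rewrite /lin_subst raddf0 subr0 mulr0.
have [h hE] : exists h, 'X_[m] - lin_subst M 'X_[m] = linear_form c * h.
  rewrite mpolyXE_id.
  elim/big_ind: _ => [|x y [hx Hx] [hy Hy]|i _].
  - by exists 0; rewrite /lin_subst rmorph1 subrr mulr0.
  - exists (hx * y + lin_subst M x * hy).
    by rewrite lin_substM mulrDr mulrA -Hx mulrCA -Hy; ring.
  elim: (m i) => [|k [g' IH']].
    by exists 0; rewrite /lin_subst expr0 rmorph1 subrr mulr0.
  exists (g' * 'X_i + lin_subst M ('X_i ^+ k) * (u 0 i)%:MP).
  rewrite mulrDr mulrA -IH' exprSr lin_substM mulrCA.
  have -> : linear_form c * (u 0 i)%:MP = 'X_i - lin_subst M 'X_i.
    apply: mpoly_ext => v; rewrite mevalM mevalB mevalC meval_lin_subst !mevalXU.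
    by rewrite meval_linear_form vM !mxE; ring.
  by ring.
exists (a *: h + g); rewrite mulrDr -IH -scalerAr -hE.
rewrite /lin_subst linearP /= scalerBr; ring.
Qed.

(** The remainders of [p] and [q] modulo the form live in an integral domain, and the point [v]
    shows that the one of [p] is not zero. *)
Lemma vanish_prime (R : realType) (n : nat) (c : 'cV[R]_n) (p q : {mpoly R[n]})
    (v : 'rV[R]_n) :
  c != 0 -> v *m c = 0 -> p.@[v 0] != 0 -> vanish c (p * q) -> vanish c q.
Proof.
move=> /hyperplane_proj[u [M [uc Mc vM]]] vc pv pq.
have id_on (w : 'rV_n) : w *m c = 0 -> w *m M = w.
  by move=> wc; rewrite vM wc mxE scale0r subr0.
have : lin_subst M p * lin_subst M q = 0.
  rewrite -lin_substM; apply: mpoly_ext => w; rewrite meval_lin_subst meval0 pq //.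
  by rewrite -mulmxA Mc mulmx0.
move/eqP; rewrite mulf_eq0 => /orP[/eqP p0|/eqP q0] w wc.
  by move: pv; rewrite -(id_on v) // -meval_lin_subst p0 meval0 eqxx.
by rewrite -(id_on w) // -meval_lin_subst q0 meval0.
Qed.

Lemma linear_form_neq0 (R : realType) (n : nat) (c : 'cV[R]_n) :
  c != 0 -> linear_form c != 0.
Proof.
move=> /cV_dual[u uc]; apply/eqP => /(congr1 (meval (u 0))).
by rewrite meval_linear_form uc meval0 mxE => /eqP; rewrite oner_eq0.
Qed.

Lemma hyperplaneZ (R : realType) (n : nat) (a : R) (c : 'cV[R]_n) :
  a != 0 -> hyperplane (a *: c) = hyperplane c.
Proof.
move=> a0; apply/vspaceP => v; rewrite !mem_hyperplane -scalemxAr.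
by rewrite scaler_eq0 (negPf a0).
Qed.

Lemma hyperplane_sub (R : realType) (n : nat) (c c' : 'cV[R]_n) :
  c != 0 -> (forall v, v \in hyperplane c -> v \in hyperplane c') ->
  exists a, c' = a *: c.
Proof.
move=> /hyperplane_proj[u [M [uc Mc vM]]] sub; exists ((u *m c') 0 0).
apply/trmx_inj/eqP; apply/eqP.
have E (v : 'rV_n) : v *m c' = v *m ((u *m c') 0 0 *: c).
  have : v *m M \in hyperplane c' by apply: sub; rewrite mem_hyperplane -mulmxA Mc mulmx0.
  rewrite mem_hyperplane vM mulmxBl subr_eq0 => /eqP ->.
  apply/matrixP => i j; rewrite !ord1 -scalemxAr -scalemxAl !mxE; ring.
congr (_^T); apply/row_matrixP => i; rewrite !rowE; exact: E.
Qed.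

Lemma hyperplane_eq (R : realType) (n : nat) (c c' : 'cV[R]_n) :
  c != 0 -> c' != 0 -> (forall v, v \in hyperplane c -> v \in hyperplane c') ->
  hyperplane c = hyperplane c'.
Proof.
move=> c0 c'0 /(hyperplane_sub c0)[a E].
rewrite E hyperplaneZ //; apply: contraNneq c'0 => a0.
by rewrite E a0 scale0r.
Qed.

Lemma hyperplane_neq (R : realType) (n : nat) (c c' : 'cV[R]_n) :
  c != 0 -> c' != 0 -> hyperplane c != hyperplane c' ->
  exists2 v : 'rV[R]_n, v *m c = 0 & (linear_form c').@[v 0] != 0.
Proof.
move=> c0 c'0 /eqP ne.
have [/subvP sub|/subvPn[v vc vc']] := boolP (hyperplane c <= hyperplane c')%VS.
  by case: ne; apply: hyperplane_eq.
exists v; first by apply/eqP; rewrite -mem_hyperplane.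
apply: contraNneq vc'; rewrite mem_hyperplane meval_linear_form => E.
by rewrite [v *m c']mx11_scalar E raddf0.
Qed.

(** The forms are pairwise non-proportional, so after division by one of them the quotient still
    vanishes on the other hyperplanes. *)
Lemma prod_dvd (R : realType) (n : nat) (cs : seq 'cV[R]_n) (p : {mpoly R[n]}) :
  uniq [seq hyperplane c | c <- cs] -> 0 \notin cs ->
  (forall c, c \in cs -> vanish c p) ->
  exists g, p = \prod_(c <- cs) linear_form c * g.
Proof.
elim: cs p => [|c cs IH] p /=; first by exists p; rewrite big_nil mul1r.
move=> /andP[cN ucs]; rewrite inE negb_or eq_sym => /andP[c0 cs0] van.
have [g gE] := vanish_dvd c0 (van c (mem_head _ _)).
have [c'|h hE] := IH g ucs cs0; last by exists h; rewrite big_cons gE hE mulrA.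
move=> c'cs.
have c'0 : c' != 0 by apply: contraNneq cs0 => <-.
have [|v vc' vc] := hyperplane_neq c'0 c0.
  by apply: contraNneq cN => <-; apply: map_f.
apply: (vanish_prime c'0 vc' vc); rewrite -gE; apply: van.
by rewrite inE c'cs orbT.
Qed.

(** The degree of a quotient, in a form that also covers [d < e], where it forces [g = 0]. *)
Lemma hom_shift_cancel (R : realType) (n e d : nat) (q g : {mpoly R[n]}) :
  q != 0 -> homdeg e q -> homdeg d (q * g) -> hom_shift e d g.
Proof.
move=> q0 hq hqg.
(* [lin_subst 2%:M] is the dilation, so the claim becomes an identity of polynomials from which [q]
   can be cancelled. *)
have : q * (2 ^+ e *: lin_subst 2%:M g - 2 ^+ d *: g) = 0.
  apply: mpoly_ext => v; rewrite meval0 mevalM mevalB !mevalZ meval_lin_subst.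
  have := hqg v; rewrite !mevalM hq mul_mx_scalar => E.
  by rewrite mulrBr mulrCA mulrA E; ring.
move/eqP; rewrite mulf_eq0 (negPf q0) /= subr_eq0 => /eqP E v.
by have := congr1 (meval (v 0)) E; rewrite !mevalZ meval_lin_subst mul_mx_scalar.
Qed.

(** The condition theta(alpha_H) in alpha_H S for the field with coefficient row [f], stated
    pointwise so that no form defining [H] has to be chosen; [tangentP] and [vanish_dvd] recover the
    divisibility. *)
Definition tangent (R : realType) (n : nat) (H : {vspace 'rV[R]_n})
    (f : 'rV[{mpoly R[n]}]_n) : Prop :=
  forall v, v \in H -> map_mx (meval (v 0)) f \in H.

Definition vf_apply (R : realType) (n : nat) (f : 'rV[{mpoly R[n]}]_n)
    (c : 'cV[R]_n) : {mpoly R[n]} :=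
  \sum_j c j 0 *: f 0 j.

Lemma meval_vf_apply (R : realType) (n : nat) (f : 'rV[{mpoly R[n]}]_n) c (v : 'rV[R]_n) :
  (vf_apply f c).@[v 0] = (map_mx (meval (v 0)) f *m c) 0 0.
Proof.
rewrite /vf_apply raddf_sum mxE; apply: eq_bigr => j _ /=.
by rewrite mevalZ mxE mulrC.
Qed.

Lemma tangentP (R : realType) (n : nat) (f : 'rV[{mpoly R[n]}]_n) (c : 'cV[R]_n) :
  tangent (hyperplane c) f <-> vanish c (vf_apply f c).
Proof.
split=> [tf v vc|van v].
  rewrite meval_vf_apply.
  have /tf : v \in hyperplane c by rewrite mem_hyperplane vc.
  by rewrite mem_hyperplane => /eqP ->; rewrite mxE.
rewrite !mem_hyperplane => /eqP /van; rewrite meval_vf_apply => E.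
by rewrite [_ *m c]mx11_scalar E raddf0.
Qed.

(** At a point of the hyperplane all rows of [T] lie in the hyperplane, so the evaluated matrix
    kills [c] and is singular. *)
Lemma det_tangent (R : realType) (n : nat) (T : 'M[{mpoly R[n]}]_n) (c : 'cV[R]_n) :
  c != 0 -> (forall i, tangent (hyperplane c) (row i T)) -> vanish c (\det T).
Proof.
move=> c0 tan v vc; rewrite -(det_map_mx (meval (v 0))); apply/eqP.
apply: contraNT c0 => d0.
have : map_mx (meval (v 0)) T *m c = 0.
  apply/row_matrixP => i; rewrite row_mul -map_row row0; apply/eqP.
  by rewrite -mem_hyperplane; apply: tan; rewrite mem_hyperplane vc.
move/(congr1 (mulmx (\adj (map_mx (meval (v 0)) T)))).
rewrite mulmxA mul_adj_mx mulmx0 mul_scalar_mx => /eqP.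
by rewrite scaler_eq0 (negPf d0).
Qed.

Definition of_hyperplanes (R : realType) (n : nat) (A : arrangement R n) : Prop :=
  forall H, H \in A -> exists2 c, c != 0 & H = hyperplane c.

Lemma of_hyperplanes_forms (R : realType) (n : nat) (A : arrangement R n) :
  of_hyperplanes A ->
  exists2 cs, [seq hyperplane c | c <- cs] = A & 0 \notin cs.
Proof.
elim: A => [|H A IH] hA; first by exists [::].
have [|cs csA cs0] := IH; first by move=> K KA; apply: hA; rewrite inE KA orbT.
have [c c0 HE] := hA H (mem_head _ _).
exists (c :: cs); first by rewrite /= csA HE.
by rewrite inE negb_or cs0 eq_sym c0.
Qed.

(* Saito's criterion without the defining polynomial [Q]: tangency makes
   [\det T] a multiple of [Q], the degree count makes the cofactor constant. *)
Definition saito_matrix (R : realType) (n : nat) (A : arrangement R n)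
    (b : 'I_n -> nat) (T : 'M[{mpoly R[n]}]_n) : Prop :=
  [/\ of_hyperplanes A, (\sum_i b i)%N = size (undup A), \det T != 0,
      forall i j, homdeg (b i) (T i j)
    & forall i H, H \in A -> tangent H (row i T)].

Lemma saito_det (R : realType) (n : nat) (A : arrangement R n) b T :
  saito_matrix A b T ->
  exists cs (k : R), [/\ [seq hyperplane c | c <- cs] = undup A, 0 \notin cs, k != 0
    & \det T = (\prod_(c <- cs) linear_form c) * k%:MP].
Proof.
case=> hA sb d0 hT tT.
have [|cs csA cs0] := of_hyperplanes_forms (A := undup A).
  by move=> H; rewrite mem_undup; apply: hA.
have ucs : uniq [seq hyperplane c | c <- cs] by rewrite csA undup_uniq.
have [c ccs|g gE] := prod_dvd (p := \det T) ucs cs0.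
  apply: det_tangent => [|i]; first by apply: contraNneq cs0 => <-.
  by apply: tT; rewrite -mem_undup -csA map_f.
have hQ : homdeg (size cs) (\prod_(c <- cs) linear_form c).
  have -> : size cs = (\sum_(c <- cs) 1)%N by rewrite sum1_size.
  by apply: homdeg_prod => c _; apply: homdeg_linear_form.
have Q0 : \prod_(c <- cs) linear_form c != 0 by apply: contraNneq d0 => Q0; rewrite gE Q0 mul0r.
have sz : size cs = (\sum_i b i)%N by rewrite sb -csA size_map.
have hd := homdeg_det hT; rewrite gE in hd.
have [k kE] : exists k, g = k%:MP.
  by apply: (@hom_shift_const _ _ (size cs)); apply: hom_shift_cancel hQ _; rewrite // sz.
exists cs; exists k; split; rewrite // -?kE //.
by apply: contraNneq d0 => k0; rewrite gE kE k0 mpolyC0 mulr0.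
Qed.

(** Cramer's rule: the coefficient at [i] is [\det (T' i) / \det T], where [T' i] has [f] as its row
    [i]. The rows of [T' i] are still tangent, so its determinant is a multiple of the product [Q]
    of the forms, as is [\det T], the latter with a constant cofactor. *)
Lemma saito_span (R : realType) (n : nat) (A : arrangement R n) b T
    (f : 'rV[{mpoly R[n]}]_n) :
  saito_matrix A b T -> (forall H, H \in A -> tangent H f) ->
  exists2 g : 'rV[{mpoly R[n]}]_n, f = g *m T &
    forall d, (forall j, homdeg d (f 0 j)) -> forall i, hom_shift (b i) d (g 0 i).
Proof.
move=> sT tf; have [cs [k [csA cs0 k0 dE]]] := saito_det sT.
have [hA sb d0 hT tT] := sT.
set Q := \prod_(c <- cs) _ in dE.
have Q0 : Q != 0 by apply: contraNneq d0 => Q0; rewrite dE Q0 mul0r.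
have hQ : homdeg (\sum_i b i)%N Q.
  rewrite sb -csA size_map.
  have -> : size cs = (\sum_(c <- cs) 1)%N by rewrite sum1_size.
  by apply: homdeg_prod => c _; apply: homdeg_linear_form.
have ucs : uniq [seq hyperplane c | c <- cs] by rewrite csA undup_uniq.
pose T' i := \matrix_(i', j) (if i' == i then f 0 j else T i' j).
have cram i : (f *m \adj T) 0 i = \det (T' i).
  rewrite (expand_det_row _ i) mxE; apply: eq_bigr => j _.
  rewrite !mxE eqxx /cofactor.
  have -> // : row' i (col' j T) = row' i (col' j (T' i)).
  by apply/matrixP => x y; rewrite !mxE eq_sym (negPf (neq_lift _ _)).
have /fin_all_exists[h hE] : forall i, exists h, \det (T' i) = Q * h.
  move=> i; apply: prod_dvd => // c ccs; apply: det_tangent => [|i'].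
    by apply: contraNneq cs0 => <-.
  have HA : hyperplane c \in A by rewrite -mem_undup -csA map_f.
  have [->|ne] := eqVneq i' i.
    have -> : row i (T' i) = f by apply/rowP => j; rewrite !mxE eqxx.
    exact: tf.
  have -> : row i' (T' i) = row i' T by apply/rowP => j; rewrite !mxE (negPf ne).
  exact: tT.
exists (\row_i (k^-1 *: h i)).
  have E : (\det T) *: f = Q *: ((\row_i h i) *m T).
    rewrite -mul_mx_scalar -mul_adj_mx mulmxA scalemxAl; congr (_ *m _).
    by apply/rowP => i; rewrite cram hE !mxE.
  rewrite dE -scalerA in E; move/(scalemx_inj Q0)/(congr1 ( *:%R (k^-1)%:MP)): E.
  rewrite scalerA -mpolyCM mulVf // scale1r scalemxAl => ->; congr (_ *m _).
  by apply/rowP => i; rewrite !mxE mul_mpolyC.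
move=> d hf i v; rewrite !mxE !mevalZ.
have hT' : homdeg (\sum_i' (if i' == i then d else b i'))%N (\det (T' i)).
  apply: homdeg_det => i' j; rewrite mxE; case: eqVneq => _ //; exact: hT.
rewrite hE in hT'; have := hom_shift_cancel Q0 hQ hT' v.
(* The degrees of [\det (T' i)] and [Q] differ only in the summand at [i]; cancelling the power of 2
   of the other summands leaves [d] and [b i]. *)
rewrite (bigD1 i) //= [in RHS](bigD1 i) //= eqxx.
rewrite [X in (d + X)%N](eq_bigr b) => [|j /negPf -> //].
set S := (\sum_(_ < n | _) _)%N; rewrite !exprD.
move=> E; apply: (mulfI (pow2_neq0 R S)).
move: (2 ^+ b i) (2 ^+ d) (2 ^+ S) E => p q r E.
have F t : r * (p * (k^-1 * t)) = k^-1 * (p * r * t) by ring.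
by rewrite F E; ring.
Qed.

(** * Restriction and deletion *)

Definition preim_mx (R : realType) (n k : nat) (N : 'M[R]_(k, n))
    (K : {vspace 'rV[R]_n}) : {vspace 'rV[R]_k} :=
  (linfun (mulmxr N : 'rV[R]_k -> 'rV[R]_n) @^-1: K)%VS.

Lemma mem_preim_mx (R : realType) (n k : nat) (N : 'M[R]_(k, n)) K w :
  (w \in preim_mx N K) = (w *m N \in K).
Proof. by rewrite /preim_mx -memv_preim lfunE. Qed.

Lemma preim_hyperplane (R : realType) (n k : nat) (N : 'M[R]_(k, n)) c :
  preim_mx N (hyperplane c) = hyperplane (N *m c).
Proof. by apply/vspaceP => w; rewrite mem_preim_mx !mem_hyperplane mulmxA. Qed.

Lemma lin_subst_form (R : realType) (n k : nat) (N : 'M[R]_(k, n)) c :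
  lin_subst N (linear_form c) = linear_form (N *m c).
Proof.
by apply: mpoly_ext => w; rewrite meval_lin_subst !meval_linear_form mulmxA.
Qed.

Lemma linear_formZ (R : realType) (n : nat) (a : R) (c : 'cV[R]_n) :
  linear_form (a *: c) = a *: linear_form c.
Proof.
by apply: mpoly_ext => v; rewrite mevalZ !meval_linear_form -scalemxAr mxE.
Qed.

Lemma linear_form0 (R : realType) (n : nat) : linear_form (0 : 'cV[R]_n) = 0.
Proof. by rewrite -(scale0r (0 : 'cV[R]_n)) linear_formZ scale0r. Qed.

Lemma form_exp_dvd (R : realType) (n m : nat) (c : 'cV[R]_n) (q g h : {mpoly R[n]})
    (v : 'rV[R]_n) :
  c != 0 -> v *m c = 0 -> q.@[v 0] != 0 -> q * g = linear_form c ^+ m * h ->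
  exists h', g = linear_form c ^+ m * h'.
Proof.
move=> c0 vc qv; elim: m g h => [|m IH] g h; first by exists g; rewrite mul1r.
rewrite exprS -mulrA => E.
have [|g1 g1E] := @vanish_dvd _ _ c g c0.
  apply: (vanish_prime c0 vc qv) => w wc.
  by rewrite E mevalM meval_linear_form wc mxE mul0r.
have [|h' h'E] := IH g1 h; last by exists h'; rewrite g1E h'E mulrA.
by apply: (mulfI (linear_form_neq0 c0)); rewrite -E g1E mulrCA.
Qed.

Lemma prod_exp_dvd (R : realType) (n : nat) (cs : seq 'cV[R]_n) (e : 'cV[R]_n -> nat)
    (p : {mpoly R[n]}) :
  uniq [seq hyperplane c | c <- cs] -> 0 \notin cs ->
  (forall c, c \in cs -> exists g, p = linear_form c ^+ e c * g) ->
  exists g, p = \prod_(c <- cs) linear_form c ^+ e c * g.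
Proof.
elim: cs p => [|c cs IH] p /=; first by exists p; rewrite big_nil mul1r.
move=> /andP[cN ucs]; rewrite inE negb_or eq_sym => /andP[c0 cs0] dvd.
have [g gE] := dvd c (mem_head _ _).
have [c'|h hE] := IH g ucs cs0; last by exists h; rewrite big_cons gE hE mulrA.
move=> c'cs.
have c'0 : c' != 0 by apply: contraNneq cs0 => <-.
have [|v vc' vc] := hyperplane_neq c'0 c0.
  by apply: contraNneq cN => <-; apply: map_f.
have [|h hE] := dvd c'; first by rewrite inE c'cs orbT.
apply: (form_exp_dvd (q := linear_form c ^+ e c) (h := h) c'0 vc').
  by rewrite rmorphXn /= expf_neq0.
by rewrite -hE -gE.
Qed.

(** [N] parametrizes the hyperplane of [c], and [L] reads off the coordinates of its points; outside
    the hyperplane [L] is just some linear extension. *)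
Definition chart (R : realType) (n k : nat) (c : 'cV[R]_n) (N : 'M[R]_(k, n))
    (L : 'M[R]_(n, k)) : Prop :=
  [/\ c != 0, N *m c = 0, N *m L = 1%:M
    & forall v : 'rV[R]_n, v *m c = 0 -> v *m L *m N = v].

Lemma chart_form_neq0 (R : realType) (n k : nat) (c c' : 'cV[R]_n)
    (N : 'M[R]_(k, n)) (L : 'M[R]_(n, k)) :
  chart c N L -> c' != 0 -> hyperplane c != hyperplane c' -> N *m c' != 0.
Proof.
case=> c0 Nc NL LN c'0; apply: contraNneq => E.
apply/eqP/hyperplane_eq => // v; rewrite !mem_hyperplane => /eqP vc.
by rewrite -(LN v vc) -mulmxA E mulmx0.
Qed.

Lemma chart_kernel (R : realType) (n k : nat) (c c' : 'cV[R]_n)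
    (N : 'M[R]_(k, n)) (L : 'M[R]_(n, k)) :
  chart c N L -> N *m c' = 0 -> exists a, c' = a *: c.
Proof.
case=> c0 Nc NL LN E; apply: hyperplane_sub => // v.
rewrite !mem_hyperplane => /eqP vc; by rewrite -(LN v vc) -mulmxA E mulmx0.
Qed.

(* The members of [F] all restrict to the hyperplane of [d] inside that of [c].
   With [q] the cofactor of [f] on one of them, [c0], the polynomial
   [f(c) - c q] vanishes on all the others. *)
Lemma restricted_class_dvd (R : realType) (n k : nat) (c : 'cV[R]_n)
    (N : 'M[R]_(k, n)) (L : 'M[R]_(n, k)) (f : 'rV[{mpoly R[n]}]_n)
    (F : seq 'cV[R]_n) (d : 'cV[R]_k) :
  chart c N L -> uniq [seq hyperplane c | c <- F] -> 0 \notin F -> d != 0 ->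
  (forall c', c' \in F -> [/\ hyperplane c != hyperplane c',
     hyperplane (N *m c') = hyperplane d & tangent (hyperplane c') f]) ->
  exists g, lin_subst N (vf_apply f c) = linear_form d ^+ (size F).-1 * g.
Proof.
move=> ch; have [c0 Nc NL LN] := ch.
case: F => [|c1 F] /=; first by exists (lin_subst N (vf_apply f c)); rewrite mul1r.
move=> /andP[c1N uF]; rewrite inE negb_or eq_sym => /andP[c10 F0] d0 hF.
have [_ hd1 /tangentP/(vanish_dvd c10)[q qE]] := hF c1 (mem_head _ _).
have prop c' : c' \in c1 :: F -> exists a, N *m c' = a *: d.
  move=> /hF[_ h _]; apply: hyperplane_sub => // w; by rewrite h.
have [c' c'F|g gE] := prod_dvd (p := vf_apply f c - linear_form c * q) uF F0.
  have [a aE] : exists a, N *m c' = a *: (N *m c1).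
    apply: hyperplane_sub => [|w]; last first.
      by have [|_ -> _] := hF c'; rewrite ?hd1 // inE c'F orbT.
    have [ne _ _] := hF c1 (mem_head _ _).
    exact: chart_form_neq0 ch c10 ne.
  (* [c'] and [a *: c1] have the same restriction, so they differ by a multiple of [c], nonzero
     because [c'] and [c1] define different hyperplanes. On [c' = 0], tangency to both of these then
     gives [f(c) = c q]. *)
  have [mu muE] : exists mu, c' - a *: c1 = mu *: c.
    by apply: (chart_kernel ch); rewrite mulmxBr -scalemxAr aE subrr.
  have {muE} muE : c' = a *: c1 + mu *: c by rewrite -muE addrC subrK.
  have mu0 : mu != 0.
    apply: contraNneq c1N => mu0; apply/mapP; exists c' => //.
    rewrite muE mu0 scale0r addr0 hyperplaneZ //.
    apply: contraNneq F0 => a0.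
    by move: c'F; rewrite muE mu0 a0 !scale0r addr0.
  have [|_ _ /tangentP tc'] := hF c'; first by rewrite inE c'F orbT.
  move=> v vc'; have := tc' v vc'; have := congr1 (fun M : 'M_1 => M 0 0) vc'.
  have := congr1 (meval (v 0)) qE.
  rewrite mevalM mevalB mevalM !meval_vf_apply !meval_linear_form muE.
  rewrite !mulmxDr -!scalemxAr.
  move: (v *m c) (v *m c1) (map_mx _ f *m c) (map_mx _ f *m c1) => X Y Z W.
  rewrite !mxE; move: (X 0 0) (Y 0 0) (Z 0 0) (W 0 0) (q.@[_]) => x y z w t E1 E2 E3.
  apply: (mulfI mu0); rewrite mulr0.
  have -> : mu * (z - x * t) = (a * w + mu * z) - (a * y + mu * x) * t + a * (y * t - w).
    by ring.
  by rewrite E2 E3 E1; ring.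
(* On the hyperplane of [c] the term [c q] drops out, and each remaining form of the class
   contributes one factor [d]. *)
have [h hE] : exists h, \prod_(c' <- F) linear_form (N *m c') = linear_form d ^+ size F * h.
  have {}prop c' : c' \in F -> exists a, N *m c' = a *: d.
    by move=> c'F; apply: prop; rewrite inE c'F orbT.
  elim: (F) prop => [|c' G IH] prop; first by exists 1; rewrite big_nil mulr1.
  have [|h hE] := IH; first by move=> x xG; apply: prop; rewrite inE xG orbT.
  have [a aE] := prop c' (mem_head _ _).
  exists (a *: h); rewrite big_cons hE aE linear_formZ exprS -scalerAl -scalerAr.
  by rewrite mulrA.
exists (h * lin_subst N g).
have := congr1 (lin_subst N) gE; rewrite lin_substM {1}/lin_subst rmorphB /=.
rewrite -/(lin_subst N _) -/(lin_subst N (linear_form c * q)) lin_substM.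
rewrite lin_subst_form Nc linear_form0 mul0r subr0 => ->.
rewrite mulrA -hE; congr (_ * _); rewrite /lin_subst rmorph_prod /=.
by apply: eq_bigr => x _; rewrite -/(lin_subst N _) lin_subst_form.
Qed.

Lemma count_fibres (T U : eqType) (s : seq T) (f : T -> U) :
  (\sum_(y <- undup [seq f x | x <- s]) size [seq x <- s | f x == y])%N = size s.
Proof.
under eq_bigr => y _ do rewrite size_filter -sum1_count big_mkcond /=.
rewrite exchange_big /= -[RHS]sum1_size; apply: eq_big_seq => x xs.
rewrite -big_mkcond /= sum1_count (eq_count (a2 := pred1 (f x))).
  by rewrite count_uniq_mem ?undup_uniq // mem_undup map_f.
by move=> y /=; rewrite eq_sym.
Qed.

(** A restricted hyperplane that comes from [p] members of [A] divides the restriction of [f(c)]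
    with multiplicity [p - 1]. These multiplicities add up to the number of members of [A] minus
    that of the restriction, which exceeds the degree [b]; so [f(c)] vanishes on the hyperplane. *)
Lemma tangent_of_low_degree (R : realType) (n k b : nat) (A : arrangement R n)
    (c : 'cV[R]_n) (N : 'M[R]_(k, n)) (L : 'M[R]_(n, k)) (f : 'rV[{mpoly R[n]}]_n) :
  chart c N L -> of_hyperplanes A -> hyperplane c \notin A ->
  (forall H, H \in A -> tangent H f) -> (forall j, homdeg b (f 0 j)) ->
  (b + size (undup [seq preim_mx N K | K <- A]) < size (undup A))%N ->
  tangent (hyperplane c) f.
Proof.
move=> ch hA cA tf hf lt.
have [cs csA cs0] : exists2 cs, [seq hyperplane c | c <- cs] = undup A & 0 \notin cs.
  by apply: of_hyperplanes_forms => H; rewrite mem_undup; apply: hA.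
have ucs : uniq [seq hyperplane c | c <- cs] by rewrite csA undup_uniq.
set D := undup _ in lt.
have csne c' : c' \in cs -> [/\ c' != 0, hyperplane c' \in A & hyperplane c != hyperplane c'].
  move=> c'cs; have HA : hyperplane c' \in A by rewrite -mem_undup -csA map_f.
  split=> //; first by apply: contraNneq cs0 => <-.
  by apply: contraNneq cA => ->.
have [ds dsD ds0] : exists2 ds, [seq hyperplane d | d <- ds] = D & 0 \notin ds.
  apply: of_hyperplanes_forms => X; rewrite mem_undup => /mapP[K].
  rewrite -mem_undup -csA => /mapP[c' c'cs ->] ->.
  have [c'0 _ ne] := csne _ c'cs.
  exists (N *m c'); last exact: preim_hyperplane.
  exact: chart_form_neq0 ch c'0 ne.
pose e d := (size [seq c' <- cs | hyperplane (N *m c') == hyperplane d]).-1.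
have [c0 Nc NL LN] := ch.
have uds : uniq [seq hyperplane d | d <- ds] by rewrite dsD undup_uniq.
have [d dds|g gE] := prod_exp_dvd (e := e) (p := lin_subst N (vf_apply f c)) uds ds0.
  apply: (restricted_class_dvd (F := [seq c' <- cs | hyperplane (N *m c') == hyperplane d]) ch).
  - by apply: subseq_uniq ucs; apply/map_subseq/filter_subseq.
  - by apply: contra cs0; rewrite mem_filter => /andP[].
  - by apply: contraNneq ds0 => <-.
  - move=> c'; rewrite mem_filter => /andP[/eqP h /csne[_ HA ne]]; split=> //; exact: tf.
set Q := \prod_(_ <- _) _ in gE.
have hQ : homdeg (\sum_(d <- ds) e d)%N Q.
  apply: homdeg_prod => d _; elim: (e d) => [|m IH]; first by rewrite expr0 -mpolyC1; apply: homdegC.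
  by rewrite exprS -add1n; apply: homdegM => //; apply: homdeg_linear_form.
have Q0 : Q != 0.
  rewrite /Q prodf_seq_neq0; apply/allP => d dds /=; apply: expf_neq0.
  by apply: linear_form_neq0; apply: contraNneq ds0 => <-.
have sz : (\sum_(d <- ds) e d + size D = size (undup A))%N.
  have E : undup [seq hyperplane (N *m c') | c' <- cs] =i D.
    move=> X; rewrite !mem_undup; apply/mapP/mapP => [[c' c'cs ->]|[K]].
      exists (hyperplane c'); first by have [] := csne _ c'cs.
      by rewrite preim_hyperplane.
    by rewrite -mem_undup -csA => /mapP[c' c'cs ->] ->; exists c'; rewrite ?preim_hyperplane.
  rewrite -csA size_map -(count_fibres cs (fun c' => hyperplane (N *m c'))).
  rewrite (perm_big D) /=; last by apply: uniq_perm; rewrite ?undup_uniq.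
  rewrite -dsD big_map size_map -sum1_size -big_split /= big_seq [RHS]big_seq.
  apply: eq_bigr => d dds; rewrite /e addn1 prednK // size_filter -has_count.
  have : hyperplane d \in D by rewrite -dsD map_f.
  by rewrite -E mem_undup => /mapP[c' c'cs ->]; apply/hasP; exists c'.
have hp : homdeg b (lin_subst N (vf_apply f c)).
  apply: homdeg_lin_subst; apply: homdeg_sum => j _.
  by move=> v; rewrite !mevalZ hf mulrCA.
have g0 : g = 0.
  apply: (@hom_shift_eq0 _ _ (\sum_(d <- ds) e d) b).
    by apply: hom_shift_cancel Q0 hQ _; rewrite -gE.
  by rewrite -(ltn_add2r (size D)) sz.
apply/tangentP => v vc; rewrite -(LN v vc) -meval_lin_subst gE g0 mulr0.
exact: meval0.
Qed.

(** The restriction of a field to a hyperplane, in the coordinates of a chart; it has this meaning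
    for fields tangent to that hyperplane. *)
Definition restrict_vf (R : realType) (n k : nat) (N : 'M[R]_(k, n)) (L : 'M[R]_(n, k))
    (f : 'rV[{mpoly R[n]}]_n) : 'rV[{mpoly R[k]}]_k :=
  map_mx (lin_subst N) f *m map_mx (@mpolyC k R) L.

Lemma meval_restrict_vf (R : realType) (n k : nat) (N : 'M[R]_(k, n)) (L : 'M[R]_(n, k))
    (f : 'rV[{mpoly R[n]}]_n) (w : 'rV[R]_k) :
  map_mx (meval (w 0)) (restrict_vf N L f) = map_mx (meval ((w *m N) 0)) f *m L.
Proof.
rewrite map_mxM; congr (_ *m _); apply/matrixP => i j; rewrite !mxE.
  exact: meval_lin_subst.
exact: mevalC.
Qed.

Lemma homdeg_restrict_vf (R : realType) (n k d : nat) (N : 'M[R]_(k, n)) (L : 'M[R]_(n, k))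
    (f : 'rV[{mpoly R[n]}]_n) :
  (forall j, homdeg d (f 0 j)) -> forall j, homdeg d (restrict_vf N L f 0 j).
Proof.
move=> hf j; rewrite mxE; apply: homdeg_sum => i _; rewrite !mxE -[d]addn0.
by apply: homdegM; [apply: homdeg_lin_subst|apply: homdegC].
Qed.

Lemma tangent_restrict_vf (R : realType) (n k : nat) (c : 'cV[R]_n) (N : 'M[R]_(k, n))
    (L : 'M[R]_(n, k)) (f : 'rV[{mpoly R[n]}]_n) (K : {vspace 'rV[R]_n}) :
  chart c N L -> tangent (hyperplane c) f -> tangent K f ->
  tangent (preim_mx N K) (restrict_vf N L f).
Proof.
case=> c0 Nc NL LN tc tK w; rewrite !mem_preim_mx meval_restrict_vf => wK.
rewrite LN; first exact: tK.
apply/eqP; rewrite -mem_hyperplane; apply: tc.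
by rewrite mem_hyperplane -mulmxA Nc mulmx0.
Qed.

(* Divided by the form [c], this combination can replace row [i] of [T]: its
   coefficient there is 1. *)
Definition relation_on (R : realType) (n : nat) (c : 'cV[R]_n)
    (T : 'M[{mpoly R[n]}]_n) (d : nat) (i : 'I_n) : Prop :=
  exists g : 'rV[{mpoly R[n]}]_n,
    [/\ g 0 i = 1, forall j, homdeg d ((g *m T) 0 j)
      & forall j, vanish c ((g *m T) 0 j)].

Definition set_row (S : comNzRingType) (n : nat) (i : 'I_n) (g : 'rV[S]_n) (T : 'M[S]_n) :=
  \matrix_(i', j) (if i' == i then g 0 j else T i' j).

Lemma row_set_row (S : comNzRingType) (n : nat) (i i' : 'I_n) (g : 'rV[S]_n) (T : 'M[S]_n) :
  row i' (set_row i g T) = if i' == i then g else row i' T.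
Proof. by apply/rowP => j; rewrite !mxE; case: eqP => _; rewrite ?mxE. Qed.

Lemma det_set_row (S : comNzRingType) (n : nat) (i : 'I_n) (g : 'rV[S]_n) (T : 'M[S]_n) :
  \det (set_row i (g *m T) T) = g 0 i * \det T.
Proof.
have -> : set_row i (g *m T) T = set_row i g 1%:M *m T.
  apply/row_matrixP => i'; rewrite row_mul !row_set_row.
  by case: eqP => _ //; rewrite row1 -rowE.
rewrite det_mulmx; congr (_ * _).
rewrite (expand_det_col _ i) (bigD1 i) //= big1 => [|i' ne].
  rewrite mxE eqxx addr0 /cofactor.
  have -> : row' i (col' i (set_row i g 1%:M)) = 1%:M.
    apply/matrixP => x y; rewrite !mxE eq_sym (negPf (neq_lift _ _)).
    by rewrite (inj_eq lift_inj).
  by rewrite det1 mulr1 -signr_odd addnn odd_double mulr1.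
by rewrite !mxE (negPf ne) mul0r.
Qed.

Lemma det_set_row_scale (S : comNzRingType) (n : nat) (i : 'I_n) (a : S) (g : 'rV[S]_n)
    (T : 'M[S]_n) : \det (set_row i (a *: g) T) = a * \det (set_row i g T).
Proof.
rewrite (determinant_multilinear (A := set_row i (a *: g) T) (B := set_row i g T)
  (C := set_row i g T) (i0 := i) (b := a) (c := 0)) ?mul0r ?addr0 //.
- by rewrite !row_set_row eqxx scale0r addr0.
- by apply/matrixP => x y; rewrite !mxE eq_sym (negPf (neq_lift _ _)).
- by apply/matrixP => x y; rewrite !mxE eq_sym (negPf (neq_lift _ _)).
Qed.

(** Since [g 0 i = 1], putting [g *m T] in row [i] keeps the determinant, and dividing that row by
    the form divides it by the form. The quotient stays tangent to [A] because the form is not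
    identically zero on any member of [A]. *)
Lemma relation_division (R : realType) (n d : nat) (A : arrangement R n)
    (c : 'cV[R]_n) b (T : 'M[{mpoly R[n]}]_n) (i : 'I_n) :
  c != 0 -> hyperplane c \notin A ->
  saito_matrix (hyperplane c :: A) b T -> relation_on c T d i ->
  exists f : 'rV[{mpoly R[n]}]_n,
    [/\ (0 < d)%N, forall j, homdeg d.-1 (f 0 j), forall H, H \in A -> tangent H f
      & linear_form c * \det (set_row i f T) = \det T].
Proof.
move=> c0 cA [hA sb d0 hT tT] [g [gi hg vg]].
have /fin_all_exists[f0 f0E] : forall j, exists h, (g *m T) 0 j = linear_form c * h.
  by move=> j; apply: vanish_dvd.
pose f := \row_j f0 j.
have fE : g *m T = linear_form c *: f by apply/rowP => j; rewrite f0E !mxE.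
have fdet : linear_form c * \det (set_row i f T) = \det T.
  by rewrite -det_set_row_scale -fE det_set_row gi mul1r.
have hs j : hom_shift 1 d (f 0 j).
  apply: hom_shift_cancel (linear_form_neq0 c0) (homdeg_linear_form c) _.
  by have := hg j; rewrite fE !mxE.
(* For [d = 0] the quotient [f] would have degree -1, hence be zero, against [\det T != 0]. *)
have dpos : (0 < d)%N.
  rewrite lt0n; apply: contraNneq d0 => dE.
  have -> : \det T = 0; last by [].
  rewrite -fdet (expand_det_row _ i) big1 ?mulr0 // => j _.
  rewrite !mxE eqxx; have := hs j; rewrite dE mxE => /hom_shift_eq0 -> //.
  by rewrite mul0r.
exists f; split => // [j|H HA].
  by apply: (@hom_shiftW _ _ 1); rewrite add1n prednK.
have [c' c'0 HE] : exists2 c', c' != 0 & H = hyperplane c'.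
  by apply: hA; rewrite inE HA orbT.
have [|v vc' vc] := hyperplane_neq c'0 c0.
  by rewrite -HE; apply: contraNneq cA => <-.
rewrite HE; apply/tangentP; apply: (vanish_prime c'0 vc' vc).
have -> : linear_form c * vf_apply f c' = vf_apply (g *m T) c'.
  rewrite fE mulr_sumr; apply: eq_bigr => j _.
  by rewrite [in RHS]mxE scalerAr.
apply/tangentP => w wH.
have -> : map_mx (meval (w 0)) (g *m T) = \sum_k (g 0 k).@[w 0] *: map_mx (meval (w 0)) (row k T).
  apply/rowP => j; rewrite !mxE rmorph_sum summxE /=; apply: eq_bigr => k _.
  by rewrite rmorphM /= !mxE.
by apply: memv_suml => k _; apply: memvZ; apply: tT => //; rewrite inE -HE HA orbT.
Qed.

Lemma det_xrow (S : comNzRingType) (n : nat) (i j : 'I_n) (T : 'M[S]_n) :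
  exists k : bool, \det (xrow i j T) = (-1) ^+ k * \det T.
Proof.
by rewrite xrowE det_mulmx det_perm; exists (tperm i j : bool).
Qed.

Lemma homdeg_shiftM (R : realType) (n e d : nat) (p q : {mpoly R[n]}) :
  hom_shift e d p -> homdeg e q -> homdeg d (p * q).
Proof.
move=> hp hq v; rewrite !mevalM hq mulrCA mulrA hp; ring.
Qed.

Lemma relation_of_span (R : realType) (k : nat) (c : 'cV[R]_k.+1) (N : 'M[R]_(k, k.+1))
    (L : 'M[R]_(k.+1, k)) (b : 'I_k.+1 -> nat) (i0 i : 'I_k.+1) (T : 'M_k.+1)
    (P : 'M[{mpoly R[k]}]_k) (g : 'rV[{mpoly R[k]}]_k) (S : {set 'I_k}) :
  chart c N L -> (forall i, tangent (hyperplane c) (row i T)) ->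
  (forall i j, homdeg (b i) (T i j)) ->
  (forall j, j \in S -> row j P = restrict_vf N L (row (lift i0 j) T)) ->
  restrict_vf N L (row i T) = g *m P ->
  (forall j, hom_shift (b (lift i0 j)) (b i) (g 0 j)) ->
  (forall j, j \notin S -> g 0 j = 0) ->
  (forall j, j \in S -> lift i0 j != i) ->
  relation_on c T (b i) i.
Proof.
move=> [c0 Nc NL LN] tT hT PS gE hg gS Si.
pose h : 'rV[{mpoly R[k.+1]}]_k.+1 := delta_mx 0 i -
  \sum_(j in S) lin_subst L (g 0 j) *: delta_mx 0 (lift i0 j).
have hTE : h *m T = row i T - \sum_(j in S) lin_subst L (g 0 j) *: row (lift i0 j) T.
  rewrite mulmxBl -rowE mulmx_suml; congr (_ - _); apply: eq_bigr => j _.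
  by rewrite -scalemxAl -rowE.
exists h; split.
- rewrite !mxE !eqxx summxE big1 ?subr0 // => j jS.
  by rewrite !mxE eqxx eq_sym (negPf (Si j jS)) mulr0.
- move=> j; rewrite hTE !mxE; apply: homdegD; first exact: hT.
  apply: homdegN; rewrite summxE; apply: homdeg_sum => j' j'S; rewrite !mxE.
  apply: (homdeg_shiftM (e := b (lift i0 j'))); last exact: hT.
  move=> v; rewrite !meval_lin_subst -scalemxAl; exact: hg.
move=> j v vc.
have E : map_mx (meval (v 0)) (h *m T) = 0.
  rewrite -[LHS](LN); last first.
    apply/eqP; rewrite -mem_hyperplane map_mxM.
    have -> : map_mx (meval (v 0)) h *m map_mx (meval (v 0)) T =
      \sum_k (h 0 k).@[v 0] *: map_mx (meval (v 0)) (row k T).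
      rewrite mulmx_sum_row; apply: eq_bigr => k' _; rewrite mxE; congr (_ *: _).
      by apply/rowP => ?; rewrite !mxE.
    apply: memv_suml => k' _; apply: memvZ; apply: tT.
    by rewrite mem_hyperplane vc.
  have -> : map_mx (meval (v 0)) (h *m T) *m L = map_mx (meval ((v *m L) 0)) (restrict_vf N L (h *m T)).
    by rewrite meval_restrict_vf LN.
  suff -> : restrict_vf N L (h *m T) = 0 by rewrite map_mx0 mul0mx.
  apply/eqP; rewrite hTE /restrict_vf.
  have -> : map_mx (lin_subst N) (row i T - \sum_(j0 in S) lin_subst L (g 0 j0) *: row (lift i0 j0) T)
    = map_mx (lin_subst N) (row i T) - \sum_(j0 in S) g 0 j0 *: map_mx (lin_subst N) (row (lift i0 j0) T).
    apply/rowP => x; rewrite !mxE !summxE /lin_subst rmorphB rmorph_sum /=; congr (_ - _).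
    apply: eq_bigr => y _; rewrite !mxE rmorphM /=; congr (_ * _).
    rewrite -/(lin_subst L _) -/(lin_subst N _); apply: mpoly_ext => w.
    by rewrite !meval_lin_subst -mulmxA NL mulmx1.
  rewrite mulmxBl mulmx_suml -/(restrict_vf N L _) gE subr_eq0; apply/eqP.
  rewrite mulmx_sum_row [LHS](bigID (mem S)) /= [X in _ + X]big1 ?addr0; last first.
    by move=> y yS; rewrite gS // scale0r.
  by apply: eq_bigr => y yS; rewrite PS // -scalemxAl.
by have := congr1 (fun M : 'rV_k.+1 => M 0 j) E; rewrite !mxE.
Qed.

Lemma row_xrow_set_row (S : comNzRingType) (n : nat) (i j x : 'I_n) (g : 'rV[S]_n)
    (T : 'M[S]_n) :
  row x (xrow j i (set_row i g T)) =
  if x == j then g else if x == i then row j T else row x T.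
Proof.
have -> : row x (xrow j i (set_row i g T)) = row (tperm j i x) (set_row i g T).
  by apply/rowP => y; rewrite !mxE.
rewrite row_set_row; case: tpermP => [->|->|/eqP xj /eqP xi].
- by rewrite !eqxx.
- by rewrite [i == j]eq_sym eqxx.
by rewrite (negPf xj) (negPf xi).
Qed.

(* The rows of [P] are replaced one at a time, by increasing degree, by
   restrictions of rows of [T], until one of these restrictions depends on those
   already used. *)
Lemma exchange (R : realType) (k : nat) (c : 'cV[R]_k.+1) (N : 'M[R]_(k, k.+1))
    (L : 'M[R]_(k.+1, k)) (A : arrangement R k.+1) (b : 'I_k.+1 -> nat) (i0 : 'I_k.+1)
    (T : 'M_k.+1) (P : 'M[{mpoly R[k]}]_k) (S : {set 'I_k}) :
  chart c N L -> saito_matrix (hyperplane c :: A) b T ->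
  saito_matrix [seq preim_mx N K | K <- A] (fun j => b (lift i0 j)) P ->
  (forall j, j \in S -> row j P = restrict_vf N L (row (lift i0 j) T)) ->
  exists2 i, (b i <= b i0)%N & relation_on c T (b i) i.
Proof.
move=> ch sT; have [hA sb d0 hT tT] := sT; have [c0 Nc NL LN] := ch.
have tc i : tangent (hyperplane c) (row i T) by apply: tT; rewrite mem_head.
have tR i K : K \in [seq preim_mx N K | K <- A] -> tangent K (restrict_vf N L (row i T)).
  move=> /mapP[K' K'A ->]; apply: (tangent_restrict_vf ch) => //.
  by apply: tT; rewrite inE K'A orbT.
have hR i j : homdeg (b i) (restrict_vf N L (row i T) 0 j).
  by apply: homdeg_restrict_vf => {}j; rewrite mxE; apply: hT.
have [m] := ubnP #|~: S|; elim: m P S => // m IH P S; rewrite ltnS => Sm sP PS.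
have [/forallP noj|] := boolP [forall j, (j \in S) || (b i0 < b (lift i0 j))%N].
  exists i0 => //; have [g gE hg] := saito_span sP (tR i0).
  apply: (relation_of_span ch tc hT PS gE).
  - by move=> j; apply: hg; apply: hR.
  - move=> j jS; have := noj j; rewrite (negPf jS) /= => lt.
    by apply: hom_shift_eq0 lt; apply: hg; apply: hR.
  - by move=> j _; rewrite eq_sym neq_lift.
rewrite negb_forall => /existsP[j1]; rewrite negb_or -leqNgt => /andP[j1S j1b].
have [j jS jmin] := arg_minnP (fun j => b (lift i0 j)) (P := [pred j | j \notin S]) j1S.
have jb : (b (lift i0 j) <= b i0)%N by apply: leq_trans (jmin _ j1S) j1b.
have [g gE hg] := saito_span sP (tR (lift i0 j)).
have {}hg := hg _ (hR (lift i0 j)).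
have [/forallP gS|] := boolP [forall j', (j' \in S) || (g 0 j' == 0)].
  exists (lift i0 j) => //; apply: (relation_of_span ch tc hT PS gE) => //.
  - by move=> j' j'S; have := gS j'; rewrite (negPf j'S) => /eqP.
  - by move=> j' j'S; rewrite (inj_eq lift_inj); apply: contraNneq jS => <-.
rewrite negb_forall => /existsP[j']; rewrite negb_or => /andP[j'S gj'].
have bj' : b (lift i0 j') = b (lift i0 j).
  apply/eqP; rewrite eqn_leq jmin // andbT leqNgt.
  by apply: contra gj' => lt; apply/eqP; apply: hom_shift_eq0 lt.
have [k' k'E] : exists k', g 0 j' = k'%:MP.
  by apply: (@hom_shift_const _ _ (b (lift i0 j))); rewrite -{1}bj'.
pose P' := xrow j j' (set_row j' (g *m P) P).
have rowP' i : row i P' = if i == j then g *m P else if i == j' then row j P else row i P.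
  exact: row_xrow_set_row.
have [hA'' sb'' d0'' hP tP] := sP.
apply: (IH P' (j |: S)).
- apply: leq_trans Sm; apply: proper_card; apply/properP; split.
    by apply/subsetP => x; rewrite !inE negb_or => /andP[].
  by exists j; rewrite !inE ?jS // eqxx.
- split=> //.
  + rewrite /P'; have [kk ->] := det_xrow j j' (set_row j' (g *m P) P).
    by rewrite det_set_row !mulf_neq0 // signr_eq0.
  + move=> i x; have -> : P' i x = row i P' 0 x by rewrite [RHS]mxE.
    rewrite rowP'; case: eqP => [->|_]; first by rewrite -gE; apply: hR.
    case: eqP => [->|_]; rewrite mxE ?bj'; exact: hP.
  + move=> i K KA; rewrite rowP'; case: eqP => [_|_]; first by rewrite -gE; apply: tR.
    by case: eqP => _; apply: tP.
move=> x; rewrite !inE rowP'; case: eqP => [-> _|_ /= xS]; first by rewrite gE.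
by rewrite ifN ?PS //; apply: contraNneq j'S => <-.
Qed.

Lemma deletion (R : realType) (k : nat) (c : 'cV[R]_k.+1) (N : 'M[R]_(k, k.+1))
    (L : 'M[R]_(k.+1, k)) (A : arrangement R k.+1) (b : 'I_k.+1 -> nat) (i0 : 'I_k.+1)
    (T : 'M_k.+1) (P : 'M[{mpoly R[k]}]_k) :
  chart c N L -> hyperplane c \notin A -> saito_matrix (hyperplane c :: A) b T ->
  saito_matrix [seq preim_mx N K | K <- A] (fun j => b (lift i0 j)) P ->
  (0 < b i0)%N /\
  exists T', saito_matrix A (fun i => if i == i0 then (b i0).-1 else b i) T'.
Proof.
move=> ch cA sT sP; have [hA sb d0 hT tT] := sT; have [c0 Nc NL LN] := ch.
have [|i ib rel] := @exchange _ _ _ _ _ _ _ _ _ _ set0 ch sT sP.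
  by move=> j; rewrite inE.
have [f [bpos hf tf fdet]] := relation_division c0 cA sT rel.
have sbA : (\sum_i b i)%N = (size (undup A)).+1 by rewrite sb /= (negPf cA).
have sb'' : (\sum_j b (lift i0 j))%N = size (undup [seq preim_mx N K | K <- A]).
  by have [_ -> _ _ _] := sP.
have hA' : of_hyperplanes A by move=> H HA; apply: hA; rewrite inE HA orbT.
have sdel : (b i0 + size (undup [seq preim_mx N K | K <- A]))%N = (size (undup A)).+1.
  by rewrite -sbA -sb'' (bigD1_ord i0).
have d0' : \det (set_row i f T) != 0.
  by apply: contraNneq d0 => z; rewrite -fdet z mulr0.
have tf' H i' : H \in A -> tangent H (row i' (set_row i f T)).
  move=> HA; rewrite row_set_row; case: eqP => _; first exact: tf.
  by apply: tT; rewrite inE HA orbT.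
have [bi|bi] := ltnP (b i) (b i0); last first.
  have {ib bi} bi : b i = b i0 by apply/eqP; rewrite eqn_leq ib.
  rewrite -bi; split=> //; exists (xrow i0 i (set_row i f T)); split; first exact: hA'.
  - rewrite (bigD1_ord i0) //= eqxx.
    under eq_bigr => j _ do rewrite eq_sym (negPf (neq_lift _ _)).
    by apply: succn_inj; rewrite -sdel -sb'' -addSn prednK // bi.
  - have [kk ->] := det_xrow i0 i (set_row i f T).
    by rewrite mulf_neq0 // signr_eq0.
  - move=> x j; set M := xrow _ _ _; have -> : M x j = row x M 0 j by rewrite [RHS]mxE.
    rewrite row_xrow_set_row; case: eqP => _; first exact: hf.
    by case: eqP => [->|_]; rewrite mxE ?bi; apply: hT.
  move=> x H HA; rewrite row_xrow_set_row; case: eqP => _; first exact: tf.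
  by case: eqP => _; apply: tT; rewrite inE HA orbT.
(* The new row would have too low a degree not to be tangent to the deleted
   hyperplane. *)
have tcf : tangent (hyperplane c) f.
  by apply: (tangent_of_low_degree (b := (b i).-1) ch hA' cA tf hf); lia.
have [cs [k0 [csA cs0 k00 dE]]] := saito_det sT.
have ucs : uniq [seq hyperplane c | c <- cs] by rewrite csA undup_uniq.
have [c' c'cs|g gE] := prod_dvd (p := \det (set_row i f T)) ucs cs0.
  apply: det_tangent => [|i']; first by apply: contraNneq cs0 => <-.
  have : hyperplane c' \in hyperplane c :: A by rewrite -mem_undup -csA map_f.
  rewrite inE => /orP[/eqP ->|]; last exact: tf'.
  rewrite row_set_row; case: eqP => _ //; apply: tT; exact: mem_head.
have : \prod_(c <- cs) linear_form c != 0.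
  by apply: contraNneq d0 => z; rewrite dE z mul0r.
move/mulfI/(_ (linear_form c * g) k0%:MP); rewrite mulrCA -gE fdet dE => /(_ erefl).
move/(congr1 (meval ((0 : 'rV[R]_k.+1) 0))).
rewrite mevalM meval_linear_form mul0mx mxE mul0r mevalC => /eqP.
by rewrite eq_sym (negPf k00).
Qed.

Definition saito (R : realType) (n : nat) (A : arrangement R n) (e : seq nat) : Prop :=
  size e = n /\ exists T, saito_matrix A (fun i => nth 0%N e i) T.

Lemma saito_perm (R : realType) (n : nat) (A : arrangement R n) (e e' : seq nat) :
  perm_eq e e' -> saito A e -> saito A e'.
Proof.
move=> pe [sz [T [hA sb d0 hT tT]]].
have sz' : size e' = n by rewrite -(perm_size pe).
have pe' : perm_eq (Tuple (introT eqP sz')) (Tuple (introT eqP sz)) by rewrite perm_sym.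
have /tuple_permP[s sE] := pe'.
have nE (i : 'I_n) : nth 0%N e' i = nth 0%N e (s i).
  have -> : e' = [tuple tnth (Tuple (introT eqP sz)) (s i) | i < n] by exact: sE.
  by rewrite -tnth_nth tnth_mktuple (tnth_nth 0%N).
split=> //; exists (row_perm s T); split => //.
- rewrite -sb [RHS](reindex_inj (perm_inj (s := s))) /=.
  by apply: eq_bigr => i _; rewrite nE.
- by rewrite row_permE det_mulmx det_perm mulf_neq0 // signr_eq0.
- by move=> i j; rewrite nE mxE; apply: hT.
move=> i H HA; have -> : row i (row_perm s T) = row (s i) T by apply/rowP => j; rewrite !mxE.
exact: tT.
Qed.

Lemma saito_eq_mem (R : realType) (n : nat) (A B : arrangement R n) (e : seq nat) :
  A =i B -> saito A e -> saito B e.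
Proof.
move=> AB [sz [T [hA sb d0 hT tT]]]; split=> //; exists T; split => //.
- by move=> H; rewrite -AB; apply: hA.
- rewrite sb; apply/perm_size/uniq_perm; rewrite ?undup_uniq // => H.
  by rewrite !mem_undup AB.
by move=> i H; rewrite -AB; apply: tT.
Qed.

Lemma lin_subst_unit_neq0 (R : realType) (n : nat) (g : 'M[R]_n) (p : {mpoly R[n]}) :
  g \in unitmx -> p != 0 -> lin_subst g p != 0.
Proof.
move=> gu; apply: contraNneq => E; apply/eqP/mpoly_ext => v.
by rewrite -[v](mulmxKV gu) -meval_lin_subst E !meval0.
Qed.

Lemma saito_preim (R : realType) (n : nat) (A : arrangement R n) (e : seq nat)
    (g : 'M[R]_n) :
  g \in unitmx -> saito A e -> saito [seq preim_mx g K | K <- A] e.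
Proof.
move=> gu [sz [T [hA sb d0 hT tT]]]; split=> //.
pose T' := map_mx (lin_subst g) T *m map_mx (@mpolyC n R) (invmx g).
have rowT' i : row i T' = restrict_vf g (invmx g) (row i T).
  by rewrite /T' row_mul -map_row.
exists T'; split.
- move=> H /mapP[K /hA[c c0 ->] ->]; rewrite preim_hyperplane; exists (g *m c) => //.
  by apply: contraNneq c0 => gc; rewrite -(mulKmx gu c) gc mulmx0.
- rewrite undup_map_inj ?size_map // => K K' KK'; apply/vspaceP => v.
  by rewrite -[v](mulmxKV gu) -!mem_preim_mx KK'.
- rewrite det_mulmx mulf_neq0 //.
    rewrite (det_map_mx (comp_mpoly _)); exact: lin_subst_unit_neq0.
  rewrite det_map_mx mpolyC_eq0; rewrite -unitfE -/(_ \in unitmx).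
  by have := unitmx_inv g; rewrite gu unitmxE.
- move=> i j; have -> : T' i j = row i T' 0 j by rewrite [RHS]mxE.
  by rewrite rowT'; apply: homdeg_restrict_vf => k; rewrite mxE.
move=> i H /mapP[K KA ->] v; rewrite !mem_preim_mx rowT' meval_restrict_vf => vK.
by rewrite mulmxKV //; apply: tT.
Qed.

Lemma deletion_seq (R : realType) (k : nat) (c : 'cV[R]_k.+1) (N : 'M[R]_(k, k.+1))
    (L : 'M[R]_(k.+1, k)) (A : arrangement R k.+1) (d : nat) (e : seq nat) :
  chart c N L -> hyperplane c \notin A -> saito (hyperplane c :: A) (d :: e) ->
  saito [seq preim_mx N K | K <- A] e ->
  (0 < d)%N /\ saito A (d.-1 :: e).
Proof.
move=> ch cA [sz [T sT]] [sz' [P sP]].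
have [dpos [T' sT']] := deletion (i0 := ord0) ch cA sT sP.
split=> //; split=> //; exists T'.
have [hA sb d0 hT tT] := sT'; split=> //.
  by rewrite -sb; apply: eq_bigr => i _; case: (unliftP ord0 i) => [j ->|->].
by move=> i j; have := hT i j; case: (unliftP ord0 i) => [x ->|->].
Qed.

Lemma deletion_iter (R : realType) (k : nat) (X : seq 'cV[R]_k.+1)
    (A : arrangement R k.+1) (d : nat) (e : seq nat) :
  uniq [seq hyperplane c | c <- X] -> (forall c, c \in X -> hyperplane c \notin A) ->
  (forall c Y, {subset c :: Y <= X} -> hyperplane c \notin [seq hyperplane c | c <- Y] ->
    exists (N : 'M[R]_(k, k.+1)) (L : 'M[R]_(k.+1, k)), chart c N L /\
      saito [seq preim_mx N K | K <- [seq hyperplane c | c <- Y] ++ A] e) ->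
  saito ([seq hyperplane c | c <- X] ++ A) (d :: e) ->
  (size X <= d)%N /\ saito A ((d - size X)%N :: e).
Proof.
elim: X d => [|c X IH] d /=; first by rewrite subn0.
move=> /andP[cX uX] XA res sA.
have [|N [L [ch sR]]] := res c X _ cX; first by move=> x.
have [|dpos sA'] := deletion_seq ch _ sA sR.
  by rewrite mem_cat negb_or cX XA // mem_head.
have [||Xd ?] := IH d.-1 uX _ _ sA'.
- by move=> x xX; apply: XA; rewrite inE xX orbT.
- by move=> x Y sub; apply: res => y /sub yX; rewrite inE yX orbT.
split; first by rewrite -(prednK dpos) ltnS.
by rewrite -(prednK dpos) subSS.
Qed.

Definition vf_der (R : realType) (n : nat) (f : 'rV[{mpoly R[n]}]_n) (p : {mpoly R[n]}) :=
  \sum_j f 0 j * p^`M(j).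

Fact vf_der_is_linear (R : realType) (n : nat) (f : 'rV[{mpoly R[n]}]_n) :
  linear (vf_der f).
Proof.
move=> a p q; rewrite /vf_der scaler_sumr -big_split /=; apply: eq_bigr => j _.
by rewrite linearP /= mulrDr scalerAr.
Qed.

HB.instance Definition _ (R : realType) (n : nat) (f : 'rV[{mpoly R[n]}]_n) :=
  GRing.isLinear.Build R {mpoly R[n]} {mpoly R[n]} *:%R (vf_der f) (vf_der_is_linear f).

Lemma vf_derX (R : realType) (n : nat) (f : 'rV[{mpoly R[n]}]_n) (i : 'I_n) :
  vf_der f 'X_i = f 0 i.
Proof.
rewrite /vf_der (bigD1 i) //= big1 => [|j ne].
  have -> : ('X_i)^`M(i) = 1 :> {mpoly R[n]}; last by rewrite mulr1 addr0.
  rewrite mderivX mnm1E eqxx scale1r -mpolyX0; congr 'X_[_].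
  by apply/mnmP => x; rewrite mnmBE subnn mnm0E.
by rewrite mderivX mnm1E eq_sym (negPf ne) scale0r mulr0.
Qed.

Lemma vf_derM (R : realType) (n : nat) (f : 'rV[{mpoly R[n]}]_n) (p q : {mpoly R[n]}) :
  vf_der f (p * q) = vf_der f p * q + p * vf_der f q.
Proof.
rewrite /vf_der mulr_suml mulr_sumr -big_split /=; apply: eq_bigr => j _.
by rewrite mderivM; ring.
Qed.

Lemma derivation_vf (R : realType) (n : nat)
    (theta : {linear {mpoly R[n]} -> {mpoly R[n]}}) :
  is_derivation theta -> forall p, theta p = vf_der (\row_j theta 'X_j) p.
Proof.
move=> der; set f := \row_j _.
have t1 : theta 1 = 0.
  have := der 1 1; rewrite !mulr1 mul1r => E; apply: (addrI (theta 1)).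
  by rewrite addr0 -E.
have f1 : vf_der f 1 = 0.
  have := vf_derM f 1 1; rewrite !mulr1 mul1r => E; apply: (addrI (vf_der f 1)).
  by rewrite addr0 -E.
have tX m : theta 'X_[m] = vf_der f 'X_[m].
  rewrite mpolyXE_id.
  elim/big_ind: _ => [|x y hx hy|i _]; first by rewrite t1 f1.
    by rewrite der vf_derM hx hy.
  elim: (m i) => [|k IH]; first by rewrite expr0 t1 f1.
  by rewrite exprS der vf_derM IH vf_derX mxE.
elim/mpolyind => [|a m p _ _ IH]; first by rewrite !linear0.
by rewrite !linearP /= IH tX.
Qed.

Lemma theta_linear_form (R : realType) (n : nat)
    (theta : {linear {mpoly R[n]} -> {mpoly R[n]}}) (c : 'cV[R]_n) :
  theta (linear_form c) = vf_apply (\row_j theta 'X_j) c.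
Proof.
rewrite /linear_form linear_sum; apply: eq_bigr => i _.
by rewrite linearZ mxE.
Qed.

Lemma saito_free (R : realType) (n : nat) (A : arrangement R n) (e : seq nat) :
  saito A e -> free_with_exponents A e.
Proof.
case=> sz; subst n => -[T sT]; have [hA sb d0 hT tT] := sT.
exists (fun i => vf_der (row i T)); split; last first.
  by move=> i j; rewrite /= vf_derX mxE; apply: homdeg_dhomog; apply: hT.
have rowE i : \row_j vf_der (row i T) 'X_j = row i T.
  by apply/rowP => j; rewrite mxE vf_derX.
split.
- move=> i; split; first exact: vf_derM.
  move=> H c HA HE; rewrite theta_linear_form /= rowE.
  have [->|c0] := eqVneq c 0.
    exists 0; rewrite linear_form0 mul0r /vf_apply big1 // => j _.
    by rewrite mxE scale0r.
  by apply: vanish_dvd => //; apply/tangentP; rewrite -HE; apply: tT.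
- move=> eta [der tan].
  have [H HA|g gE _] := saito_span (f := \row_j eta 'X_j) sT.
    have [c c0 HE] := hA H HA; rewrite HE; apply/tangentP => v vc.
    have [g gE] := tan H c HA HE.
    by rewrite -theta_linear_form gE mevalM meval_linear_form vc mxE mul0r.
  exists (fun i => g 0 i) => p; rewrite (derivation_vf der) gE /=.
  rewrite /vf_der; under [RHS]eq_bigr => i _ do rewrite mulr_sumr.
  rewrite exchange_big /=; apply: eq_bigr => j _; rewrite mxE mulr_suml.
  by apply: eq_bigr => i _; rewrite mxE mulrA.
move=> f f0 i; have E : (\row_i f i) *m T = 0.
  apply/rowP => j; rewrite !mxE -[RHS](f0 'X_j); apply: eq_bigr => x _.
  by rewrite /= vf_derX !mxE.
have := congr1 (mulmxr (\adj T)) E; rewrite /= mul0mx -mulmxA mul_mx_adj mul_mx_scalar.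
move/rowP/(_ i); rewrite !mxE => /eqP; rewrite mulf_eq0 (negPf d0) => /eqP //.
Qed.

(** * Arrangements of type B and their restrictions *)

Definition affine_form (R : realType) (l : nat) (c : 'cV[R]_l) (s : R) : 'cV[R]_(l + 1) :=
  col_mx c (- s)%:M.

Definition infinity_form (R : realType) (l : nat) : 'cV[R]_(l + 1) := col_mx 0 1%:M.

(* The coordinate hyperplanes are [x_i = q / 2] for [q] in [T]. *)
Definition typeB (R : realType) (l a : nat) (T : seq int) : affine_arrangement R l :=
  let pairs := [seq p : 'I_l * 'I_l <- enum {: 'I_l * 'I_l} | (p.1 < p.2)%N] in
  [seq (coord_form R p.1 + coord_form R p.2, s%:~R)
     | p <- pairs, s <- int_range a] ++
  [seq (coord_form R p.1 - coord_form R p.2, s%:~R)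
     | p <- pairs, s <- int_range a] ++
  [seq (coord_form R i, q%:~R / 2) | i <- enum 'I_l, q <- T].

Definition zcoord (l : nat) : 'I_(l + 1) := rshift l ord0.

Lemma mem_affine (R : realType) (l : nat) (c : 'cV[R]_l) (s : R) (v : 'rV[R]_(l + 1)) :
  (v \in hyperplane (affine_form c s)) = ((lsubmx v *m c) 0 0 == s * v 0 (zcoord l)).
Proof.
rewrite mem_hyperplane -{1}[v]hsubmxK mul_row_col mul_mx_scalar scaleNr subr_eq0.
rewrite [LHS](inj_eq (f := fun M : 'M[R]_1 => M) _ _ _) //.
apply/eqP/eqP => [->|E]; first by rewrite !mxE.
by apply/matrixP => i j; rewrite !ord1 E !mxE.
Qed.

Lemma mem_infinity (R : realType) (l : nat) (v : 'rV[R]_(l + 1)) :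
  (v \in hyperplane (infinity_form R l)) = (v 0 (zcoord l) == 0).
Proof.
rewrite mem_hyperplane -{1}[v]hsubmxK mul_row_col mulmx0 add0r mulmx1.
apply/eqP/eqP => [/matrixP/(_ 0 0)|E]; first by rewrite !mxE.
by apply/matrixP => i j; rewrite !ord1 !mxE E.
Qed.

Lemma mul_coord_form (R : realType) (l : nat) (i : 'I_l) (v : 'rV[R]_(l + 1)) :
  (lsubmx v *m coord_form R i) 0 0 = v 0 (lshift 1 i).
Proof. by rewrite -colE !mxE. Qed.

Lemma mem_plus (R : realType) (l : nat) (i j : 'I_l) (s : R) (v : 'rV[R]_(l + 1)) :
  (v \in hyperplane (affine_form (coord_form R i + coord_form R j) s)) =
  (v 0 (lshift 1 i) + v 0 (lshift 1 j) == s * v 0 (zcoord l)).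
Proof. by rewrite mem_affine mulmxDr mxE !mul_coord_form. Qed.

Lemma mem_minus (R : realType) (l : nat) (i j : 'I_l) (s : R) (v : 'rV[R]_(l + 1)) :
  (v \in hyperplane (affine_form (coord_form R i - coord_form R j) s)) =
  (v 0 (lshift 1 i) - v 0 (lshift 1 j) == s * v 0 (zcoord l)).
Proof. by rewrite mem_affine mulmxBr -!mul_coord_form !mxE. Qed.

Lemma mem_single (R : realType) (l : nat) (i : 'I_l) (s : R) (v : 'rV[R]_(l + 1)) :
  (v \in hyperplane (affine_form (coord_form R i) s)) =
  (v 0 (lshift 1 i) == s * v 0 (zcoord l)).
Proof. by rewrite mem_affine mul_coord_form. Qed.

Variant typeB_spec (R : realType) (l a : nat) (T : seq int) : {vspace 'rV[R]_(l + 1)} -> Prop :=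
| TypeBinf : typeB_spec a T (hyperplane (infinity_form R l))
| TypeBplus (i j : 'I_l) s of (i < j)%N & s \in int_range a :
    typeB_spec a T (hyperplane (affine_form (coord_form R i + coord_form R j) s%:~R))
| TypeBminus (i j : 'I_l) s of (i < j)%N & s \in int_range a :
    typeB_spec a T (hyperplane (affine_form (coord_form R i - coord_form R j) s%:~R))
| TypeBsingle (i : 'I_l) q of q \in T :
    typeB_spec a T (hyperplane (affine_form (coord_form R i) (q%:~R / 2))).

Lemma typeBP (R : realType) (l a : nat) (T : seq int) H :
  H \in cone (typeB R l a T) <-> typeB_spec a T H.
Proof.
split.
  rewrite inE => /orP[/eqP ->|/mapP[h]]; first exact: TypeBinf.
  rewrite !mem_cat => /or3P[] /allpairsP[[p s] /= [hp hs ->]] -> /=.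
  - by apply: TypeBplus => //; move: hp; rewrite mem_filter => /andP[].
  - by apply: TypeBminus => //; move: hp; rewrite mem_filter => /andP[].
  exact: TypeBsingle.
case=> [|i j s ij hs|i j s ij hs|i q hq]; first exact: mem_head.
- rewrite inE; apply/orP; right; apply/mapP.
  exists (coord_form R i + coord_form R j, s%:~R) => //.
  rewrite !mem_cat; apply/orP; left; apply/allpairsP; exists ((i, j), s); split=> //.
  by rewrite mem_filter ij mem_enum.
- rewrite inE; apply/orP; right; apply/mapP.
  exists (coord_form R i - coord_form R j, s%:~R) => //.
  rewrite !mem_cat; apply/orP; right; apply/orP; left.
  by apply/allpairsP; exists ((i, j), s); split=> //; rewrite mem_filter ij mem_enum.
rewrite inE; apply/orP; right; apply/mapP.
exists (coord_form R i, q%:~R / 2) => //.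
rewrite !mem_cat; apply/orP; right; apply/orP; right.
by apply/allpairsP; exists (i, q); split=> //; rewrite mem_enum.
Qed.

Lemma typeB_plus (R : realType) (l a : nat) (T : seq int) (i j : 'I_l) s :
  i != j -> s \in int_range a ->
  hyperplane (affine_form (coord_form R i + coord_form R j) s%:~R) \in cone (typeB R l a T).
Proof.
move=> ij hs; apply/typeBP; have [lt|gt|/val_inj E] := ltngtP i j.
- exact: TypeBplus.
- by rewrite addrC; apply: TypeBplus.
by rewrite E eqxx in ij.
Qed.

Lemma typeB_minus (R : realType) (l a : nat) (T : seq int) (i j : 'I_l) s :
  i != j -> s \in int_range a ->
  hyperplane (affine_form (coord_form R i - coord_form R j) s%:~R) \in cone (typeB R l a T).
Proof.
move=> ij hs; apply/typeBP; have [lt|gt|/val_inj E] := ltngtP i j.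
- exact: TypeBminus.
- have -> : hyperplane (affine_form (coord_form R i - coord_form R j) s%:~R) =
    hyperplane (affine_form (coord_form R j - coord_form R i) (- s)%:~R).
    apply/vspaceP => v; rewrite !mem_minus -opprB rmorphN /= mulNr.
    by rewrite eqr_oppLR.
  by apply: TypeBminus => //; move: hs; rewrite !mem_int_range; lia.
by rewrite E eqxx in ij.
Qed.

Lemma typeB_single (R : realType) (l a : nat) (T : seq int) (i : 'I_l) q :
  q \in T ->
  hyperplane (affine_form (coord_form R i) (q%:~R / 2)) \in cone (typeB R l a T).
Proof. by move=> qT; apply/typeBP; apply: TypeBsingle. Qed.

(* The subspace on which [x_i] is the coordinate [x_j] ([sigma i = inl j]) or
   is equal to [(q / 2) z] ([sigma i = inr q]). *)
Definition subst_mx (R : realType) (l k : nat) (sigma : 'I_l -> 'I_k + int) :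
    'M[R]_(k + 1, l + 1) :=
  \matrix_(r, x) (match split x with
    | inl i => match sigma i with
        | inl j => delta_mx (lshift 1 j) 0
        | inr q => (q%:~R / 2) *: delta_mx (zcoord k) 0 end
    | inr _ => delta_mx (zcoord k) (0 : 'I_1) end : 'cV[R]_(k + 1)) r 0.

Definition subst_val (R : realType) (l k : nat) (sigma : 'I_l -> 'I_k + int)
    (w : 'rV[R]_(k + 1)) (i : 'I_l) : R :=
  match sigma i with
  | inl j => w 0 (lshift 1 j) | inr q => q%:~R / 2 * w 0 (zcoord k) end.

Lemma mul_delta (R : realType) (n : nat) (w : 'rV[R]_n) (r : 'I_n) :
  (w *m (delta_mx r 0 : 'cV[R]_n)) 0 0 = w 0 r.
Proof. by rewrite -colE mxE. Qed.

Lemma subst_mx_x (R : realType) (l k : nat) (sigma : 'I_l -> 'I_k + int)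
    (w : 'rV[R]_(k + 1)) (i : 'I_l) :
  (w *m subst_mx R sigma) 0 (lshift 1 i) = subst_val sigma w i.
Proof.
rewrite mxE; under eq_bigr => r _ do rewrite mxE (unsplitK (inl i)).
rewrite /subst_val; case: (sigma i) => [j|q].
  by rewrite -[RHS]mul_delta [RHS]mxE.
rewrite -[w 0 (zcoord k)]mul_delta [in RHS]mxE mulr_sumr.
by apply: eq_bigr => r _; rewrite mxE mulrCA.
Qed.

Lemma subst_mx_z (R : realType) (l k : nat) (sigma : 'I_l -> 'I_k + int)
    (w : 'rV[R]_(k + 1)) :
  (w *m subst_mx R sigma) 0 (zcoord l) = w 0 (zcoord k).
Proof.
rewrite mxE; under eq_bigr => r _ do rewrite mxE (unsplitK (inr ord0)).
by rewrite -[RHS]mul_delta [RHS]mxE.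
Qed.

Lemma rV_coordP (R : realType) (l : nat) (v w : 'rV[R]_(l + 1)) :
  (forall i, v 0 (lshift 1 i) = w 0 (lshift 1 i)) ->
  v 0 (zcoord l) = w 0 (zcoord l) -> v = w.
Proof.
move=> vx vz; apply/rowP => r; case: (split_ordP r) => j -> //.
by rewrite [j]ord1.
Qed.

Lemma hyperplane_full_or_infinity (R : realType) (k : nat) (K : {vspace 'rV[R]_(k + 1)}) (t : R) :
  (forall w, (w \in K) = (t * w 0 (zcoord k) == 0)) ->
  K = fullv \/ K = hyperplane (infinity_form R k).
Proof.
move=> KE; have [t0|t0] := eqVneq t 0; [left|right]; apply/vspaceP => w; rewrite KE.
  by rewrite t0 mul0r eqxx memvf.
by rewrite mem_infinity mulf_eq0 (negPf t0).
Qed.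

Lemma mem_preim_plus (R : realType) (l k : nat) (sigma : 'I_l -> 'I_k + int)
    (i j : 'I_l) (s : R) (w : 'rV[R]_(k + 1)) :
  (w \in preim_mx (subst_mx R sigma)
     (hyperplane (affine_form (coord_form R i + coord_form R j) s))) =
  (subst_val sigma w i + subst_val sigma w j == s * w 0 (zcoord k)).
Proof. by rewrite mem_preim_mx mem_plus !subst_mx_x subst_mx_z. Qed.

Lemma mem_preim_minus (R : realType) (l k : nat) (sigma : 'I_l -> 'I_k + int)
    (i j : 'I_l) (s : R) (w : 'rV[R]_(k + 1)) :
  (w \in preim_mx (subst_mx R sigma)
     (hyperplane (affine_form (coord_form R i - coord_form R j) s))) =
  (subst_val sigma w i - subst_val sigma w j == s * w 0 (zcoord k)).
Proof. by rewrite mem_preim_mx mem_minus !subst_mx_x subst_mx_z. Qed.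

Lemma mem_preim_single (R : realType) (l k : nat) (sigma : 'I_l -> 'I_k + int)
    (i : 'I_l) (s : R) (w : 'rV[R]_(k + 1)) :
  (w \in preim_mx (subst_mx R sigma) (hyperplane (affine_form (coord_form R i) s))) =
  (subst_val sigma w i == s * w 0 (zcoord k)).
Proof. by rewrite mem_preim_mx mem_single !subst_mx_x subst_mx_z. Qed.

Lemma typeB_restrict_sub (R : realType) (l k a : nat) (T T' : seq int)
    (sigma : 'I_l -> 'I_k + int) H :
  (forall i i' j, sigma i = inl j -> sigma i' = inl j -> i = i') ->
  {subset T <= T'} ->
  (forall i q s, sigma i = inr q -> s \in int_range a -> 2 * s - q \in T' /\ 2 * s + q \in T') ->
  H \in cone (typeB R l a T) ->
  preim_mx (subst_mx R sigma) H = fullv \/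
  preim_mx (subst_mx R sigma) H \in cone (typeB R k a T').
Proof.
move=> inj TT' hT'.
have fi (K : {vspace 'rV[R]_(k + 1)}) (t : R) : (forall w, (w \in K) = (t * w 0 (zcoord k) == 0)) ->
    K = fullv \/ K \in cone (typeB R k a T').
  by move=> /hyperplane_full_or_infinity[->|->]; [left|right; apply/typeBP; apply: TypeBinf].
case/typeBP => [|i j s ij hs|i j s ij hs|i q qT].
- right; have -> : preim_mx (subst_mx R sigma) (hyperplane (infinity_form R l)) = hyperplane (infinity_form R k).
    by apply/vspaceP => w; rewrite mem_preim_mx !mem_infinity subst_mx_z.
  by apply/typeBP; apply: TypeBinf.
- have ne : i != j by rewrite neq_ltn ij.
  case Ei: (sigma i) => [i'|q]; case Ej: (sigma j) => [j'|q'].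
  + right.
    have -> : preim_mx (subst_mx R sigma) (hyperplane (affine_form (coord_form R i + coord_form R j) s%:~R)) =
      hyperplane (affine_form (coord_form R i' + coord_form R j') s%:~R).
      apply/vspaceP => w; rewrite [LHS]mem_preim_plus [RHS]mem_plus.
      by rewrite /subst_val Ei Ej.
    apply: typeB_plus => //; apply: contraNneq ne => E; apply/eqP.
    by apply: (inj _ _ j'); rewrite // Ei E.
  + right.
    have -> : preim_mx (subst_mx R sigma) (hyperplane (affine_form (coord_form R i + coord_form R j) s%:~R)) =
      hyperplane (affine_form (coord_form R i') ((2 * s - q')%:~R / 2)).
      apply/vspaceP => w; rewrite [LHS]mem_preim_plus [RHS]mem_single.
      rewrite /subst_val Ei Ej rmorphB rmorphM /=; apply/eqP/eqP => E; lra.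
    by apply: typeB_single; have [] := hT' _ _ _ Ej hs.
  + right.
    have -> : preim_mx (subst_mx R sigma) (hyperplane (affine_form (coord_form R i + coord_form R j) s%:~R)) =
      hyperplane (affine_form (coord_form R j') ((2 * s - q)%:~R / 2)).
      apply/vspaceP => w; rewrite [LHS]mem_preim_plus [RHS]mem_single.
      rewrite /subst_val Ei Ej rmorphB rmorphM /=; apply/eqP/eqP => E; lra.
    by apply: typeB_single; have [] := hT' _ _ _ Ei hs.
  + apply: (fi _ (q%:~R / 2 + q'%:~R / 2 - s%:~R)) => w; rewrite [LHS]mem_preim_plus /subst_val Ei Ej.
    by apply/eqP/eqP => E; lra.
- have ne : i != j by rewrite neq_ltn ij.
  case Ei: (sigma i) => [i'|q]; case Ej: (sigma j) => [j'|q'].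
  + right.
    have -> : preim_mx (subst_mx R sigma) (hyperplane (affine_form (coord_form R i - coord_form R j) s%:~R)) =
      hyperplane (affine_form (coord_form R i' - coord_form R j') s%:~R).
      apply/vspaceP => w; rewrite [LHS]mem_preim_minus [RHS]mem_minus.
      by rewrite /subst_val Ei Ej.
    apply: typeB_minus => //; apply: contraNneq ne => E; apply/eqP.
    by apply: (inj _ _ j'); rewrite // Ei E.
  + right.
    have -> : preim_mx (subst_mx R sigma) (hyperplane (affine_form (coord_form R i - coord_form R j) s%:~R)) =
      hyperplane (affine_form (coord_form R i') ((2 * s + q')%:~R / 2)).
      apply/vspaceP => w; rewrite [LHS]mem_preim_minus [RHS]mem_single.
      rewrite /subst_val Ei Ej rmorphD rmorphM /=; apply/eqP/eqP => E; lra.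
    by apply: typeB_single; have [] := hT' _ _ _ Ej hs.
  + right.
    have -> : preim_mx (subst_mx R sigma) (hyperplane (affine_form (coord_form R i - coord_form R j) s%:~R)) =
      hyperplane (affine_form (coord_form R j') ((2 * (- s) + q)%:~R / 2)).
      apply/vspaceP => w; rewrite [LHS]mem_preim_minus [RHS]mem_single.
      rewrite /subst_val Ei Ej rmorphD rmorphM rmorphN /=; apply/eqP/eqP => E; lra.
    have hs' : - s \in int_range a by move: hs; rewrite !mem_int_range; lia.
    by apply: typeB_single; have [] := hT' _ _ _ Ei hs'.
  + apply: (fi _ (q%:~R / 2 - q'%:~R / 2 - s%:~R)) => w; rewrite [LHS]mem_preim_minus /subst_val Ei Ej.
    by apply/eqP/eqP => E; lra.
case Ei: (sigma i) => [i'|q'].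
  right.
  have -> : preim_mx (subst_mx R sigma) (hyperplane (affine_form (coord_form R i) (q%:~R / 2))) =
    hyperplane (affine_form (coord_form R i') (q%:~R / 2)).
    apply/vspaceP => w; rewrite [LHS]mem_preim_single [RHS]mem_single.
    by rewrite /subst_val Ei.
  by apply: typeB_single; apply: TT'.
apply: (fi _ (q'%:~R / 2 - q%:~R / 2)) => w.
rewrite [LHS]mem_preim_single /subst_val Ei.
by apply/eqP/eqP => E; lra.
Qed.

Lemma typeB_restrict_sup (R : realType) (l k a : nat) (T T' : seq int)
    (sigma : 'I_l -> 'I_k + int) K :
  (forall j, exists i, sigma i = inl j) ->
  (forall t, t \in T' -> t \in T \/ exists i q s, [/\ sigma i = inr q, s \in int_range a &
     t = 2 * s - q \/ t = 2 * s + q]) ->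
  K \in cone (typeB R k a T') ->
  exists2 H, H \in cone (typeB R l a T) & K = preim_mx (subst_mx R sigma) H.
Proof.
move=> sur hT'.
case/typeBP => [|i j s ij hs|i j s ij hs|i q qT].
- exists (hyperplane (infinity_form R l)); first by apply/typeBP; apply: TypeBinf.
  by apply/vspaceP => w; rewrite mem_preim_mx !mem_infinity subst_mx_z.
- have [[i' Ei] [j' Ej]] := (sur i, sur j).
  exists (hyperplane (affine_form (coord_form R i' + coord_form R j') s%:~R)).
    apply: typeB_plus => //; apply/eqP => E; move: Ej ij.
    by rewrite -E Ei => -[->]; rewrite ltnn.
  apply/vspaceP => w; rewrite [RHS]mem_preim_plus [LHS]mem_plus.
  by rewrite /subst_val Ei Ej.
- have [[i' Ei] [j' Ej]] := (sur i, sur j).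
  exists (hyperplane (affine_form (coord_form R i' - coord_form R j') s%:~R)).
    apply: typeB_minus => //; apply/eqP => E; move: Ej ij.
    by rewrite -E Ei => -[->]; rewrite ltnn.
  apply/vspaceP => w; rewrite [RHS]mem_preim_minus [LHS]mem_minus.
  by rewrite /subst_val Ei Ej.
have [i' Ei] := sur i.
have [qT0|[j [q' [s [Ej hs tE]]]]] := hT' q qT.
  exists (hyperplane (affine_form (coord_form R i') (q%:~R / 2))).
    exact: typeB_single.
  apply/vspaceP => w; rewrite [RHS]mem_preim_single [LHS]mem_single.
  by rewrite /subst_val Ei.
have ne : i' != j by apply/eqP => E; move: Ej; rewrite -E Ei.
case: tE => ->.
  exists (hyperplane (affine_form (coord_form R i' + coord_form R j) s%:~R)).
    exact: typeB_plus.
  apply/vspaceP => w; rewrite [RHS]mem_preim_plus [LHS]mem_single.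
  rewrite /subst_val Ei Ej rmorphB rmorphM /=; apply/eqP/eqP => E; lra.
exists (hyperplane (affine_form (coord_form R i' - coord_form R j) s%:~R)).
  exact: typeB_minus.
apply/vspaceP => w; rewrite [RHS]mem_preim_minus [LHS]mem_single.
rewrite /subst_val Ei Ej rmorphD rmorphM /=; apply/eqP/eqP => E; lra.
Qed.

Lemma mulmx_row_ext (R : nzRingType) (m n : nat) (A B : 'M[R]_(m, n)) :
  (forall v : 'rV[R]_m, v *m A = v *m B) -> A = B.
Proof. by move=> AB; apply/row_matrixP => i; rewrite !rowE. Qed.

Definition coord_proj (R : realType) (l k : nat) (h : 'I_k -> 'I_l) :
    'M[R]_(l + 1, k + 1) :=
  \matrix_(x, r) (match split r with
    | inl j => x == lshift 1 (h j) | inr _ => x == zcoord l end)%:R.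

Lemma coord_proj_x (R : realType) (l k : nat) (h : 'I_k -> 'I_l) (v : 'rV[R]_(l + 1)) j :
  (v *m coord_proj R h) 0 (lshift 1 j) = v 0 (lshift 1 (h j)).
Proof.
rewrite mxE (bigD1 (lshift 1 (h j))) //= big1 => [|x ne].
  by rewrite mxE (unsplitK (inl j)) eqxx mulr1 addr0.
by rewrite mxE (unsplitK (inl j)) (negPf ne) mulr0.
Qed.

Lemma coord_proj_z (R : realType) (l k : nat) (h : 'I_k -> 'I_l) (v : 'rV[R]_(l + 1)) :
  (v *m coord_proj R h) 0 (zcoord k) = v 0 (zcoord l).
Proof.
rewrite mxE (bigD1 (zcoord l)) //= big1 => [|x ne].
  by rewrite mxE (unsplitK (inr ord0)) eqxx mulr1 addr0.
by rewrite mxE (unsplitK (inr ord0)) (negPf ne) mulr0.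
Qed.

Lemma subst_mxK (R : realType) (l k : nat) (sigma : 'I_l -> 'I_k + int) (h : 'I_k -> 'I_l) :
  (forall j, sigma (h j) = inl j) -> subst_mx R sigma *m coord_proj R h = 1%:M.
Proof.
move=> sh; apply: mulmx_row_ext => w; rewrite mulmxA mulmx1.
apply: rV_coordP => [j|]; last by rewrite coord_proj_z subst_mx_z.
by rewrite coord_proj_x subst_mx_x /subst_val sh.
Qed.

Lemma affine_form_neq0 (R : realType) (l : nat) (i : 'I_l) (s : R) :
  affine_form (coord_form R i) s != 0.
Proof.
apply/eqP => E; have := congr1 (fun M : 'cV_(l + 1) => M (lshift 1 i) 0) E.
rewrite col_mxEu !mxE !eqxx => /eqP; by rewrite oner_eq0.
Qed.

Definition drop_coord (l : nat) (i0 : 'I_l.+1) (q : int) (i : 'I_l.+1) : 'I_l + int :=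
  if unlift i0 i is Some j then inl j else inr q.

Lemma chart_single (R : realType) (l : nat) (i0 : 'I_l.+1) (q : int) :
  chart (affine_form (coord_form R i0) (q%:~R / 2))
    (subst_mx R (drop_coord i0 q)) (coord_proj R (lift i0)).
Proof.
have NL : subst_mx R (drop_coord i0 q) *m coord_proj R (lift i0) = 1%:M.
  by apply: subst_mxK => j; rewrite /drop_coord liftK.
split=> //.
- exact: affine_form_neq0.
- apply: mulmx_row_ext => w; rewrite mulmx0 mulmxA; apply/eqP.
  rewrite -mem_hyperplane mem_single subst_mx_x subst_mx_z /subst_val.
  by rewrite /drop_coord unlift_none.
move=> v vc; have : v \in hyperplane (affine_form (coord_form R i0) (q%:~R / 2)).
  by rewrite mem_hyperplane vc.
rewrite mem_single => /eqP vx.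
apply: rV_coordP => [i|]; last by rewrite subst_mx_z coord_proj_z.
rewrite subst_mx_x /subst_val /drop_coord; case: unliftP => [j ->|->].
  by rewrite coord_proj_x.
by rewrite coord_proj_z vx.
Qed.

Definition normalized (R : realType) (n : nat) (c : 'cV[R]_n) : Prop :=
  exists i : 'I_n, c i 0 = 1 /\ forall j : 'I_n, (j < i)%N -> c j 0 = 0.

Lemma normalized_inj (R : realType) (n : nat) (c c' : 'cV[R]_n) :
  normalized c -> normalized c' -> hyperplane c = hyperplane c' -> c = c'.
Proof.
move=> [i [ci cj]] [i' [ci' cj']] E.
have c0 : c != 0 by apply/eqP => c0; move/eqP: ci; rewrite c0 mxE eq_sym oner_eq0.
have [|a aE] := @hyperplane_sub _ _ c c' c0; first by move=> v; rewrite E.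
have a0 : a != 0.
  by apply/eqP => a0; move/eqP: ci'; rewrite aE a0 scale0r mxE eq_sym oner_eq0.
have [lt|gt|/val_inj ii] := ltngtP i i'.
- by have /eqP := cj' i lt; rewrite aE mxE ci mulr1 (negPf a0).
- by move/eqP: ci'; rewrite aE mxE cj // mulr0 eq_sym oner_eq0.
by move: ci'; rewrite -ii aE mxE ci mulr1 => ->; rewrite scale1r.
Qed.

Lemma coord_formE (R : realType) (l : nat) (i k : 'I_l) :
  coord_form R i k 0 = (k == i)%:R.
Proof. by rewrite mxE andbT. Qed.

Lemma coord_plusE (R : realType) (l : nat) (i j k : 'I_l) :
  (coord_form R i + coord_form R j) k 0 = (k == i)%:R + (k == j)%:R.
Proof. by rewrite -!coord_formE mxE. Qed.

Lemma coord_minusE (R : realType) (l : nat) (i j k : 'I_l) :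
  (coord_form R i - coord_form R j) k 0 = (k == i)%:R - (k == j)%:R.
Proof. by rewrite -!coord_formE !mxE. Qed.

Lemma normalized_plus (R : realType) (l : nat) (i j : 'I_l) (s : R) : (i < j)%N ->
  normalized (affine_form (coord_form R i + coord_form R j) s).
Proof.
move=> ij; exists (lshift 1 i); rewrite col_mxEu coord_plusE eqxx.
split; first by rewrite -val_eqE (ltn_eqF ij) addr0.
move=> k; case: (split_ordP k) => k' -> /= lt; last by move: (ltn_ord i); lia.
by rewrite col_mxEu coord_plusE -!val_eqE (ltn_eqF lt) (ltn_eqF (ltn_trans lt ij)) addr0.
Qed.

Lemma normalized_minus (R : realType) (l : nat) (i j : 'I_l) (s : R) : (i < j)%N ->
  normalized (affine_form (coord_form R i - coord_form R j) s).
Proof.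
move=> ij; exists (lshift 1 i); rewrite col_mxEu coord_minusE eqxx.
split; first by rewrite -val_eqE (ltn_eqF ij) subr0.
move=> k; case: (split_ordP k) => k' -> /= lt; last by move: (ltn_ord i); lia.
by rewrite col_mxEu coord_minusE -!val_eqE (ltn_eqF lt) (ltn_eqF (ltn_trans lt ij)) subr0.
Qed.

Lemma normalized_single (R : realType) (l : nat) (i : 'I_l) (s : R) :
  normalized (affine_form (coord_form R i) s).
Proof.
exists (lshift 1 i); rewrite col_mxEu !coord_formE eqxx; split=> // k.
case: (split_ordP k) => k' -> /= lt; last by move: (ltn_ord i); lia.
by rewrite col_mxEu coord_formE -val_eqE (ltn_eqF lt).
Qed.

Lemma normalized_infinity (R : realType) (l : nat) : normalized (infinity_form R l).
Proof.
exists (zcoord l); rewrite col_mxEd mxE eqxx; split=> // k.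
case: (split_ordP k) => k' -> /= lt; last by move: lt; rewrite [k']ord1 ltnn.
by rewrite col_mxEu mxE.
Qed.

Lemma affine_form_inj (R : realType) (l : nat) (c c' : 'cV[R]_l) (s s' : R) :
  affine_form c s = affine_form c' s' -> c = c' /\ s = s'.
Proof.
move=> /eq_col_mx[-> /matrixP/(_ 0 0)]; rewrite !mxE !mulr1n => /oppr_inj ->.
by [].
Qed.

Lemma uniq_int_range a : uniq (int_range a).
Proof. by rewrite map_inj_uniq ?iota_uniq // => i j; lia. Qed.

Lemma pair_plus (x y x' y' : nat) : (x < y)%N -> (x' < y')%N ->
  (1 + (x == y) = (x == x') + (x == y'))%N -> ((y == x) + 1 = (y == x') + (y == y'))%N ->
  x = x' /\ y = y'.
Proof. do !case: eqP; lia. Qed.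

Lemma pair_minus (x y x' y' : nat) : (x < y)%N -> (x' < y')%N ->
  (1 + (x == y') = (x == x') + (x == y))%N -> ((y' == x) + 1 = (y' == x') + (y' == y))%N ->
  x = x' /\ y = y'.
Proof. do !case: eqP; lia. Qed.

Lemma uniq_typeB (R : realType) (l a : nat) (T : seq int) :
  uniq T -> uniq (typeB R l a T).
Proof.
move=> uT; have up : uniq [seq p : 'I_l * 'I_l <- enum {: 'I_l * 'I_l} | (p.1 < p.2)%N].
  by rewrite filter_uniq // enum_uniq.
have intr (s s' : int) : s%:~R = s'%:~R :> R -> s = s' by move/intr_inj.
have nat_eq (x y : nat) : x%:R = y%:R :> R -> x = y by move/eqP; rewrite eqr_nat => /eqP.
have plus_inj (i j i' j' : 'I_l) : (i < j)%N -> (i' < j')%N ->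
    coord_form R i + coord_form R j = coord_form R i' + coord_form R j' -> (i, j) = (i', j').
  move=> ij ij' E; have F (k : 'I_l) : ((k == i) + (k == j) = (k == i') + (k == j'))%N.
    apply: nat_eq; have := congr1 (fun M : 'cV_l => M k 0) E.
    by rewrite /= !coord_plusE !natrD.
  have := F i; have := F j; rewrite !eqxx => E2 E1.
  by have [/val_inj -> /val_inj ->] := pair_plus ij ij' E1 E2.
have minus_inj (i j i' j' : 'I_l) : (i < j)%N -> (i' < j')%N ->
    coord_form R i - coord_form R j = coord_form R i' - coord_form R j' -> (i, j) = (i', j').
  move=> ij ij' E; have F (k : 'I_l) : ((k == i) + (k == j') = (k == i') + (k == j))%N.
    apply: nat_eq; have := congr1 (fun M : 'cV_l => M k 0) E.
    rewrite /= !coord_minusE !natrD => E'.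
    lra.
  have := F i; have := F j'; rewrite !eqxx => E2 E1.
  by have [/val_inj -> /val_inj ->] := pair_minus ij ij' E1 E2.
pose S (c : 'cV[R]_l) := \sum_k c k 0.
have S1 (i : 'I_l) : S (coord_form R i) = 1.
  by rewrite /S (bigD1 i) //= big1 => [|k ne]; rewrite coord_formE ?eqxx ?addr0 ?(negPf ne).
have SD (c c' : 'cV[R]_l) : S (c + c') = S c + S c'.
  by rewrite /S -big_split /=; apply: eq_bigr => k _; rewrite mxE.
have SN (c : 'cV[R]_l) : S (- c) = - S c.
  by rewrite /S -sumrN; apply: eq_bigr => k _; rewrite mxE.
rewrite /typeB; set P := [seq p <- _ | _] in up *.
have Splus h : h \in [seq (coord_form R p.1 + coord_form R p.2, s%:~R : R)
    | p <- P, s <- int_range a] -> S h.1 = 2.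
  by case/allpairsP=> -[p t] [_ _ ->] /=; rewrite SD !S1.
have Sminus h : h \in [seq (coord_form R p.1 - coord_form R p.2, s%:~R : R)
    | p <- P, s <- int_range a] -> S h.1 = 0.
  by case/allpairsP=> -[p t] [_ _ ->] /=; rewrite SD SN !S1 subrr.
have Ssingle h : h \in [seq (coord_form R i, q%:~R / 2 : R)
    | i <- enum 'I_l, q <- T] -> S h.1 = 1.
  by case/allpairsP=> -[p t] [_ _ ->] /=; rewrite S1.
rewrite !cat_uniq; apply/and5P; split.
- apply: allpairs_uniq; rewrite ?uniq_int_range // => z z'.
  case/allpairsP=> -[p t] [hp _ ->]; case/allpairsP=> -[p' t'] [hp' _ ->] /= [E /intr ->].
  move: hp hp'; rewrite /= !mem_filter => /andP[lt _] /andP[lt' _].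
  by have := plus_inj _ _ _ _ lt lt' E; rewrite -!surjective_pairing => ->.
- apply/hasPn => h; rewrite mem_cat => /orP[/Sminus|/Ssingle] E;
    by apply/negP => /Splus; rewrite E => /eqP; lra.
- apply: allpairs_uniq; rewrite ?uniq_int_range // => z z'.
  case/allpairsP=> -[p t] [hp _ ->]; case/allpairsP=> -[p' t'] [hp' _ ->] /= [E /intr ->].
  move: hp hp'; rewrite /= !mem_filter => /andP[lt _] /andP[lt' _].
  by have := minus_inj _ _ _ _ lt lt' E; rewrite -!surjective_pairing => ->.
- by apply/hasPn => h /Ssingle E; apply/negP => /Sminus; rewrite E => /eqP; lra.
apply: allpairs_uniq; rewrite ?enum_uniq // => -[i s] [i' s'] _ _ /= [E E'].
congr (_, _); last by apply: intr; lra.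
have := congr1 (fun M : 'cV_l => M i 0) E; rewrite /= !coord_formE eqxx.
by case: eqP => // _ /eqP; rewrite oner_eq0.
Qed.

Lemma typeB_normalized (R : realType) (l a : nat) (T : seq int) h :
  h \in typeB R l a T -> normalized (affine_form h.1 h.2).
Proof.
rewrite !mem_cat => /or3P[] /allpairsP[[p s] /= [hp _ ->]] /=.
- by apply: normalized_plus; move: hp; rewrite mem_filter => /andP[].
- by apply: normalized_minus; move: hp; rewrite mem_filter => /andP[].
exact: normalized_single.
Qed.

Lemma uniq_cone_typeB (R : realType) (l a : nat) (T : seq int) :
  uniq T -> uniq (cone (typeB R l a T)).
Proof.
move=> /(uniq_typeB R l a) uB; rewrite /= map_inj_in_uniq ?uB ?andbT.
  apply/mapP => -[h hB] /(normalized_inj (normalized_infinity R l) (typeB_normalized hB)).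
  move=> /(congr1 usubmx); rewrite !col_mxKu => E.
  have [i [hi _]] := typeB_normalized hB; move: hB.
  rewrite !mem_cat => /or3P[] /allpairsP[[p s] /= [hp _ hE]];
    move: E; rewrite hE /= => /matrixP E.
  - have := E p.1 0; rewrite coord_plusE eqxx mxE.
    by move/eqP; rewrite eq_sym paddr_eq0 // oner_eq0.
  - have := E p.1 0; rewrite coord_minusE eqxx mxE.
    move: hp; rewrite mem_filter -val_eqE => /andP[lt _].
    by rewrite (ltn_eqF lt) subr0 => /eqP; rewrite eq_sym oner_eq0.
  by have := E p 0; rewrite coord_formE eqxx mxE => /eqP; rewrite eq_sym oner_eq0.
move=> h h' hB h'B /(normalized_inj (typeB_normalized hB) (typeB_normalized h'B)).
by move=> /affine_form_inj[]; case: h h' {hB h'B} => [? ?] [? ?] /= -> ->.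
Qed.

Lemma size_typeB (R : realType) (l a : nat) (T : seq int) :
  size (typeB R l a T) = (l * l.-1 * (2 * a).+1 + l * size T)%N.
Proof.
have sp : (size [seq p : 'I_l * 'I_l <- enum {: 'I_l * 'I_l} | (p.1 < p.2)%N] * 2 = l * l.-1)%N.
  rewrite size_filter -sum1_count big_enum_cond /=.
  rewrite -(pair_big_dep xpredT (fun i j : 'I_l => (i < j)%N) (fun _ _ => 1%N)) /=.
  rewrite (exchange_big_dep xpredT) //=.
  have E (j : 'I_l) : (\sum_(i < l | (i < j)%N) 1 = j)%N.
    rewrite -(big_ord_widen_cond l xpredT (fun=> 1%N)) 1?ltnW //.
    by rewrite sum1_card card_ord.
  rewrite (eq_bigr (fun j : 'I_l => j : nat)) => [|j _]; last exact: E.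
  rewrite -(big_mkord xpredT (fun i => i)) bin2_sum bin2 muln2 halfK.
  by rewrite oddM; case: (l) => //= n; rewrite andNb subn0.
rewrite !size_cat !size_allpairs size_map size_iota size_enum_ord.
by rewrite -sp; ring.
Qed.

Lemma single_mem_typeB (R : realType) (l a : nat) (T : seq int) (i : 'I_l) (t : int) :
  hyperplane (affine_form (coord_form R i) (t%:~R / 2)) \in cone (typeB R l a T) -> t \in T.
Proof.
have ns := @normalized_single R l i (t%:~R / 2).
move E : (hyperplane _) => H /typeBP HT; case: H / HT E.
- move/(normalized_inj ns (normalized_infinity R l)).
  move/(congr1 (fun M : 'cV_(l + 1) => M (lshift 1 i) 0)).
  by rewrite !col_mxEu coord_formE eqxx mxE => /eqP; rewrite oner_eq0.
- move=> i' j' s lt _ /(normalized_inj ns (normalized_plus _ lt)) /affine_form_inj[E _].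
  have := congr1 (fun M : 'cV_l => M i' 0) E; have := congr1 (fun M : 'cV_l => M j' 0) E.
  rewrite !coord_plusE !coord_formE !eqxx -[j' == i']val_eqE (gtn_eqF lt) -[i' == j']val_eqE (ltn_eqF lt).
  rewrite addr0 add0r => /eqP E1 /eqP; move: E1; rewrite !pnatr_eq1 !eqb1.
  by move=> /eqP ej /eqP ei; move: lt; rewrite ej ei ltnn.
- move=> i' j' s lt _ /(normalized_inj ns (normalized_minus _ lt)) /affine_form_inj[E _].
  have := congr1 (fun M : 'cV_l => M j' 0) E.
  rewrite coord_minusE coord_formE eqxx -[j' == i']val_eqE (gtn_eqF lt) sub0r => E'.
  by have := ler0n R (j' == i); rewrite E' oppr_ge0 lern0.
move=> i' q qT /(normalized_inj ns (normalized_single _ _)) /affine_form_inj[_ E].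
have /intr_inj -> // : t%:~R = q%:~R :> R by lra.
Qed.

Lemma typeB_subset (R : realType) (l a : nat) (T T' : seq int) :
  {subset T <= T'} -> {subset cone (typeB R l a T) <= cone (typeB R l a T')}.
Proof.
move=> TT' H /typeBP[|i j s ij hs|i j s ij hs|i q qT]; apply/typeBP.
- exact: TypeBinf.
- exact: TypeBplus.
- exact: TypeBminus.
by apply: TypeBsingle; apply: TT'.
Qed.

Lemma typeB_eq_mem (R : realType) (l a : nat) (T T' : seq int) :
  T =i T' -> cone (typeB R l a T) =i cone (typeB R l a T').
Proof.
by move=> TT' H; apply/idP/idP; apply: typeB_subset => q; rewrite TT'.
Qed.

(* All the hyperplanes [x_i = +- q / 2] have the same restriction. *)
Lemma typeB_deletion (R : realType) (l a : nat) (T0 T' : seq int) (q : int) (d : nat)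
    (e : seq nat) :
  0 < q -> q \notin T0 -> - q \notin T0 -> {subset T0 <= T'} ->
  (forall s, s \in int_range a -> 2 * s - q \in T' /\ 2 * s + q \in T') ->
  (forall t, t \in T' -> t \in T0 \/
     exists2 s, s \in int_range a & t = 2 * s - q \/ t = 2 * s + q) ->
  saito (cone (typeB R l a T')) e ->
  saito (cone (typeB R l.+1 a (q :: - q :: T0))) (d :: e) ->
  (l.+1 * 2 <= d)%N /\ saito (cone (typeB R l.+1 a T0)) ((d - l.+1 * 2)%N :: e).
Proof.
move=> q0 qT qNT T0T' hs hT' sT' sT.
pose L3 := [seq (coord_form R i, t%:~R / 2 : R) | i <- enum 'I_l.+1, t <- [:: q; - q]].
pose X := [seq affine_form h.1 h.2 | h <- L3].
have szX : size X = (l.+1 * 2)%N by rewrite size_map size_allpairs size_enum_ord.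
have XP c : c \in X -> exists (i : 'I_l.+1) t, (t = q \/ t = - q) /\
    c = affine_form (coord_form R i) (t%:~R / 2).
  move/mapP=> [h hL ->]; case/allpairsP: hL => -[i t] [_ /= tq ->]; exists i, t; split=> //.
  by move: tq; rewrite !inE => /orP[/eqP|/eqP]; [left|right].
have qq : uniq [:: q; - q] by rewrite /= inE andbT; apply/eqP; lia.
have uX : uniq [seq hyperplane c | c <- X].
  have := uniq_cone_typeB R l.+1 a qq; rewrite cons_uniq => /andP[_].
  rewrite /typeB !map_cat !cat_uniq => /and3P[_ _ /and3P[_ _ uL]].
  by rewrite /X -map_comp.
have notT0 i t : t = q \/ t = - q ->
    hyperplane (affine_form (coord_form R i) (t%:~R / 2)) \notin cone (typeB R l.+1 a T0).
  by move=> tq; apply/negP => /single_mem_typeB; case: tq => ->; apply/negP.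
have XA H : (H \in [seq hyperplane c | c <- X] ++ cone (typeB R l.+1 a T0)) =
            (H \in cone (typeB R l.+1 a (q :: - q :: T0))).
  rewrite mem_cat; apply/orP/idP => [[/mapP[c /XP[i [t [tq ->]] ->]]|]|].
  - by apply: typeB_single; rewrite !inE; case: tq => ->; rewrite eqxx ?orbT.
  - by apply: typeB_subset => t tT; rewrite !inE tT !orbT.
  case/typeBP => [|i j s ij hs'|i j s ij hs'|i t].
  - by right; apply/typeBP; apply: TypeBinf.
  - by right; apply/typeBP; apply: TypeBplus.
  - by right; apply/typeBP; apply: TypeBminus.
  rewrite !inE => tq; have [tT|tT] := boolP (t \in T0).
    by right; apply/typeBP; apply: TypeBsingle.
  left; apply/mapP; exists (affine_form (coord_form R i) (t%:~R / 2)) => //.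
  apply/mapP; exists (coord_form R i, t%:~R / 2) => //; apply/allpairsP.
  exists (i, t); split; rewrite ?mem_enum //= !inE.
  by move: tq; rewrite (negPf tT) orbF.
have sX := saito_eq_mem (fun H => esym (XA H)) sT.
rewrite -szX; apply: (@deletion_iter R (l + 1) X (cone (typeB R l.+1 a T0)) d e uX _ _ sX).
  by move=> c /XP[i [t [tq ->]]]; apply: notT0.
move=> c Y sub cY.
have [i [t [tq cE]]] := XP c (sub c (mem_head _ _)).
exists (subst_mx R (drop_coord i t)), (coord_proj R (lift i)).
have ch := chart_single R i t; rewrite -cE in ch; split; first exact: ch.
apply: saito_eq_mem sT' => K; apply/idP/mapP => [KT'|[H HA ->]].
  have [||H HA ->] := @typeB_restrict_sup R l.+1 l a T0 T' (drop_coord i t) K _ _ KT'.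
  - by move=> j; exists (lift i j); rewrite /drop_coord liftK.
  - move=> x /hT'[?|[s sa xE]]; [by left|right]; exists i, t, s; split=> //.
      by rewrite /drop_coord unlift_none.
    by case: tq => ->; rewrite ?opprK; tauto.
  by exists H; rewrite // mem_cat HA orbT.
have inj x x' j : drop_coord i t x = inl j -> drop_coord i t x' = inl j -> x = x'.
  rewrite /drop_coord; case: unliftP => // y -> [->].
  by case: unliftP => // y' -> [->].
have a0 : 0 \in int_range a by rewrite mem_int_range; lia.
have TT' : {subset q :: - q :: T0 <= T'}.
  move=> x; rewrite !inE => /or3P[/eqP ->|/eqP ->|]; last exact: T0T'.
    by have [_] := hs 0 a0; rewrite mulr0 add0r.
  by have [] := hs 0 a0; rewrite mulr0 add0r.
have hs'' (x : 'I_l.+1) (q' s : int) : drop_coord i t x = inr q' -> s \in int_range a ->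
    2 * s - q' \in T' /\ 2 * s + q' \in T'.
  rewrite /drop_coord; case: unliftP => // _ [<-] /hs[h1 h2].
  by case: tq => ->; rewrite ?opprK.
have HX : H \in cone (typeB R l.+1 a (q :: - q :: T0)).
  rewrite -XA mem_cat; move: HA; rewrite mem_cat => /orP[/mapP[c' c'Y ->]|->]; rewrite ?orbT //.
  by rewrite map_f // sub // inE c'Y orbT.
have [full|//] := typeB_restrict_sub inj TT' hs'' HX.
exfalso; have [c0 Nc NL LN] := ch.
have hT : of_hyperplanes (cone (typeB R l.+1 a (q :: - q :: T0))).
  by case: sT => _ [T [? _ _ _ _]].
have [c' c'0 HE] := hT H HX.
have EH : hyperplane c = H.
  rewrite HE; apply: hyperplane_eq => // v; rewrite mem_hyperplane => /eqP vc.
  rewrite -HE -(LN v vc) -mem_preim_mx full; exact: memvf.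
move: HA; rewrite -EH mem_cat (negPf cY) /= cE; apply/negP; exact: notT0.
Qed.

Definition half_range (M N : nat) : seq int :=
  [seq 2 * k | k <- int_range M] ++
  [seq 2 * (i%:Z - N%:Z) + 1 | i <- iota 0 (2 * N)].

Lemma half_rangeP (M N : nat) (q : int) :
  reflect ((exists2 k : int, q = 2 * k & - M%:Z <= k <= M%:Z) \/
           (exists2 k : int, q = 2 * k + 1 & - N%:Z <= k < N%:Z))
    (q \in half_range M N).
Proof.
rewrite mem_cat; apply: (iffP orP) => -[].
- by move/mapP=> [k kM ->]; left; exists k; rewrite -?mem_int_range.
- move/mapP=> [i]; rewrite mem_iota => /andP[_ iN] ->; right.
  by exists (i%:Z - N%:Z) => //; lia.
- by move=> [k -> kM]; left; apply: map_f; rewrite mem_int_range.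
move=> [k -> kN]; right; apply/mapP; exists (absz (k + N%:Z)); last by lia.
by rewrite mem_iota; lia.
Qed.

Lemma uniq_half_range (M N : nat) : uniq (half_range M N).
Proof.
rewrite cat_uniq; apply/and3P; split.
- by rewrite map_inj_uniq ?uniq_int_range // => i j; lia.
- by apply/hasPn => q /mapP[i _ ->]; apply/negP => /mapP[k _]; lia.
by rewrite map_inj_uniq ?iota_uniq // => i j; lia.
Qed.

Lemma size_half_range (M N : nat) : size (half_range M N) = (2 * (M + N)).+1.
Proof. by rewrite size_cat !size_map !size_iota; lia. Qed.

Definition typeB_exponents (l a K : nat) : seq nat :=
  1%N :: [seq (2 * K + 1 + 2 * a * l.-1 + 2 * k)%N | k <- iota 0 l].

Lemma typeB_exponents_rcons (l a K : nat) :
  typeB_exponents l.+1 a K = rcons (typeB_exponents l a (K + a)) (2 * K + 1 + 2 * a * l + 2 * l)%N.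
Proof.
rewrite /typeB_exponents rcons_cons; congr (_ :: _).
have -> : iota 0 l.+1 = rcons (iota 0 l) l by rewrite -addn1 iotaD cats1.
rewrite map_rcons; congr rcons.
by apply/eq_in_map => k; rewrite mem_iota; case: l => [|l] //= _; lia.
Qed.

Lemma typeB_exponents_cons (l a K : nat) :
  perm_eq ((2 * K + 1 + 2 * a * l)%N :: typeB_exponents l a (K.+1 + a))
    (typeB_exponents l.+1 a K).
Proof.
rewrite /typeB_exponents [iota 0 l.+1]/= [map _ (_ :: _)]/=.
have -> : [seq (2 * (K.+1 + a) + 1 + 2 * a * l.-1 + 2 * k)%N | k <- iota 0 l] =
  [seq (2 * K + 1 + 2 * a * l + 2 * k)%N | k <- iota 1 l].
  rewrite (iotaDl 1 0) -map_comp; apply/eq_in_map => k; rewrite mem_iota.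
  by case: l => [|l] //= _; lia.
rewrite muln0 addn0; exact/permEl/(perm_catCA [:: _] [:: _]).
Qed.

Lemma typeB_step (R : realType) (l a K : nat) (T0 T T' : seq int) (q : int) :
  T =i q :: - q :: T0 ->
  0 < q -> q \notin T0 -> - q \notin T0 -> {subset T0 <= T'} ->
  (forall s, s \in int_range a -> 2 * s - q \in T' /\ 2 * s + q \in T') ->
  (forall t, t \in T' -> t \in T0 \/
     exists2 s, s \in int_range a & t = 2 * s - q \/ t = 2 * s + q) ->
  saito (cone (typeB R l a T')) (typeB_exponents l a (K.+1 + a)) ->
  saito (cone (typeB R l.+1 a T)) (typeB_exponents l.+1 a K.+1) ->
  saito (cone (typeB R l.+1 a T0)) (typeB_exponents l.+1 a K).
Proof.
move=> TE q0 qT qNT T0T' hs hT' sT' sT.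
have {}sT := saito_eq_mem (@typeB_eq_mem R l.+1 a _ _ TE) sT.
rewrite typeB_exponents_rcons in sT.
have {}sT := saito_perm (permEl (perm_rcons _ _)) sT.
have [_] := typeB_deletion q0 qT qNT T0T' hs hT' sT' sT.
apply: saito_perm; have -> : (2 * K.+1 + 1 + 2 * a * l + 2 * l - l.+1 * 2 = 2 * K + 1 + 2 * a * l)%N by lia.
exact: typeB_exponents_cons.
Qed.

Lemma typeB_step_odd (R : realType) (l a M N : nat) :
  saito (cone (typeB R l a (half_range M (N.+1 + a)))) (typeB_exponents l a (M + (N.+1 + a))) ->
  saito (cone (typeB R l.+1 a (half_range M N.+1))) (typeB_exponents l.+1 a (M + N.+1)) ->
  saito (cone (typeB R l.+1 a (half_range M N))) (typeB_exponents l.+1 a (M + N)).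
Proof.
have -> : (M + (N.+1 + a) = (M + N).+1 + a)%N by lia.
rewrite (addnS M N) => s1 s2.
apply: (typeB_step (q := 2 * N%:Z + 1) _ _ _ _ _ _ _ s1 s2).
- move=> q; rewrite !inE; apply/half_rangeP/or3P => [[[k -> kM]|[k -> kN]]|[/eqP ->|/eqP ->|/half_rangeP h]].
  + by apply: Or33; apply/half_rangeP; left; exists k.
  + have [->|?] := eqVneq k N%:Z; first by apply: Or31.
    have [->|?] := eqVneq k (- N.+1%:Z); first by apply: Or32; lia.
    by apply: Or33; apply/half_rangeP; right; exists k => //; lia.
  + by right; exists N%:Z => //; lia.
  + by right; exists (- N.+1%:Z); lia.
  by case: h => -[k -> kM]; [left|right]; exists k => //; lia.
- lia.
- by apply/half_rangeP => -[] [k]; lia.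
- by apply/half_rangeP => -[] [k]; lia.
- by move=> t /half_rangeP[[k -> ?]|[k -> ?]]; apply/half_rangeP; [left|right]; exists k => //; lia.
- move=> s; rewrite mem_int_range => sa; split; apply/half_rangeP; right.
    by exists (s - N.+1%:Z); lia.
  by exists (s + N%:Z); lia.
move=> t /half_rangeP[[k -> ?]|[k -> ?]]; first by left; apply/half_rangeP; left; exists k.
have [h|h] := boolP (- N%:Z <= k < N%:Z).
  by left; apply/half_rangeP; right; exists k.
right; have [k0|k0] := lerP 0 k.
  by exists (k - N%:Z); rewrite ?mem_int_range; [lia|right; lia].
by exists (k + N.+1%:Z); rewrite ?mem_int_range; [lia|left; lia].
Qed.

Lemma typeB_step_even (R : realType) (l a M N : nat) :
  saito (cone (typeB R l a (half_range (M.+1 + a) N))) (typeB_exponents l a (M.+1 + a + N)) ->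
  saito (cone (typeB R l.+1 a (half_range M.+1 N))) (typeB_exponents l.+1 a (M.+1 + N)) ->
  saito (cone (typeB R l.+1 a (half_range M N))) (typeB_exponents l.+1 a (M + N)).
Proof.
have -> : (M.+1 + a + N = (M + N).+1 + a)%N by lia.
rewrite (addSn M N) => s1 s2.
apply: (typeB_step (q := 2 * M.+1%:Z) _ _ _ _ _ _ _ s1 s2).
- move=> q; rewrite !inE; apply/half_rangeP/or3P => [[[k -> kM]|[k -> kN]]|[/eqP ->|/eqP ->|/half_rangeP h]].
  + have [->|?] := eqVneq k M.+1%:Z; first by apply: Or31.
    have [->|?] := eqVneq k (- M.+1%:Z); first by apply: Or32; lia.
    by apply: Or33; apply/half_rangeP; left; exists k => //; lia.
  + by apply: Or33; apply/half_rangeP; right; exists k.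
  + by left; exists M.+1%:Z => //; lia.
  + by left; exists (- M.+1%:Z); lia.
  by case: h => -[k -> kM]; [left|right]; exists k => //; lia.
- lia.
- by apply/half_rangeP => -[] [k]; lia.
- by apply/half_rangeP => -[] [k]; lia.
- by move=> t /half_rangeP[[k -> ?]|[k -> ?]]; apply/half_rangeP; [left|right]; exists k => //; lia.
- move=> s; rewrite mem_int_range => sa; split; apply/half_rangeP; left.
    by exists (s - M.+1%:Z); lia.
  by exists (s + M.+1%:Z); lia.
move=> t /half_rangeP[[k -> ?]|[k -> ?]]; last by left; apply/half_rangeP; right; exists k.
have [h|h] := boolP (- M%:Z <= k <= M%:Z).
  by left; apply/half_rangeP; left; exists k.
right; have [k0|k0] := lerP 0 k.
  by exists (k - M.+1%:Z); rewrite ?mem_int_range; [lia|right; lia].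
by exists (k + M.+1%:Z); rewrite ?mem_int_range; [lia|left; lia].
Qed.

(** * An explicit basis *)

(* Central factorials: [cfac h m] is, up to the factor [(2m+1) 2h], an
   antidifference with step [2h] of [t => efac h m (t ^+ 2)]. *)
Definition efac (S : comNzRingType) (h : S) (m : nat) (u : S) : S :=
  \prod_(i < m) (u - ((2 * i + 1)%:R * h) ^+ 2).

Definition cfac (S : comNzRingType) (h : S) (m : nat) (t : S) : S :=
  t * \prod_(i < m) (t ^+ 2 - ((2 * i + 2)%:R * h) ^+ 2).

Lemma cfac_shift (S : comNzRingType) (h : S) (m : nat) (t : S) :
  cfac h m (t + h) = (t + (2 * m + 1)%:R * h) * efac h m (t ^+ 2) /\
  cfac h m (t - h) = (t - (2 * m + 1)%:R * h) * efac h m (t ^+ 2).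
Proof.
rewrite /cfac /efac; elim: m => [|m [IH1 IH2]].
  by rewrite !big_ord0 !mulr1 mul1r.
rewrite !big_ord_recr /= !mulrA IH1 IH2.
have -> : (2 * m.+1 + 1 = 2 * m + 1 + 2)%N by lia.
have -> : (2 * m + 2 = 2 * m + 1 + 1)%N by lia.
rewrite !(natrD _ (2 * m + 1)).
move: (2 * m + 1)%:R (\prod_(i < m) (t ^+ 2 - ((2 * i + 1)%:R * h) ^+ 2)) => x y.
by split; ring.
Qed.

Lemma cfac_odd (S : comNzRingType) (h : S) (m : nat) (t : S) : cfac h m (- t) = - cfac h m t.
Proof. by rewrite /cfac sqrrN mulNr. Qed.

Fixpoint newton (S : comNzRingType) (h : S) (cs : seq S) (m : nat) : S :=
  if cs is c :: cs' then
    (if m is m'.+1 then newton h cs' m' else 0) +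
    (((2 * m + 1)%:R * h) ^+ 2 - c) * newton h cs' m
  else (m == 0%N)%:R.

Lemma newton_gt (S : comNzRingType) (h : S) (cs : seq S) (m : nat) :
  (size cs < m)%N -> newton h cs m = 0.
Proof.
elim: cs m => [|c cs IH] [|m] //= lt.
by rewrite !IH ?mulr0 ?addr0 // ltnW.
Qed.

Lemma newtonE (S : comNzRingType) (h : S) (cs : seq S) (u : S) :
  \prod_(c <- cs) (u - c) = \sum_(m < (size cs).+1) newton h cs m * efac h m u.
Proof.
elim: cs => [|c cs IH].
  by rewrite big_nil big_ord1 /= /efac big_ord0 mulr1.
rewrite big_cons IH mulr_sumr /=.
under [RHS]eq_bigr => m _ do rewrite mulrDl.
rewrite big_split /= [X in _ = X + _]big_ord_recl mul0r add0r.
rewrite [X in _ = _ + X]big_ord_recr /= newton_gt // mulr0 mul0r addr0 -big_split /=.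
apply: eq_bigr => m _ /=; rewrite /efac big_ord_recr /=.
move: (\prod_(_ < m) _) (newton _ _ _) => x y; ring.
Qed.

Definition antidiff (S : comNzRingType) (h : S) (iota : nat -> S) (cs : seq S) (t : S) : S :=
  \sum_(m < (size cs).+1) newton h cs m * iota m * cfac h m t.

Lemma antidiffE (S : comNzRingType) (h : S) (iota : nat -> S) (cs : seq S) (t : S) :
  (forall m, (2 * m + 1)%:R * iota m = 1) ->
  antidiff h iota cs (t + h) - antidiff h iota cs (t - h) =
  2%:R * h * \prod_(c <- cs) (t ^+ 2 - c).
Proof.
move=> iotaE; rewrite (newtonE h) mulr_sumr -sumrB; apply: eq_bigr => m _.
have [-> ->] := cfac_shift h m t; rewrite -[2%:R * h]mulr1 -(iotaE m).
ring.
Qed.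

Lemma antidiff_odd (S : comNzRingType) (h : S) (iota : nat -> S) (cs : seq S) (t : S) :
  antidiff h iota cs (- t) = - antidiff h iota cs t.
Proof.
by rewrite /antidiff -sumrN; apply: eq_bigr => m _; rewrite cfac_odd mulrN.
Qed.

Lemma rmorph_cfac (S S' : comNzRingType) (phi : {rmorphism S -> S'}) (h : S) m t :
  phi (cfac h m t) = cfac (phi h) m (phi t).
Proof.
rewrite /cfac rmorphM rmorph_prod; congr (_ * _); apply: eq_bigr => i _.
by rewrite rmorphB !rmorphXn rmorphM rmorph_nat.
Qed.

Lemma rmorph_newton (S S' : comNzRingType) (phi : {rmorphism S -> S'}) (h : S) cs m :
  phi (newton h cs m) = newton (phi h) [seq phi c | c <- cs] m.
Proof.
elim: cs m => [|c cs IH] m /=; first by rewrite rmorph_nat.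
rewrite rmorphD rmorphM rmorphB rmorphXn rmorphM rmorph_nat IH; congr (_ + _).
by case: m => [|m]; rewrite ?rmorph0 ?IH.
Qed.

Lemma rmorph_antidiff (S S' : comNzRingType) (phi : {rmorphism S -> S'}) (h : S) iota cs t :
  phi (antidiff h iota cs t) =
  antidiff (phi h) (fun m => phi (iota m)) [seq phi c | c <- cs] (phi t).
Proof.
rewrite /antidiff rmorph_sum size_map; apply: eq_bigr => m _.
by rewrite [LHS]rmorphM [X in X * _]rmorphM rmorph_newton rmorph_cfac.
Qed.

Lemma homdeg_newton (R : realType) (n : nat) (h : {mpoly R[n]}) (cs : seq {mpoly R[n]})
    (m d : nat) :
  homdeg 1 h -> (forall c, c \in cs -> homdeg 2 c) -> (m + d = size cs)%N ->
  homdeg (2 * d) (newton h cs m).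
Proof.
move=> hh; elim: cs m d => [|c cs IH] m d hcs /= md.
  have [-> ->] : m = 0%N /\ d = 0%N by lia.
  by rewrite -mpolyC1; apply: homdegC.
have hcs' c' : c' \in cs -> homdeg 2 c' by move=> c'cs; apply: hcs; rewrite inE c'cs orbT.
apply: homdegD.
  by case: m md => [|m] md; [apply: homdeg0|apply: IH => //; lia].
have [lt|ge] := ltnP (size cs) m; first by rewrite newton_gt // mulr0; apply: homdeg0.
have -> : (2 * d = 2 + 2 * d.-1)%N by lia.
apply: homdegM; last by apply: IH => //; lia.
apply: homdegD; last by apply/homdegN/hcs; rewrite mem_head.
rewrite exprMn -natrX -mpolyC_nat -[2%N]add0n; apply: homdegM; first exact: homdegC.
by rewrite expr2 -[2%N]/(1 + 1)%N; apply: homdegM.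
Qed.

Lemma homdeg_cfac (R : realType) (n : nat) (h t : {mpoly R[n]}) (m : nat) :
  homdeg 1 h -> homdeg 1 t -> homdeg (2 * m + 1) (cfac h m t).
Proof.
move=> hh ht; rewrite addnC; apply: homdegM => //.
have -> : (2 * m = \sum_(i < m) 2)%N by rewrite sum_nat_const card_ord mulnC.
apply: homdeg_prod => i _; apply: homdegD.
  by rewrite expr2 -[2%N]/(1 + 1)%N; apply: homdegM.
apply: homdegN; rewrite exprMn -natrX -mpolyC_nat -[2%N]add0n; apply: homdegM; first exact: homdegC.
by rewrite expr2 -[2%N]/(1 + 1)%N; apply: homdegM.
Qed.

Lemma homdeg_antidiff (R : realType) (n : nat) (h t : {mpoly R[n]}) (k : nat -> R)
    (cs : seq {mpoly R[n]}) :
  homdeg 1 h -> homdeg 1 t -> (forall c, c \in cs -> homdeg 2 c) ->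
  homdeg (2 * size cs + 1) (antidiff h (fun m => (k m)%:MP) cs t).
Proof.
move=> hh ht hcs; apply: homdeg_sum => m _.
have ms : (m <= size cs)%N by rewrite -ltnS ltn_ord.
have -> : (2 * size cs + 1 = 2 * (size cs - m) + 0 + (2 * m + 1))%N.
  by rewrite -[in LHS](subnK ms); lia.
apply: homdegM; last exact: homdeg_cfac.
apply: homdegM; last exact: homdegC.
by apply: homdeg_newton => //; rewrite subnKC.
Qed.

Lemma size_antidiff (R : realType) (h : R) (k : nat -> R) (cs : seq R) :
  (size (antidiff h%:P (fun m => (k m)%:P) [seq c%:P | c <- cs] 'X) <= 2 * size cs + 2)%N.
Proof.
apply: (leq_trans (size_sum _ _ _)); apply/bigmax_leqP => m _.
rewrite -(rmorph_newton polyC) -polyCM mul_polyC.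
apply: (leq_trans (size_scale_leq _ _)).
rewrite /cfac; apply: (leq_trans (size_polyMleq _ _)); rewrite size_polyX /=.
have : (size (\prod_(i < m) ('X ^+ 2 - ((2 * i + 2)%:R * h%:P) ^+ 2) : {poly R})%R <= 2 * m + 1)%N.
  elim: (nat_of_ord m) => [|j IH]; first by rewrite big_ord0 size_poly1.
  rewrite big_ord_recr /=; apply: (leq_trans (size_polyMleq _ _)).
  have -> : ((2 * j + 2)%:R * h%:P) ^+ 2 = (((2 * j + 2)%:R * h) ^+ 2)%:P :> {poly R}.
    by rewrite rmorphXn rmorphM rmorph_nat.
  rewrite size_XnsubC // addn3 /=.
  by have -> : (2 * j.+1 + 1 = (2 * j + 1).+2)%N by lia.
have ms : (m <= size cs)%N.
  by have := ltn_ord m; rewrite ltnS => /leq_trans; apply; rewrite size_map.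
move=> /(leq_add (leqnn 1)) H; apply: (leq_trans H).
by move: ms; move: (nat_of_ord m) => m'; lia.
Qed.

Lemma odd_eq0 (R : realType) (x : R) : x = - x -> x = 0.
Proof. by move=> E; lra. Qed.

Lemma antidiff_flat (R : realType) (h : R) (iota : nat -> R) (cs : seq R) (t : R) :
  (forall m, (2 * m + 1)%:R * iota m = 1) -> t ^+ 2 \in cs ->
  antidiff h iota cs (t + h) = antidiff h iota cs (t - h).
Proof.
move=> iotaE tcs; apply/eqP; rewrite -subr_eq0 antidiffE //.
by rewrite (big_rem _ tcs) /= subrr mul0r mulr0.
Qed.

Lemma antidiff_chain (R : realType) (h x : R) (iota : nat -> R) (cs : seq R) (a u : nat) :
  (forall m, (2 * m + 1)%:R * iota m = 1) ->
  (forall u, (u < a)%N -> (x + (2 * u%:R + 1 - a%:R) * h) ^+ 2 \in cs) -> (u <= a)%N ->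
  antidiff h iota cs (x + (2 * u%:R - a%:R) * h) = antidiff h iota cs (x + a%:R * h).
Proof.
move=> iotaE chain ua.
have F v : (v <= a)%N ->
    antidiff h iota cs (x + (2 * v%:R - a%:R) * h) = antidiff h iota cs (x - a%:R * h).
  elim: v => [|v IH] va; first by congr antidiff; ring.
  rewrite -IH 1?ltnW //; have := antidiff_flat h iotaE (chain v va).
  move=> E; transitivity (antidiff h iota cs (x + (2 * v%:R + 1 - a%:R) * h + h)).
    by congr antidiff; rewrite -natr1; ring.
  by rewrite E; congr antidiff; ring.
by rewrite F // -(F a (leqnn a)); congr antidiff; ring.
Qed.

Lemma antidiff_zero (R : realType) (h : R) (iota : nat -> R) (cs : seq R) (r q : nat) :
  (forall m, (2 * m + 1)%:R * iota m = 1) ->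
  (forall i, (i < r)%N -> (i%:R * h) ^+ 2 \in cs) -> (q <= r)%N ->
  antidiff h iota cs (q%:R * h) = 0.
Proof.
move=> iotaE zer; elim/ltn_ind: q => -[|[|q]] IH qr.
- by apply: odd_eq0; rewrite -antidiff_odd mul0r oppr0.
- apply: odd_eq0; rewrite -antidiff_odd mul1r.
  have := antidiff_flat h iotaE (zer 0%N qr); by rewrite mul0r add0r sub0r.
rewrite -(IH q) //; last by apply: leq_trans qr; rewrite ltnW.
have := antidiff_flat h iotaE (zer q.+1 qr); rewrite -!natr1 => E.
rewrite [LHS](_ : _ = antidiff h iota cs ((q%:R + 1) * h + h)); last by congr antidiff; ring.
by rewrite E; congr antidiff; ring.
Qed.


Lemma eq_antidiff (S : comNzRingType) (h : S) (iota iota' : nat -> S) (cs cs' : seq S) (t : S) :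
  iota =1 iota' -> cs = cs' -> antidiff h iota cs t = antidiff h iota' cs' t.
Proof. by move=> ii <-; apply: eq_bigr => m _; rewrite ii. Qed.

Definition inv_odd (R : realType) (m : nat) : R := ((2 * m + 1)%:R)^-1.

Lemma inv_oddE (R : realType) (m : nat) : (2 * m + 1)%:R * inv_odd R m = 1.
Proof. by rewrite mulfV // pnatr_eq0; lia. Qed.

Definition half_z (R : realType) (l : nat) : {mpoly R[l + 1]} := 2^-1 *: 'X_(zcoord l).

Definition fixed_roots (R : realType) (l a r : nat) : seq {mpoly R[l + 1]} :=
  [seq ('X_(lshift 1 i) + (2 * u%:R + 1 - a%:R) *: half_z R l) ^+ 2
     | i <- enum 'I_l, u <- iota 0 a] ++
  [seq (i%:R *: half_z R l) ^+ 2 | i <- iota 0 r].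

Definition base_roots (R : realType) (l a r k : nat) : seq {mpoly R[l + 1]} :=
  fixed_roots R l a r ++ nseq k 0.

Definition base_field (R : realType) (l a r k : nat) (i : 'I_l) : {mpoly R[l + 1]} :=
  antidiff (half_z R l) (fun m => (inv_odd R m)%:MP) (base_roots R l a r k)
    ('X_(lshift 1 i) + a%:R *: half_z R l).

Definition half_zv (R : realType) (l : nat) (v : 'rV[R]_(l + 1)) : R :=
  2^-1 * v 0 (zcoord l).

Definition eval_roots (R : realType) (l a r k : nat) (v : 'rV[R]_(l + 1)) : seq R :=
  [seq c.@[v 0] | c <- base_roots R l a r k].

Lemma meval_base_field (R : realType) (l a r k : nat) (i : 'I_l) (v : 'rV[R]_(l + 1)) :
  (base_field R a r k i).@[v 0] =
  antidiff (half_zv v) (inv_odd R) (eval_roots a r k v) (v 0 (lshift 1 i) + a%:R * half_zv v).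
Proof.
have hz : (half_z R l).@[v 0] = half_zv v by rewrite mevalZ mevalXU.
rewrite /base_field rmorph_antidiff /= hz mevalD mevalXU (mevalZ _ a%:R) hz.
by apply: eq_antidiff => // m; rewrite mevalC.
Qed.

Lemma eval_roots_chain (R : realType) (l a r k : nat) (i : 'I_l) (v : 'rV[R]_(l + 1)) (u : nat) :
  (u < a)%N ->
  (v 0 (lshift 1 i) + (2 * u%:R + 1 - a%:R) * half_zv v) ^+ 2 \in eval_roots a r k v.
Proof.
move=> ua; apply/mapP.
exists (('X_(lshift 1 i) + (2 * u%:R + 1 - a%:R) *: half_z R l) ^+ 2); last first.
  by rewrite rmorphXn /= mevalD !mevalZ !mevalXU.
rewrite !mem_cat; apply/orP; left; apply/orP; left; apply/allpairsP.
by exists (i, u); rewrite mem_enum mem_iota.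
Qed.

Lemma eval_roots_zero (R : realType) (l a r k : nat) (v : 'rV[R]_(l + 1)) (i : nat) :
  (i < r)%N -> (i%:R * half_zv v) ^+ 2 \in eval_roots a r k v.
Proof.
move=> ir; apply/mapP; exists ((i%:R *: half_z R l) ^+ 2); last first.
  by rewrite rmorphXn /= !mevalZ !mevalXU.
rewrite !mem_cat; apply/orP; left; apply/orP; right; apply/mapP.
by exists i; rewrite ?mem_iota.
Qed.

Lemma base_field_minus (R : realType) (l a r k s : nat) (i j : 'I_l) (v : 'rV[R]_(l + 1)) :
  (s <= a)%N -> v 0 (lshift 1 i) - v 0 (lshift 1 j) = s%:R * v 0 (zcoord l) ->
  (base_field R a r k i).@[v 0] = (base_field R a r k j).@[v 0].
Proof.
move=> sa E; apply: etrans (meval_base_field a r k i v) _.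
apply: etrans _ (esym (meval_base_field a r k j v)).
rewrite -(@antidiff_chain R _ (v 0 (lshift 1 i)) _ _ a (a - s) (@inv_oddE R)) ?leq_subr //.
  by congr antidiff; rewrite natrB // /half_zv; lra.
by move=> u ua; apply: eval_roots_chain.
Qed.

Lemma base_field_plus (R : realType) (l a r k s : nat) (i j : 'I_l) (v : 'rV[R]_(l + 1)) :
  (s <= a)%N -> v 0 (lshift 1 i) + v 0 (lshift 1 j) = s%:R * v 0 (zcoord l) ->
  (base_field R a r k i).@[v 0] = - (base_field R a r k j).@[v 0].
Proof.
move=> sa E; apply: etrans (meval_base_field a r k i v) _.
apply: etrans _ (congr1 -%R (esym (meval_base_field a r k j v))).
rewrite -(@antidiff_chain R _ (v 0 (lshift 1 i)) _ _ a (a - s) (@inv_oddE R)) ?leq_subr //; last first.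
  by move=> u ua; apply: eval_roots_chain.
rewrite -(@antidiff_chain R _ (v 0 (lshift 1 j)) _ _ a 0 (@inv_oddE R)) //; last first.
  by move=> u ua; apply: eval_roots_chain.
by rewrite -antidiff_odd; congr antidiff; rewrite natrB // /half_zv; lra.
Qed.

Lemma base_field_plusN (R : realType) (l a r k s : nat) (i j : 'I_l) (v : 'rV[R]_(l + 1)) :
  (s <= a)%N -> v 0 (lshift 1 i) + v 0 (lshift 1 j) = - (s%:R * v 0 (zcoord l)) ->
  (base_field R a r k i).@[v 0] = - (base_field R a r k j).@[v 0].
Proof.
move=> sa E; apply: etrans (meval_base_field a r k i v) _.
apply: etrans _ (congr1 -%R (esym (meval_base_field a r k j v))).
rewrite -[in RHS](@antidiff_chain R _ (v 0 (lshift 1 j)) _ _ a s (@inv_oddE R)) //; last first.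
  by move=> u ua; apply: eval_roots_chain.
by rewrite -antidiff_odd; congr antidiff; rewrite /half_zv; lra.
Qed.

Lemma base_field_single (R : realType) (l a r k q : nat) (i : 'I_l) (v : 'rV[R]_(l + 1)) :
  (q <= a + r)%N -> v 0 (lshift 1 i) = q%:R / 2 * v 0 (zcoord l) ->
  (base_field R a r k i).@[v 0] = 0.
Proof.
move=> qar E; have [qa|aq] := leqP q a.
  by apply: odd_eq0; apply: (@base_field_plus R l a r k q i i v) => //; lra.
rewrite (meval_base_field a r k i) -(@antidiff_chain R _ (v 0 (lshift 1 i)) _ _ a 0 (@inv_oddE R)) //; last first.
  by move=> u ua; apply: eval_roots_chain.
rewrite -[RHS](@antidiff_zero R (half_zv v) (inv_odd R) (eval_roots a r k v) r (q - a) (@inv_oddE R)).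
- by congr antidiff; rewrite natrB 1?ltnW // /half_zv; lra.
- by move=> u ur; apply: eval_roots_zero.
by lia.
Qed.

Lemma base_field_singleN (R : realType) (l a r k q : nat) (i : 'I_l) (v : 'rV[R]_(l + 1)) :
  (q <= a + r)%N -> v 0 (lshift 1 i) = - (q%:R / 2 * v 0 (zcoord l)) ->
  (base_field R a r k i).@[v 0] = 0.
Proof.
move=> qar E; have [qa|aq] := leqP q a.
  by apply: odd_eq0; apply: (@base_field_plusN R l a r k q i i v) => //; lra.
rewrite (meval_base_field a r k i); apply: oppr_inj; rewrite oppr0 -antidiff_odd.
rewrite -[RHS](@antidiff_zero R (half_zv v) (inv_odd R) (eval_roots a r k v) r (q - a) (@inv_oddE R)).
- by congr antidiff; rewrite natrB 1?ltnW // /half_zv; lra.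
- by move=> u ur; apply: eval_roots_zero.
by lia.
Qed.

Lemma size_base_roots (R : realType) (l a r k : nat) :
  size (base_roots R l a r k) = (l * a + r + k)%N.
Proof.
by rewrite /base_roots /fixed_roots !size_cat size_allpairs size_enum_ord size_map !size_iota size_nseq.
Qed.

Lemma homdeg_base_field (R : realType) (l a r k : nat) (i : 'I_l) :
  homdeg (2 * (l * a + r + k) + 1) (base_field R a r k i).
Proof.
have hh : homdeg 1 (half_z R l) by move=> v; rewrite !mevalZ homdegX; ring.
have hZ (c : R) : homdeg 1 (c *: half_z R l) by move=> v; rewrite !mevalZ homdegX; ring.
have h2 (p : {mpoly R[l + 1]}) : homdeg 1 p -> homdeg 2 (p ^+ 2).
  by move=> hp; rewrite expr2 -[2%N]/(1 + 1)%N; apply: homdegM.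
rewrite -(size_base_roots R); apply: homdeg_antidiff => //.
  by apply: homdegD => //; apply: homdegX.
move=> c; rewrite !mem_cat => /orP[/orP[]|].
- by case/allpairsP=> -[j u] [_ _ ->]; apply/h2/homdegD => //; apply: homdegX.
- by case/mapP=> j _ ->; apply: h2.
by move/nseqP=> [-> _]; apply: homdeg0.
Qed.

Definition base_mx (R : realType) (l a r : nat) : 'M[{mpoly R[l + 1]}]_(l + 1) :=
  \matrix_(x, y) match split x with
    | inl k => if split y is inl i then base_field R a r k i else 0
    | inr _ => 'X_y end.

Lemma base_mx_tangent (R : realType) (l a r : nat) (T : seq int) x H :
  (forall q, q \in T -> (absz q <= a + r)%N) ->
  H \in cone (typeB R l a T) -> tangent H (row x (base_mx R l a r)).
Proof.
move=> hT; case: (split_ordP x) => k ->; last first.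
  have E (v : 'rV[R]_(l + 1)) : map_mx (meval (v 0)) (row (rshift l k) (base_mx R l a r)) = v.
    by apply/rowP => y; rewrite !mxE (unsplitK (inr k)) mevalXU.
  by move=> _ v; rewrite E.
have Ex (v : 'rV[R]_(l + 1)) i : map_mx (meval (v 0)) (row (lshift 1 k) (base_mx R l a r)) 0 (lshift 1 i)
    = (base_field R a r k i).@[v 0].
  by rewrite !mxE (unsplitK (inl k)) (unsplitK (inl i)).
have Ez (v : 'rV[R]_(l + 1)) : map_mx (meval (v 0)) (row (lshift 1 k) (base_mx R l a r)) 0 (zcoord l) = 0.
  by rewrite !mxE (unsplitK (inl k)) (unsplitK (inr ord0)) meval0.
case/typeBP => [|i j s ij hs|i j s ij hs|i q qT] v.
- by rewrite !mem_infinity Ez eqxx.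
- rewrite !mem_plus Ez !Ex mulr0 addr_eq0 => /eqP E; apply/eqP.
  move: hs; rewrite mem_int_range => /andP[s1 s2]; case: (intP s) E s1 s2 => [|n|n] E s1 s2.
  + by apply: (@base_field_plus R l a r k 0 _ _ v).
  + by apply: (@base_field_plus R l a r k n.+1 _ _ v); rewrite // E.
  by apply: (@base_field_plusN R l a r k n.+1 _ _ v); [lia|rewrite E rmorphN mulNr].
- rewrite !mem_minus Ez !Ex mulr0 subr_eq0 => /eqP E; apply/eqP.
  move: hs; rewrite mem_int_range => /andP[s1 s2]; case: (intP s) E s1 s2 => [|n|n] E s1 s2.
  + by apply: (@base_field_minus R l a r k 0 _ _ v).
  + by apply: (@base_field_minus R l a r k n.+1 _ _ v); rewrite // E.
  apply/esym/(@base_field_minus R l a r k n.+1 _ _ v); first by lia.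
  by rewrite -opprB E rmorphN mulNr opprK.
rewrite !mem_single Ez !Ex mulr0 => /eqP E; apply/eqP.
have := hT q qT; case: (intP q) E => [|n|n] E qar.
- by apply: (@base_field_single R l a r k 0 _ v).
- by apply: (@base_field_single R l a r k n.+1 _ v); rewrite // E.
apply: (@base_field_singleN R l a r k n.+1 _ v); first by move: qar; rewrite abszN.
by rewrite E rmorphN mulNr mulNr.
Qed.

Lemma horner_antidiff (R : realType) (h : R) (k : nat -> R) (cs : seq R) (t : R) :
  (antidiff h%:P (fun m => (k m)%:P) [seq c%:P | c <- cs] 'X).[t] = antidiff h k cs t.
Proof.
transitivity (antidiff (h%:P).[t] (fun m => ((k m)%:P).[t])
  [seq p.[t] | p <- [seq c%:P | c <- cs]] ('X : {poly R}).[t]).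
  exact: (rmorph_antidiff (horner_eval t)).
rewrite hornerC hornerX.
apply: eq_antidiff => [m|]; first by rewrite hornerC.
by rewrite -map_comp map_id_in // => c _ /=; rewrite hornerC.
Qed.

(* At [base_point], where [z = 2], the chains [x_i + {-a, .., a}] are spaced so as
   to be disjoint from each other, from their opposites and from [[-r, r]]. *)
Definition root_ints (l a r : nat) : seq int :=
  let B := (2 * (a + r).+1)%N in
  let pos := [seq (i.+1 * B)%:Z + 2 * u%:Z - a%:Z | i <- iota 0 l, u <- iota 0 a.+1] in
  pos ++ [seq - q | q <- pos] ++ int_range r.

Lemma uniq_root_ints (l a r : nat) : uniq (root_ints l a r).
Proof.
rewrite /root_ints; set B := (2 * (a + r).+1)%N; set pos := [seq _ | i <- _, u <- _].
have posP q : q \in pos -> r%:Z < q.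
  case/allpairsP=> -[i u] [_ /= _ ->]; rewrite mulSn; move: (i * B)%N => x.
  by rewrite /B; lia.
have upos : uniq pos.
  apply: allpairs_uniq; rewrite ?iota_uniq // => z z'.
  case/allpairsP=> -[i u] [_ hu ->]; case/allpairsP=> -[i' u'] [_ hu' ->] /= E.
  have {}hu : (u < a.+1)%N by move: hu; rewrite mem_iota.
  have {}hu' : (u' < a.+1)%N by move: hu'; rewrite mem_iota.
  have E' : (i.+1 * B + 2 * u = i'.+1 * B + 2 * u')%N by lia.
  have B0 : (0 < B)%N by rewrite /B.
  have uB : (2 * u < B)%N by rewrite /B; lia.
  have uB' : (2 * u' < B)%N by rewrite /B; lia.
  have := congr1 (divn^~ B) E'; rewrite /= !divnMDl // !divn_small // !addn0 => -[ii].
  by move: E'; rewrite ii => /addnI uu; congr (_, _); lia.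
rewrite !cat_uniq; apply/and5P; split; rewrite ?(map_inj_uniq oppr_inj) ?uniq_int_range //.
  apply/hasPn => q.
  rewrite mem_cat => /orP[/mapP[q' /posP h ->]|]; first by apply/negP => /posP; lia.
  by rewrite mem_int_range => h; apply/negP => /posP; lia.
apply/hasPn => q; rewrite mem_int_range => h.
by apply/negP => /mapP[q' /posP h' E]; lia.
Qed.

Lemma size_root_ints (l a r : nat) :
  size (root_ints l a r) = (2 * (l * a + l + r) + 1)%N.
Proof.
rewrite /root_ints !size_cat size_map size_allpairs size_map !size_iota; ring.
Qed.

Definition base_point (R : realType) (l a r : nat) : 'rV[R]_(l + 1) :=
  \row_x match split x with
    | inl i => (i.+1 * (2 * (a + r).+1))%:R | inr _ => 2 end.

Lemma base_roots_point (R : realType) (l a r k : nat) :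
  eval_roots a r k (base_point R l a r) =
  [seq c.@[base_point R l a r 0] | c <- fixed_roots R l a r] ++ nseq k 0.
Proof. by rewrite /eval_roots map_cat map_nseq meval0. Qed.

Lemma base_independent (R : realType) (l a r : nat) (w : 'I_l -> R) :
  (forall i : 'I_l, \sum_(k < l) w k * (base_field R a r k i).@[base_point R l a r 0] = 0) ->
  forall k, w k = 0.
Proof.
move=> dep; set v := base_point R l a r in dep *.
have hv : half_zv v = 1 by rewrite /half_zv mxE (unsplitK (inr ord0)) mulVf ?pnatr_eq0.
pose F k := antidiff (1 : R) (inv_odd R) (eval_roots a r k v).
pose P k : {poly R} := antidiff 1%:P (fun m => (inv_odd R m)%:P) [seq c%:P | c <- eval_roots a r k v] 'X.
have PF k t : (P k).[t] = F k t by exact: horner_antidiff.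
pose G := \sum_(k < l) w k *: P k.
have GE t : G.[t] = \sum_(k < l) w k * F k t.
  by rewrite /G horner_sum; apply: eq_bigr => k _; rewrite hornerZ PF.
have Gx i u : (u <= a)%N -> G.[v 0 (lshift 1 i) + (2 * u%:R - a%:R)] = 0.
  move=> ua; rewrite GE -[RHS](dep i); apply: eq_bigr => k _; congr (_ * _).
  apply: etrans _ (esym (meval_base_field a r k i v)).
  rewrite -(@antidiff_chain R _ _ _ _ a u (@inv_oddE R)) //; last first.
    by move=> u' u'a; apply: eval_roots_chain.
  by rewrite /F hv mulr1.
have Godd t : G.[- t] = - G.[t].
  by rewrite !GE -sumrN; apply: eq_bigr => k _; rewrite /F antidiff_odd mulrN.
have G0 (q : nat) : (q <= r)%N -> G.[q%:R] = 0.
  move=> qr; rewrite GE big1 // => k _; rewrite /F -[q%:R]mulr1.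
  rewrite (antidiff_zero (r := r) (@inv_oddE R)) ?mulr0 // => i ir.
  by have := eval_roots_zero a k v ir; rewrite hv.
have Groot q : q \in root_ints l a r -> root G q%:~R.
  rewrite /root_ints; set pos := [seq _ | i <- _, u <- _].
  have posroot q' : q' \in pos -> G.[q'%:~R] = 0.
    case/allpairsP=> -[i u] [hi hu ->] /=.
    have {}hi : (i < l)%N by move: hi; rewrite mem_iota.
    have {}hu : (u < a.+1)%N by move: hu; rewrite mem_iota.
    rewrite -[RHS](Gx (Ordinal hi) u hu); congr (_.[_]).
    rewrite mxE (unsplitK (inl (Ordinal hi))) /= rmorphB rmorphD rmorphM /=.
    by rewrite addrA.
  rewrite !mem_cat => /or3P[/posroot/eqP //|/mapP[q' /posroot h ->]|].
    by rewrite /root rmorphN /= Godd h oppr0.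
  rewrite mem_int_range; case: (intP q) => [|n|n] h; apply/eqP.
  - exact: (G0 0%N).
  - by apply: (G0 n.+1); lia.
  by rewrite rmorphN /= Godd (G0 n.+1) ?oppr0 //; lia.
have {Groot} Gz : G = 0.
  apply/eqP; apply: contraT => Gn0.
  have ur : uniq [seq q%:~R : R | q <- root_ints l a r].
    by rewrite map_inj_uniq ?uniq_root_ints //; apply: intr_inj.
  have ar : all (root G) [seq q%:~R : R | q <- root_ints l a r].
    by apply/allP => _ /mapP[q /Groot h ->].
  have := max_poly_roots Gn0 ar ur; rewrite size_map size_root_ints ltnNge => /negP[].
  apply: (leq_trans (size_sum _ _ _)); apply/bigmax_leqP => k _.
  apply: (leq_trans (size_scale_leq _ _)); apply: (leq_trans (size_antidiff _ _ _)).
  by rewrite size_map size_base_roots; move: (ltn_ord k); move: (nat_of_ord k) => k'; lia.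
pose K := \prod_(c <- [seq c.@[v 0] | c <- fixed_roots R l a r]) ('X^2 - c%:P).
have KW : K * \sum_(k < l) w k *: 'X^(2 * k) = 0.
  apply: poly_horner_inj => t; have D : G.[t + 1] - G.[t - 1] = 0 by rewrite Gz !horner0 subrr.
  rewrite hornerM horner_sum mulr_sumr.
  apply: (mulfI (x := 2%:R)); first by rewrite pnatr_eq0.
  rewrite mulr0 -[RHS]D !GE -sumrB mulr_sumr; apply: eq_bigr => k _.
  rewrite -mulrBr /F (antidiffE _ _ _ (@inv_oddE R)) base_roots_point big_cat /= -/v.
  rewrite big_nseq /= hornerZ hornerXn mulr1 /K horner_prod.
  have -> : iter k ( *%R (t ^+ 2 - 0)) 1 = t ^+ (2 * k).
    by rewrite subr0 exprM iter_mulr_1.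
  have -> : \prod_(i <- [seq c.@[v 0] | c <- fixed_roots R l a r]) ('X^2 - i%:P).[t] =
    \prod_(i <- [seq c.@[v 0] | c <- fixed_roots R l a r]) (t ^+ 2 - i).
    by apply: eq_bigr => c _; rewrite !hornerE.
  ring.
have K0 : K != 0.
  rewrite /K prodf_seq_neq0; apply/allP => c _ /=.
  by rewrite -size_poly_eq0 size_XnsubC.
move/eqP: KW; rewrite mulf_eq0 (negPf K0) /= => /eqP W k.
have := congr1 (fun p : {poly R} => p`_(2 * k)) W; rewrite /= coef0 coef_sum => <-.
rewrite (bigD1 k) //= big1 => [|j jk]; first by rewrite coefZ coefXn eqxx mulr1 addr0.
rewrite coefZ coefXn; case: eqP => [E|]; last by rewrite mulr0.
case/eqP: jk; apply: val_inj; move/eqP: E.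
by rewrite eqn_pmul2l // => /eqP/esym.
Qed.

Lemma det_base_mx (R : realType) (l a r : nat) : \det (base_mx R l a r) != 0.
Proof.
apply/negP => /eqP d0; pose v := base_point R l a r.
have : \det (map_mx (meval (v 0)) (base_mx R l a r)) == 0.
  by rewrite (det_map_mx (meval (v 0))) d0 rmorph0.
case/det0P => w w0 wM; case/negP: w0; apply/eqP.
have E y := congr1 (fun M : 'rV_(l + 1) => M 0 y) wM.
have wz : w 0 (zcoord l) = 0.
  have := E (zcoord l); rewrite mxE big_split_ord /= big1 ?add0r => [|k _]; last first.
    by rewrite !mxE (unsplitK (inl k)) (unsplitK (inr ord0)) meval0 mulr0.
  rewrite big_ord1 !mxE (unsplitK (inr ord0)) mevalXU mxE (unsplitK (inr ord0)).
  by move/eqP; rewrite mulf_eq0 pnatr_eq0 orbF => /eqP.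
have wx := @base_independent R l a r (fun k => w 0 (lshift 1 k)).
apply: rV_coordP => [k|]; last by rewrite wz mxE.
rewrite [RHS]mxE; apply: (wx _ k) => i.
have := E (lshift 1 i); rewrite mxE big_split_ord /= big_ord1 wz mul0r addr0 mxE => E'.
rewrite -[RHS]E'; by apply: eq_bigr => k' _; rewrite !mxE (unsplitK (inl k')) (unsplitK (inl i)).
Qed.

Lemma sum_exponents (E l : nat) :
  sumn [seq (E + 2 * k)%N | k <- iota 0 l] = (l * E + l * l.-1)%N.
Proof.
elim: l => // l IH; rewrite -[in iota _ _]addn1 iotaD map_cat sumn_cat IH /=.
by case: l {IH} => [|l] /=; lia.
Qed.

Lemma normalized_neq0 (R : realType) (n : nat) (c : 'cV[R]_n) : normalized c -> c != 0.
Proof.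
by case=> i [ci _]; apply/eqP => c0; move/eqP: ci; rewrite c0 mxE eq_sym oner_eq0.
Qed.

Lemma saito_base (R : realType) (l a M : nat) : (a <= 2 * M)%N ->
  saito (cone (typeB R l a (half_range M M))) (typeB_exponents l a (M + M)).
Proof.
move=> aM; pose r := (2 * M - a)%N; have ar : (a + r = 2 * M)%N by rewrite subnKC.
pose es := [seq (2 * (M + M) + 1 + 2 * a * l.-1 + 2 * k)%N | k <- iota 0 l].
have szes : size es = l by rewrite size_map size_iota.
apply: (@saito_perm _ _ _ (rcons es 1%N)); first by rewrite perm_rcons.
split; first by rewrite size_rcons szes addn1.
exists (base_mx R l a r).
have uC := uniq_cone_typeB R l a (uniq_half_range M M).
split.
- move=> H /typeBP[|i j s ij hs|i j s ij hs|i q qT].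
  + by exists (infinity_form R l) => //; apply/normalized_neq0/normalized_infinity.
  + exists (affine_form (coord_form R i + coord_form R j) s%:~R) => //.
    exact/normalized_neq0/normalized_plus.
  + exists (affine_form (coord_form R i - coord_form R j) s%:~R) => //.
    exact/normalized_neq0/normalized_minus.
  exists (affine_form (coord_form R i) (q%:~R / 2)) => //.
  exact/normalized_neq0/normalized_single.
- rewrite undup_id //= size_map size_typeB size_half_range.
  have -> : (\sum_(i < l + 1) nth 0 (rcons es 1) i)%N = sumn (rcons es 1%N).
    rewrite -(big_mkord xpredT (nth 0%N (rcons es 1%N))) sumnE [in RHS](big_nth 0%N).
    by rewrite size_rcons szes addn1.
  by rewrite sumn_rcons sum_exponents; case: (l) => [|l'] /=; nia.
- exact: det_base_mx.
- move=> x y; case: (split_ordP x) => k ->; rewrite mxE; last first.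
    rewrite (unsplitK (inr k)) nth_rcons szes /= [k]ord1 addn0 ltnn eqxx; exact: homdegX.
  rewrite (unsplitK (inl k)) nth_rcons szes /= ltn_ord (nth_map 0%N) ?size_iota // nth_iota // add0n.
  case: (split y) => [i|_]; last exact: homdeg0.
  have -> : (2 * (M + M) + 1 + 2 * a * l.-1 + 2 * k = 2 * (l * a + r + k) + 1)%N.
    by move: k i => [k kl] [i il] /=; case: (l) kl => [|l'] //= _; nia.
  exact: homdeg_base_field.
move=> x H; apply: base_mx_tangent => q /half_rangeP; rewrite ar.
by case=> -[k -> hk]; lia.
Qed.

Lemma typeB0 (R : realType) (a : nat) (T T' : seq int) :
  cone (typeB R 0 a T) =i cone (typeB R 0 a T').
Proof.
by move=> H; apply/idP/idP => /typeBP[|i|i|i]; try (by case: i);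
  apply/typeBP; apply: TypeBinf.
Qed.

Lemma saito_typeB (R : realType) (l a M N : nat) :
  saito (cone (typeB R l a (half_range M N))) (typeB_exponents l a (M + N)).
Proof.
elim: l M N => [|l IH] M N.
  have aa : (a <= 2 * a)%N by lia.
  exact: saito_eq_mem (@typeB0 R a _ _) (@saito_base R 0 a a aa).
have down_odd K j : saito (cone (typeB R l.+1 a (half_range K (j + N)))) (typeB_exponents l.+1 a (K + (j + N))) ->
    saito (cone (typeB R l.+1 a (half_range K N))) (typeB_exponents l.+1 a (K + N)).
  elim: j => [//|j IHj] s; apply: IHj.
  exact: (@typeB_step_odd R l a K (j + N) (IH K ((j + N).+1 + a)%N) s).
have down_even j : saito (cone (typeB R l.+1 a (half_range (j + M) N))) (typeB_exponents l.+1 a (j + M + N)) ->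
    saito (cone (typeB R l.+1 a (half_range M N))) (typeB_exponents l.+1 a (M + N)).
  elim: j => [//|j IHj] s; apply: IHj.
  exact: (@typeB_step_even R l a (j + M) N (IH ((j + M).+1 + a)%N N) s).
apply: (down_even (N + a)%N); apply: (down_odd (N + a + M)%N (M + a)%N).
have -> : (M + a + N = N + a + M)%N by lia.
by apply: saito_base; lia.
Qed.

Lemma half_double (R : realType) (x : int) : (2 * x)%:~R / 2 = x%:~R :> R.
Proof. by rewrite rmorphM /= mulrAC mulfV ?pnatr_eq0 // mul1r. Qed.

Lemma B0_typeB (R : realType) (l m a : nat) : B0 R l m a = typeB R l a (half_range m 0).
Proof.
have -> : half_range m 0 = [seq 2 * k | k <- int_range m] by rewrite /half_range muln0 cats0.
rewrite /B0 /typeB; congr (_ ++ (_ ++ _)); rewrite [RHS]allpairs_mapr.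
by apply: eq_allpairs => i s; rewrite half_double.
Qed.

Lemma subspace_frame_mem (R : realType) (n : nat) (X : {vspace 'rV[R]_n})
    (w : 'rV[R]_(\dim X)) : w *m subspace_frame X \in X.
Proof.
rewrite mulmx_sum_row; apply: memv_suml => i _; apply: memvZ; rewrite rowK.
by apply: vbasis_mem; apply: mem_nth; rewrite size_tuple.
Qed.

Lemma subspace_frame_inj (R : realType) (n : nat) (X : {vspace 'rV[R]_n})
    (w : 'rV[R]_(\dim X)) : w *m subspace_frame X = 0 -> w = 0.
Proof.
move=> w0; have /freeP fX := basis_free (vbasisP X).
apply/rowP => i; rewrite mxE; apply: (fX (fun i => w 0 i)).
by rewrite -[RHS]w0 mulmx_sum_row; apply: eq_bigr => j _; rewrite rowK.
Qed.

Lemma saito_restriction_frame (R : realType) (n k k' : nat) (A : arrangement R n)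
    (X : {vspace 'rV[R]_n}) (N : 'M[R]_(k, n)) (L : 'M[R]_(n, k)) (F : 'M[R]_(k', n))
    (B : arrangement R k) (e : seq nat) :
  k' = k -> N *m L = 1%:M -> (forall v, v \in X -> v *m L *m N = v) ->
  (forall w : 'rV_k', w *m F \in X) -> (forall w : 'rV_k', w *m F = 0 -> w = 0) ->
  (forall H, H \in A -> ~~ (X <= H)%VS -> preim_mx N H \in B) ->
  (forall K, K \in B -> exists2 H, H \in A & ~~ (X <= H)%VS /\ K = preim_mx N H) ->
  saito B e -> saito [seq preim_mx F (H :&: X)%VS | H <- A & ~~ (X <= H)%VS] e.
Proof.
move=> kk; subst k' => NL XN FX F0 AB BA sB.
have FE (w : 'rV_k) : w *m (F *m L) *m N = w *m F by rewrite mulmxA XN.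
have gu : F *m L \in unitmx.
  rewrite unitmxE unitfE; apply/negP => /det0P[w w0 wg]; case/negP: w0; apply/eqP.
  by apply: F0; rewrite -FE wg mul0mx.
have pE H : preim_mx F (H :&: X)%VS = preim_mx (F *m L) (preim_mx N H).
  by apply/vspaceP => w; rewrite !mem_preim_mx memv_cap FX andbT FE.
apply: saito_eq_mem (saito_preim gu sB) => K; apply/mapP/mapP.
  by move=> [K' /BA[H HA [XH ->]] ->]; exists H; rewrite ?pE // mem_filter XH.
move=> [H]; rewrite mem_filter => /andP[XH HA] ->; exists (preim_mx N H); last exact: pE.
exact: AB.
Qed.


(** * The flag *)

Definition flag_subst (l m a k : nat) (i : 'I_l) : 'I_k + int :=
  if insub (i : nat) is Some j then inl j
  else inr (2 * (m + (l - i.+1) * a)%:Z).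

Definition flag_space (R : realType) (l m a d : nat) : {vspace 'rV[R]_(l + 1)} :=
  (linfun (mulmxr (subst_mx R (@flag_subst l m a d.-1)) :
     'rV[R]_(d.-1 + 1) -> 'rV[R]_(l + 1)) @: fullv)%VS.

Lemma mem_flag_space (R : realType) (l m a d : nat) (v : 'rV[R]_(l + 1)) :
  (d.-1 <= l)%N ->
  reflect (forall i : 'I_l, (d.-1 <= i)%N ->
             v 0 (lshift 1 i) = (m + (l - i.+1) * a)%:R * v 0 (zcoord l))
    (v \in flag_space R l m a d).
Proof.
move=> dl; apply: (iffP memv_imgP) => [[w _ ->] i di|vE].
  rewrite lfunE /= subst_mx_x subst_mx_z /subst_val /flag_subst insubF; last by rewrite ltnNge di.
  by rewrite half_double.
exists (v *m coord_proj R (widen_ord dl)); rewrite ?memvf // lfunE /=.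
apply: rV_coordP => [i|]; last by rewrite subst_mx_z coord_proj_z.
rewrite subst_mx_x /subst_val /flag_subst; case: insubP => [j _ ij|].
  by rewrite coord_proj_x; congr (v 0 (lshift 1 _)); apply: val_inj.
rewrite -leqNgt => di; by rewrite coord_proj_z vE // half_double.
Qed.

Lemma flag_subst_widen (l m a k : nat) (kl : (k <= l)%N) (j : 'I_k) :
  flag_subst m a k (widen_ord kl j) = inl j.
Proof.
rewrite /flag_subst insubT //= => lt; by congr inl; apply: val_inj.
Qed.

Lemma flag_subst_mxK (R : realType) (l m a k : nat) (kl : (k <= l)%N) :
  subst_mx R (@flag_subst l m a k) *m coord_proj R (widen_ord kl) = 1%:M.
Proof. by apply: subst_mxK => j; apply: flag_subst_widen. Qed.

Lemma dim_flag_space (R : realType) (l m a d : nat) :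
  (0 < d)%N -> (d.-1 <= l)%N -> \dim (flag_space R l m a d) = d.
Proof.
move=> d0 dl; rewrite limg_dim_eq; first by rewrite dimvf /dim /= mul1n addn1 prednK.
apply/eqP; rewrite -subv0; apply/subvP => w; rewrite memv_cap memv_ker lfunE /= => /andP[_ /eqP w0].
by rewrite memv0 -[w]mulmx1 -(flag_subst_mxK R m a dl) mulmxA w0 mul0mx.
Qed.

Lemma mem_bigcap_seq (R : realType) (n : nat) (B : arrangement R n) (v : 'rV[R]_n) :
  (v \in \bigcap_(H <- B) H)%VS = all (fun H : {vspace 'rV[R]_n} => v \in H) B.
Proof.
elim: B => [|H B IH]; first by rewrite big_nil memvf.
by rewrite big_cons memv_cap IH.
Qed.

Lemma flag_space_in_L (R : realType) (l m a d : nat) : (d.-1 <= l)%N ->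
  in_L (cone (typeB R l a (half_range m 0))) (flag_space R l m a d).
Proof.
move=> dl; set A := cone _; set X := flag_space _ _ _ _ _.
exists [seq H <- A | (X <= H)%VS]; first by move=> H; rewrite mem_filter => /andP[].
apply/vspaceP => v; rewrite mem_bigcap_seq; apply/idP/allP => [vX H|vB].
  by rewrite mem_filter => /andP[/subvP XH _]; apply: XH.
have inX H : H \in A -> (forall w, w \in X -> w \in H) -> v \in H.
  by move=> HA XH; apply: vB; rewrite mem_filter HA andbT; apply/subvP.
apply/mem_flag_space => // i di; move jE : (l - i.+1)%N => j.
elim: j i di jE => [|j IH] i di jE.
  have : v \in hyperplane (affine_form (coord_form R i) ((2 * m%:Z)%:~R / 2)).
    apply: inX; first by apply: typeB_single; apply/half_rangeP; left; exists m%:Z => //; lia.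
    move=> w /(mem_flag_space m a w dl)/(_ i di); rewrite jE mul0n addn0 mem_single => ->.
    by rewrite half_double.
  by rewrite mem_single => /eqP ->; rewrite mul0n addn0 half_double.
have i'l : (i.+1 < l)%N by lia.
pose i' := Ordinal i'l; have j'E : (l - i'.+1 = j)%N by rewrite /=; lia.
have di' : (d.-1 <= i')%N by rewrite /=; lia.
have vi' := IH i' di' j'E.
have ii' : i != i' by rewrite -val_eqE /= neq_ltn ltnSn.
have : v \in hyperplane (affine_form (coord_form R i - coord_form R i') (a%:Z)%:~R).
  apply: inX; first by apply: typeB_minus => //; rewrite mem_int_range; lia.
  move=> w /(mem_flag_space m a w dl) wX; rewrite mem_minus (wX i di) (wX i' di') jE j'E.
  by apply/eqP; rewrite -mulrBl mulSn !natrD; ring.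
rewrite mem_minus vi' subr_eq => /eqP ->; rewrite mulSn !natrD; ring.
Qed.

Lemma flag_space_restriction (R : realType) (l m a d : nat) : (0 < d)%N -> (d.-1 <= l)%N ->
  saito (restriction (cone (typeB R l a (half_range m 0))) (flag_space R l m a d))
    (typeB_exponents d.-1 a (m + (l - d.-1) * a)).
Proof.
move=> d0 dl; have NL := flag_subst_mxK R m a dl.
set N := subst_mx _ _ in NL; set L := coord_proj _ _ in NL.
set X := flag_space _ _ _ _ _; set k := d.-1 in dl N L NL *.
have XN v : v \in X -> v *m L *m N = v.
  by case/memv_imgP=> w _ ->; rewrite lfunE /= -/k -/N -(mulmxA w N L) NL mulmx1.
have NX (w : 'rV_(k + 1)) : w *m N \in X.
  by apply/memv_imgP; exists w; rewrite ?memvf ?lfunE.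
have full H : (preim_mx N H == fullv) = (X <= H)%VS.
  apply/eqP/subvP => [E v /XN <-|XH]; first by rewrite -mem_preim_mx E memvf.
  by apply/vspaceP => w; rewrite mem_preim_mx memvf XH.
have sB := saito_typeB R k a (m + (l - k) * a) 0; rewrite addn0 in sB.
apply: (saito_restriction_frame _ NL XN (@subspace_frame_mem _ _ X)
  (@subspace_frame_inj _ _ X) _ _ sB).
- by rewrite dim_flag_space // /k addn1 prednK.
- move=> H HA; rewrite -full.
  have [|||->|//] := @typeB_restrict_sub R l k a _ (half_range (m + (l - k) * a) 0)
    (@flag_subst l m a k) H _ _ _ HA; last by rewrite eqxx.
  + move=> i i' j; rewrite /flag_subst; case: insubP => // x _ xi [<-].
    by case: insubP => // x' _ xi' [xx]; apply: val_inj; rewrite /= -xi -xi' xx.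
  + move=> q /half_rangeP[[s -> hs]|[s _ hs]]; last by lia.
    by move: (_ * a)%N => y; apply/half_rangeP; left; exists s => //; lia.
  move=> i q s; rewrite /flag_subst; case: insubP => // ik [<-].
  rewrite mem_int_range => hs; rewrite -leqNgt in ik.
  have il := ltn_ord i.
  have : (a + (l - i.+1) * a <= (l - k) * a)%N by rewrite -mulSn leq_mul2r; apply/orP; right; lia.
  move: (_ * a)%N (_ * a)%N => x y xy.
  split; apply/half_rangeP; left; [exists (s - (m + y)%:Z)|exists (s + (m + y)%:Z)]; lia.
move=> K KB.
have [||H HA KE] := @typeB_restrict_sup R l k a (half_range m 0) _ (@flag_subst l m a k) K _ _ KB.
- by move=> j; exists (widen_ord dl j); apply: flag_subst_widen.
- move=> t /half_rangeP[[s -> hs]|[s _ hs]]; last by lia.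
  have [ms|ms] := boolP (- m%:Z <= s <= m%:Z).
    by left; apply/half_rangeP; left; exists s.
  right; pose y := (absz s - m).-1; pose j := (y %/ a)%N.
  have sm : (m < absz s <= m + (l - k) * a)%N by lia.
  have a0 : (0 < a)%N by move: sm; case: (a) => //; rewrite muln0; lia.
  have jl : (j < l - k)%N by rewrite ltn_divLR // /y; lia.
  have il : (l - j.+1 < l)%N by lia.
  have := divn_eq y a; have := ltn_pmod y a0; rewrite -/j; set x := (y %% a)%N => xa yE.
  exists (Ordinal il), (2 * (m + j * a)%:Z).
  have sE : flag_subst m a k (Ordinal il) = inr (2 * (m + j * a)%:Z).
    rewrite /flag_subst insubF /=; last by lia.
    by have -> : (l - (l - j.+1).+1 = j)%N by lia.
  have ysE : (absz s = m + j * a + x.+1)%N by lia.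
  move: (j * a)%N sE ysE => z sE ysE.
  have [s0|s0] := lerP 0 s.
    exists x.+1%:Z; split=> //; first by rewrite mem_int_range; lia.
    by right; lia.
  exists (- x.+1%:Z); split=> //; first by rewrite mem_int_range; lia.
  by left; lia.
exists H => //; split=> //; rewrite -full -KE; apply/eqP => Kf.
have [_ [_ [hB _ _ _ _]]] := sB; have [c c0 cE] := hB K KB.
have [u uc] := cV_dual c0; have : u \in K by rewrite Kf memvf.
rewrite cE mem_hyperplane uc => /eqP/matrixP/(_ 0 0); rewrite !mxE => /eqP.
by rewrite oner_eq0.
Qed.

Lemma typeB_exponents_take (l a m k : nat) : (k <= l)%N ->
  take k.+1 (typeB_exponents l a m) = typeB_exponents k a (m + (l - k) * a).
Proof.
move=> kl; rewrite /= -map_take take_iota (minn_idPl kl); congr (_ :: _).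
apply/eq_in_map => i; rewrite mem_iota => /andP[_ ik]; congr (_ + _)%N.
case: k kl ik => [|k] kl ik; first by lia.
by rewrite -(subnK kl) addnK addnS /=; nia.
Qed.

Lemma typeB_flag_accurate (R : realType) (l m a : nat) :
  flag_accurate_with (cone (B0 R l m a)) (typeB_exponents l a m).
Proof.
rewrite B0_typeB; split.
- by rewrite /= size_map size_iota addn1.
- rewrite /= path_sortedE; last exact: leq_trans.
  apply/andP; split; first by apply/allP => _ /mapP[k _ ->]; rewrite (addn1 (2 * m)) !addSn.
  apply: (homo_sorted (e := leq)); last exact: iota_sorted.
  by move=> x y xy; lia.
- by apply: saito_free; have := saito_typeB R l a m 0; rewrite addn0.
exists (flag_space R l m a); split.
- apply/eqP; rewrite eqEsubv subvf /=; apply/subvP => v _.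
  have E : ((l + 1).-1 = l)%N by rewrite addn1.
  by apply/mem_flag_space; rewrite E // => i; rewrite leqNgt ltn_ord.
- move=> d /andP[d0 dl]; apply/subvP => v /mem_flag_space vX.
  apply/mem_flag_space => /= [|i di]; first by lia.
  by apply: vX; lia.
move=> d /andP[d0 dl]; have dl' : (d.-1 <= l)%N by lia.
split; [exact: flag_space_in_L | exact: dim_flag_space |].
apply: saito_free; rewrite -(prednK d0) typeB_exponents_take // prednK //.
exact: flag_space_restriction.
Qed.

Theorem theorem5p12 (R : realType) (m a l : nat) (hl : (1 <= l)%N) :
  flag_accurate (cone (B0 R l m a)) /\
  flag_accurate_with (cone (CatB R l m))
    (1%N :: [seq (2 * m * l + 2 * i - 1)%N | i <- iota 1 l]).
Proof.
split; first by exists (typeB_exponents l a m); apply: typeB_flag_accurate.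
have -> : 1%N :: [seq (2 * m * l + 2 * i - 1)%N | i <- iota 1 l] = typeB_exponents l m m.
  congr (_ :: _); rewrite (iotaDl 1 0) -map_comp; apply: eq_map => k /=.
  by case: l hl => // l' _ /=; nia.
exact: typeB_flag_accurate.
Qed.
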